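(* Let $A=\varinjlim_n\{A_n,\varphi_n\}$ ($n=1,2,\dots$) be an inductive limit C*-algebra, where each $A_n=\bigoplus_i A_n^i$ is a finite direct sum of homogeneous C*-algebras, $A_n^i$ being the C*-algebra of continuous sections of a locally trivial C*-bundle over a compact, connected, Hausdorff space $Z_n^i$ with fibre the matrix algebra $M_{r_n^i}$. Suppose that every connecting map $\varphi_n: A_n\to A_{n+1}$ is a unital, injective and maximally homogeneous homomorphism. If $A_1$ has a C*-diagonal, then $A$ has a C*-diagonal.
   Context: A sub-C*-algebra $B$ of a unital C*-algebra $A$ is a Cartan subalgebra if: $B$ is maximal abelian in $A$; $B$ is regular, i.e. the set of normalizers $N_A(B)=\{n\in A: nBn^*\subseteq B \text{ and } n^*Bn\subseteq B\}$ generates $A$ as a C*-algebra; and there is a faithful conditional expectation $P:A\to B$ onto $B$. A Cartan subalgebra $B$ of $A$ is a C*-diagonal if moreover every pure state of $B$ extends uniquely to a (necessarily pure) state of $A$. Put $Z_n=\coprod_i Z_n^i$, and for $x\in Z_n$ let $\mathrm{ev}_x$ denote evaluation at $x$, an irreducible representation of $A_n$ on the fibre at $x$; up to unitary equivalence every irreducible representation of $A_n$ is of this form. Homomorphism means $*$-homomorphism. If $\varphi:A_n\to A_{n+1}$ is a unital homomorphism, then for every $y\in Z_{n+1}$ the representation $\mathrm{ev}_y\circ\varphi$ is unitarily equivalent to $\bigoplus_{\mu\in M_y}\mathrm{ev}_{x_\mu}$ for some finite index set $M_y$ and points $x_\mu\in Z_n$. The homomorphism $\varphi$ is called maximally homogeneous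 if for every $y\in Z_{n+1}$ the points $x_\mu$, $\mu\in M_y$, are pairwise distinct. *)

(* Defs.v *)
From HB Require Import structures.
From mathcomp Require Import all_boot all_order all_algebra.
From mathcomp Require Import complex.
From mathcomp Require Import all_classical all_reals all_analysis.

Set Implicit Arguments.
Unset Strict Implicit.
Unset Printing Implicit Defensive.

Import Order.TTheory GRing.Theory Num.Theory.
Import numFieldNormedType.Exports.
Local Open Scope classical_set_scope.
Local Open Scope sesquilinear_scope.
Local Open Scope complex_scope.
Local Open Scope ring_scope.

(* The topology of [R[i]] is the one given by its modulus. *)
HB.instance Definition _ (R : realType) := NormedModule.copy R[i] R[i]^o.

(* Unital C*-algebras.  As [GRing.Algebra] extends [NzRing], they are nonzero.
   The norm is a field of the mixin, and [entourage_cnorm] says that the uniform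
   structure is the one of the norm, because the library has no join of its rings
   and its normed modules. *)
HB.mixin Record isCStar (R : realType) A
    of Tvs R[i] A & GRing.Algebra R[i] A := {
  star : A -> A;
  cnorm : A -> R;
  starK : involutive star;
  starD : {morph star : a b / a + b};
  starZ : forall (c : R[i]) a, star (c *: a) = Num.conj c *: star a;
  starM : forall a b, star (a * b) = star b * star a;
  cnorm0_eq0 : forall a, cnorm a = 0 -> a = 0;
  ler_cnormD : forall a b, cnorm (a + b) <= cnorm a + cnorm b;
  cnormZ : forall (c : R[i]) a, cnorm (c *: a) = complex.Re `|c| * cnorm a;
  ler_cnormM : forall a b, cnorm (a * b) <= cnorm a * cnorm b;
  cnorm_starM : forall a, cnorm (star a * a) = cnorm a ^+ 2;
  entourage_cnorm : forall E : set (A * A), entourage E <->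
    exists2 e : R, 0 < e & forall a b, cnorm (a - b) < e -> E (a, b);
  cnorm_complete : forall F : set_system A,
    ProperFilter F -> cauchy F -> exists a : A, F --> a
}.

#[short(type="cstarType")]
HB.structure Definition CStar (R : realType) :=
  {A of Tvs R[i] A & GRing.Algebra R[i] A & isCStar R A}.

Section Diagonals.
Variables (R : realType) (A : cstarType R).
Implicit Types (B N : set A) (f g h : A -> R[i]).

(* A sub-C*-algebra is not assumed to contain the unit of [A]. *)
Definition sub_cstar B : Prop :=
  [/\ B 0, forall (c : R[i]) a b, B a -> B b -> B (c *: a + b),
      forall a b, B a -> B b -> B (a * b),
      forall a, B a -> B (star a) & closed B].

Definition generated_cstar N : set A :=
  \bigcap_(B in [set B | sub_cstar B /\ N `<=` B]) B.

Definition commutative B : Prop := forall a b, B a -> B b -> a * b = b * a.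

Definition maximal_abelian B : Prop :=
  commutative B /\
  forall B', sub_cstar B' -> commutative B' -> B `<=` B' -> B' = B.

Definition normalizers B : set A :=
  [set n | forall b, B b -> B (n * b * star n) /\ B (star n * b * n)].

Definition regular_sub B : Prop := generated_cstar (normalizers B) = setT.

Definition positive (a : A) : Prop := exists b, a = star b * b.

(* A map onto [B] is encoded as a map [A -> A] with values in [B].  Complete
   positivity follows from positivity and the bimodule property:
   sum_ij b_i^* P(a_i^* a_j) b_j = P (c^* c) with c = sum_i a_i b_i. *)
Definition conditional_expectation B (P : A -> A) : Prop :=
  [/\ linear P, forall a, B (P a), forall b, B b -> P b = b,
      forall a, positive a -> positive (P a) & forall a, cnorm (P a) <= cnorm a]
  /\ forall b a b', B b -> B b' -> P (b * a * b') = b * P a * b'.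

Definition faithful (P : A -> A) : Prop :=
  forall a, P (star a * a) = 0 -> a = 0.

Definition cartan B : Prop :=
  [/\ sub_cstar B, maximal_abelian B, regular_sub B
    & exists P, conditional_expectation B P /\ faithful P].

(* Functionals on [B] are represented by functions on [A] of which only the
   values on [B] matter.  In [state] the supremum is the norm of the restriction
   to [B]; as [sup] is 0 on unbounded sets, the equation with 1 includes
   boundedness. *)
Definition state B f : Prop :=
  [/\ forall (c : R[i]) a b, B a -> B b -> f (c *: a + b) = c * f a + f b,
      forall b, B b -> 0 <= f (star b * b)
    & sup [set complex.Re `|f b| | b in [set b | B b /\ cnorm b <= 1]] = 1].

Definition pure_state B f : Prop :=
  state B f /\
  forall g h (t : R), state B g -> state B h -> 0 < t < 1 ->
    (forall b, B b -> f b = t%:C * g b + (1 - t)%:C * h b) ->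
    forall b, B b -> g b = f b /\ h b = f b.

Definition unique_extension B : Prop :=
  forall f, pure_state B f ->
    exists! g, state setT g /\ forall b, B b -> g b = f b.

Definition cstar_diagonal B : Prop := cartan B /\ unique_extension B.

End Diagonals.

Section Morphisms.
Variable R : realType.

Definition star_hom (A A' : cstarType R) (f : A -> A') : Prop :=
  [/\ linear f, {morph f : a b / a * b} & {morph f : a / star a}].

Definition unital_star_hom (A A' : cstarType R) (f : A -> A') : Prop :=
  star_hom f /\ f 1 = 1.

Definition mx_star_hom (A : cstarType R) r (f : A -> 'M[R[i]]_r) : Prop :=
  [/\ linear f, {morph f : a b / a * b >-> a *m b},
      {morph f : a / star a >-> a ^t*} & f 1 = 1%:M].

Definition mx_star_aut r (f : 'M[R[i]]_r -> 'M[R[i]]_r) : Prop :=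
  [/\ bijective f, linear f, {morph f : a b / a *m b}
    & {morph f : a / a ^t*}].

Definition unitarily_equivalent (A : cstarType R) m n
    (f : A -> 'M[R[i]]_m) (g : A -> 'M[R[i]]_n) : Prop :=
  exists U : 'M[R[i]]_(m, n),
    [/\ U *m U ^t* = 1%:M, U ^t* *m U = 1%:M
      & forall a, f a = U *m g a *m U ^t*].

End Morphisms.

Section Homogeneous.
Variable R : realType.

Definition l2norm r (v : 'cV[R[i]]_r) : R :=
  Num.sqrt (\sum_i (complex.Re `|v i 0|) ^+ 2).

Definition opnorm r (m : 'M[R[i]]_r) : R :=
  sup [set l2norm (m *m v) | v in [set v | l2norm v <= 1]].

Definition homeomorphism_on (X Y : topologicalType) (U : set X) (V : set Y)
    (f : X -> Y) : Prop :=
  exists g : Y -> X,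
    [/\ {within U, continuous f}, {within V, continuous g},
        forall x, U x -> V (f x) /\ g (f x) = x
      & forall y, V y -> U (g y) /\ f (g y) = y].

(* Locally trivial C*-bundles over [Z] with fibre [M_r].  For each [z],
   [point z] identifies the C*-algebra [M_r] with the fibre over [z]; these
   identifications carry the fibrewise operations and norm, and are not assumed
   to depend continuously on [z]: the twisting of the bundle is recorded by the
   topology of [total]. *)
Record matrix_bundle (Z : topologicalType) (r : nat) := MatrixBundle {
  total : topologicalType;
  proj : total -> Z;
  point : Z -> 'M[R[i]]_r -> total;
  proj_continuous : continuous proj;
  proj_point : forall z m, proj (point z m) = z;
  point_inj : forall z, injective (point z);
  point_surj : forall e, exists m, e = point (proj e) m;
  locally_trivial : forall z0, exists U : set Z, exists h,
    [/\ open U, U z0, forall z, U z -> mx_star_aut (h z)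
      & homeomorphism_on (U `*` setT) (proj @^-1` U)
          (fun zm : Z * 'M[R[i]]_r => point zm.1 (h zm.1 zm.2))]
}.

Definition continuous_section Z r (E : matrix_bundle Z r)
    (s : Z -> 'M[R[i]]_r) : Prop :=
  continuous (fun z => point E z (s z)).

(* [A] is, through [a |-> (fun z => hev z a)], the C*-algebra of continuous
   sections of [hbundle], with the supremum norm. *)
Record homogeneous (A : cstarType R) := Homogeneous {
  hbase : topologicalType;
  hrank : nat;
  hbundle : matrix_bundle hbase hrank;
  hev : hbase -> A -> 'M[R[i]]_hrank;
  hbase_compact : compact [set: hbase];
  hbase_connected : connected [set: hbase];
  hbase_hausdorff : hausdorff_space hbase;
  hrank_gt0 : (0 < hrank)%N;
  hev_hom : forall z, mx_star_hom (hev z);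
  hev_section : forall a, continuous_section hbundle (fun z => hev z a);
  hev_surj : forall s, continuous_section hbundle s ->
    exists a, forall z, hev z a = s z;
  hev_norm : forall a, cnorm a = sup (range (fun z => opnorm (hev z a)))
}.

Record homogeneous_sum (A : cstarType R) := HomogeneousSum {
  nsummands : nat;
  summand : 'I_nsummands -> cstarType R;
  coordinate : forall i, A -> summand i;
  summand_homogeneous : forall i, homogeneous (summand i);
  coordinate_hom : forall i, unital_star_hom (coordinate i);
  coordinate_bij : forall b : (forall i, summand i),
    exists! a, forall i, coordinate i a = b i;
  coordinate_norm : forall a, cnorm a = \big[Num.max/0]_i cnorm (coordinate i a)
}.

Section Spectrum.
Variables (A : cstarType R) (H : homogeneous_sum A).

Definition spectrum : Type :=
  {i : 'I_(nsummands H) & hbase (summand_homogeneous i)}.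

Definition fibre_rank (x : spectrum) : nat :=
  hrank (summand_homogeneous (projT1 x)).

Definition ev (x : spectrum) (a : A) : 'M[R[i]]_(fibre_rank x) :=
  hev (projT2 x) (coordinate (projT1 x) a).

End Spectrum.

(* The multiset of the points [x mu] is determined by [y], so that requiring a
   decomposition with distinct points is requiring that the points of any
   decomposition are distinct. *)
Definition maximally_homogeneous (A A' : cstarType R)
    (H : homogeneous_sum A) (H' : homogeneous_sum A') (f : A -> A') : Prop :=
  forall y : spectrum H', exists (k : nat) (x : 'I_k -> spectrum H),
    injective x /\
    unitarily_equivalent (fun a => ev y (f a))
                         (fun a => \mxdiag_(mu < k) ev (x mu) a).

End Homogeneous.

Section InductiveLimit.
Variables (R : realType) (A : nat -> cstarType R).
Variable phi : forall n, A n -> A n.+1.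

Fixpoint connecting n m : A n -> A (m + n) :=
  match m return A n -> A (m + n) with
  | 0 => id
  | m'.+1 => fun a => phi (connecting m' a)
  end.

(* [L] is the completion of the algebraic direct limit for the C*-seminorm
   [a |-> lim_m cnorm (phi_(n+m-1) (... (phi_n a)))]. *)
Definition inductive_limit (L : cstarType R) (psi : forall n, A n -> L) : Prop :=
  [/\ forall n, star_hom (psi n),
      forall n a, psi n.+1 (phi a) = psi n a,
      forall n (a : A n), (fun m => cnorm (connecting m a)) @ \oo --> cnorm (psi n a)
    & closure (\bigcup_n range (psi n)) = setT].

End InductiveLimit.

(* Main.v *)
(* A masa of A_n is described by a unitary frame V_x of each fibre over the
   spectrum, not assumed continuous in x: it consists of the sections a for which
   V_x^* a(x) V_x is diagonal at every x.  The frame is full if these diagonals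
   take all values at each point.  A C*-diagonal of A_1 yields a full frame: it is
   simultaneously diagonalizable in each fibre, and by uniqueness of extensions of
   pure states its diagonal entries there are distinct characters.  A full frame of
   A_n induces one of A_(n+1), because ev_y o phi is a direct sum of evaluations at
   distinct points, where the diagonals can be prescribed independently.

   Fullness provides, near each point, orthogonal diagonal elements of fibrewise
   rank one.  Cutting with them shows that the fibrewise diagonal part P a of a
   section is again a section, and that A_n is the closed span of the normalizers
   p a q with p, q diagonal of rank at most one and either p = q or p q = 0.  The
   connecting maps preserve diagonals, monomial elements and P, so this passes to
   the union of the A_n, and the closure of the union of the diagonals is a
   C*-diagonal of the limit: the elements p a q with p q = 0 are killed by P and
   by every extension of a pure state, which yields maximality and uniqueness of
   extensions, and P is faithful because the x with P (x^* x) = 0 form a right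
   ideal, while the compressions P (v^* b v) recover the norm of a positive b. *)

Require Import Defs.
From HB Require Import structures.
From mathcomp Require Import all_boot all_order all_algebra.
From mathcomp Require Import complex.
From mathcomp Require Import all_classical all_reals all_analysis.
From mathcomp Require Import ring lra.

Set Implicit Arguments.
Unset Strict Implicit.
Unset Printing Implicit Defensive.

Import Order.TTheory GRing.Theory Num.Theory.
Import numFieldNormedType.Exports.
Local Open Scope classical_set_scope.
Local Open Scope sesquilinear_scope.
Local Open Scope complex_scope.
Local Open Scope ring_scope.

(** * Norm convergence and positive functionals *)

(** $A$ has no fibres, and faithfulness or positivity on a dense subalgebra says little about its
    completion. What survives completion is a list of identities and norm inequalities that can be
    checked at a finite stage; [diagonal_system] is such a list, and the limit is treated from it
    alone. In this abstract part order enters through explicit squares: a positive element comes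
    with a root, and roots of convergent sequences converge because the positive square root is
    Hoelder continuous of exponent 1/2.

    Inside $A_n$ the obstacle is continuity, since neither the frame nor the diagonal entries in it
    need be continuous over the spectrum; the fibre norms of an element are. A field of matrices is
    therefore recognized as an element by approximation: near each point it is close to an element
    that is exact at that point, and [glue] patches these with a partition of unity. Square roots,
    diagonal parts and the approximation by sums of terms p a q all arise in this way. Distinctness
    of the points in a decomposition becomes injectivity of the labelling of basis vectors in
    [field_morphism]. *)

Section CstarBasics.
Variables (R : realType) (A : cstarType R).
Implicit Types (a b : A).

Lemma star0 : star (0 : A) = 0.
Proof. by apply: (addrI (star (0:A))); rewrite -starD !addr0. Qed.

Lemma starN a : star (- a) = - star a.
Proof. by apply: (addrI (star a)); rewrite -starD !subrr star0. Qed.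

Lemma starB a b : star (a - b) = star a - star b.
Proof. by rewrite starD starN. Qed.

Lemma star1 : star (1 : A) = 1.
Proof. by rewrite -[LHS]mulr1 -[X in star _ * X]starK -starM mulr1 starK. Qed.

Lemma star_sum n (F : 'I_n -> A) : star (\sum_i F i) = \sum_i star (F i).
Proof. by apply: (big_morph (@star R A) (@starD R A) star0). Qed.

Lemma cnorm0 : cnorm (0 : A) = 0.
Proof. by rewrite -(scale0r (0 : A)) cnormZ normr0 mul0r. Qed.

Lemma cnormN a : cnorm (- a) = cnorm a.
Proof. by rewrite -scaleN1r cnormZ normrN1 mul1r. Qed.

Lemma cnorm_ge0 a : 0 <= cnorm a.
Proof.
have := ler_cnormD a (- a); rewrite subrr cnorm0 cnormN -mulr2n => h.
by rewrite -(pmulrn_lge0 _ (isT : (0 < 2)%N)).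
Qed.

Lemma cnormBC a b : cnorm (a - b) = cnorm (b - a).
Proof. by rewrite -cnormN opprB. Qed.

Lemma cnorm_triangle c a b : cnorm (a - b) <= cnorm (a - c) + cnorm (c - b).
Proof. by apply: (le_trans _ (ler_cnormD _ _)); rewrite addrA subrK. Qed.

Lemma cnorm_star a : cnorm (star a) = cnorm a.
Proof.
suff h b : cnorm b <= cnorm (star b).
  by apply/eqP; rewrite eq_le h andbT -{2}(starK a) h.
have [->|b0] := eqVneq (cnorm b) 0; first exact: cnorm_ge0.
have bp : 0 < cnorm b by rewrite lt_def b0 cnorm_ge0.
by rewrite -(ler_pM2r bp) -expr2 -cnorm_starM ler_cnormM.
Qed.

Lemma cnorm1 : cnorm (1 : A) = 1.
Proof.
have n0 : cnorm (1 : A) != 0 by apply/eqP => /cnorm0_eq0/eqP; rewrite oner_eq0.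
by apply: (mulfI n0); rewrite -expr2 -cnorm_starM star1 !mul1r mulr1.
Qed.

Lemma cnormZr (c : R) a : cnorm (c%:C *: a) = `|c| * cnorm a.
Proof. by rewrite cnormZ normc_def /= expr0n /= addr0 sqrtr_sqr. Qed.

Lemma nbhs_cnormP a (S : set A) :
  nbhs a S <-> exists2 e : R, 0 < e & forall b, cnorm (a - b) < e -> S b.
Proof.
rewrite -nbhs_entourageE; split.
  case=> E entE ES; move/entourage_cnorm: entE => [e e0 h].
  by exists e => // b ab; apply: ES; apply/xsectionP; apply: h.
case=> e e0 h; exists [set ab | cnorm (ab.1 - ab.2) < e].
  by apply/entourage_cnorm; exists e.
by move=> b /xsectionP /= ; apply: h.
Qed.

Definition tends (u : nat -> A) a := (fun n => cnorm (u n - a)) @ \oo --> (0 : R).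

Lemma tends_le (u : nat -> A) a (b : nat -> R) :
  (forall n, cnorm (u n - a) <= b n) -> b @ \oo --> (0 : R) -> tends u a.
Proof.
move=> h b0; apply: (squeeze_cvgr _ (cvg_cst 0) b0).
by near=> n; rewrite cnorm_ge0 h.
Unshelve. all: by end_near. Qed.

Lemma tends_cst a : tends (fun=> a) a.
Proof. by apply: (@tends_le _ _ (fun=> 0)) => [n|]; [rewrite subrr cnorm0|exact: cvg_cst]. Qed.

Lemma tends_norm u a : tends u a -> (fun n => cnorm (u n)) @ \oo --> cnorm a.
Proof.
move=> ua; apply/subr_cvg0; apply: norm_cvg0.
apply: (squeeze_cvgr _ (cvg_cst 0) ua); near=> n; rewrite normr_ge0 /=.
have h1 : cnorm (u n) <= cnorm (u n - a) + cnorm a.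
  by apply: (le_trans _ (ler_cnormD _ _)); rewrite subrK.
have h2 : cnorm a <= cnorm (u n - a) + cnorm (u n).
  by rewrite (cnormBC _ a); apply: (le_trans _ (ler_cnormD _ _)); rewrite subrK.
by rewrite ler_norml; apply/andP; split; lra.
Unshelve. all: by end_near. Qed.

Lemma tends_unique u a b : tends u a -> tends u b -> a = b.
Proof.
move=> ua ub; apply/eqP; rewrite -subr_eq0; apply/eqP/cnorm0_eq0.
have h : (fun n => cnorm (u n - a) + cnorm (u n - b)) @ \oo --> (0 : R).
  by rewrite -[X in _ --> X]addr0; apply: cvgD.
apply/eqP; rewrite eq_le cnorm_ge0 andbT.
apply: (ler_cvg_to (cvg_cst (cnorm (a - b))) h); near=> n.
by rewrite (cnormBC _ a) cnorm_triangle.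
Unshelve. all: by end_near. Qed.

Lemma tendsD u v a b : tends u a -> tends v b -> tends (fun n => u n + v n) (a + b).
Proof.
move=> ua vb; apply: (@tends_le _ _ (fun n => cnorm (u n - a) + cnorm (v n - b))).
  by move=> n; rewrite opprD addrACA ler_cnormD.
by rewrite -[X in _ --> X]addr0; apply: cvgD.
Qed.

Lemma tendsZ (c : R[i]) u a : tends u a -> tends (fun n => c *: u n) (c *: a).
Proof.
move=> ua; apply: (@tends_le _ _ (fun n => complex.Re `|c| * cnorm (u n - a))).
  by move=> n; rewrite -scalerBr cnormZ.
by rewrite -[X in _ --> X](mulr0 (complex.Re `|c|)); apply: cvgM; first exact: cvg_cst.
Qed.

Lemma tendsN u a : tends u a -> tends (fun n => - u n) (- a).
Proof.
move=> ua; rewrite -scaleN1r; apply: (@tends_le _ _ (fun n => cnorm (u n - a))) => //.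
by move=> n; rewrite scaleN1r -opprD cnormN.
Qed.

Lemma tendsB u v a b : tends u a -> tends v b -> tends (fun n => u n - v n) (a - b).
Proof. by move=> ua vb; apply: tendsD => //; apply: tendsN. Qed.

Lemma tends_star u a : tends u a -> tends (fun n => star (u n)) (star a).
Proof.
move=> ua; apply: (@tends_le _ _ (fun n => cnorm (u n - a))) => //.
by move=> n; rewrite -starB cnorm_star.
Qed.

Lemma tendsM u v a b : tends u a -> tends v b -> tends (fun n => u n * v n) (a * b).
Proof.
move=> ua vb.
apply: (@tends_le _ _ (fun n => cnorm (u n) * cnorm (v n - b) + cnorm (u n - a) * cnorm b)).
  move=> n; have -> : u n * v n - a * b = u n * (v n - b) + (u n - a) * b.
    by rewrite mulrBr mulrBl addrA subrK.
  by apply: (le_trans (ler_cnormD _ _)); rewrite lerD ?ler_cnormM.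
rewrite -[X in _ --> X]addr0 -[X in _ --> X + _](mulr0 (cnorm a)).
rewrite -[X in _ --> _ + X](mul0r (cnorm b)).
apply: cvgD; apply: cvgM => //; [exact: tends_norm|exact: cvg_cst].
Qed.

Lemma closure_tendsP (S : set A) a :
  closure S a <-> exists2 u : nat -> A, (forall n, S (u n)) & tends u a.
Proof.
split.
  move=> cSa.
  have h n : exists b, S b /\ cnorm (b - a) <= harmonic n.
    have [|b [Sb /= ab]] := cSa [set b | cnorm (b - a) <= harmonic n].
      apply/nbhs_cnormP; exists (harmonic n); first exact: harmonic_gt0.
      by move=> b ab /=; rewrite cnormBC ltW.
    by exists b.
  have [u hu] := choice h; exists u; first by move=> n; case: (hu n).
  by apply: (tends_le (b := harmonic)); [move=> n; case: (hu n)|exact: cvg_harmonic].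
move=> [u Su ua] V /nbhs_cnormP[e e0 aV].
have /cvgrPdist_lt /(_ e e0) [N _ hN] := ua.
exists (u N); split=> //; apply: aV; have := hN N (leqnn N).
by rewrite /= sub0r normrN ger0_norm ?cnorm_ge0 // cnormBC.
Qed.

Lemma closedP (S : set A) :
  closed S <-> forall u a, (forall n, S (u n)) -> tends u a -> S a.
Proof.
split=> [cS u a Su ua|h a /closure_tendsP[u Su ua]]; last exact: h ua.
by apply: cS; apply/closure_tendsP; exists u.
Qed.

(** The sum [b m + b n] is the shape that arises when two terms are compared through a third object,
    such as a prospective limit, whose distance to [u n] is controlled by [b n]. *)
Lemma cnorm_cauchy (u : nat -> A) (b : nat -> R) :
  (forall m n, cnorm (u m - u n) <= b m + b n) -> b @ \oo --> (0 : R) ->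
  exists a, tends u a.
Proof.
move=> ub b0.
have small e : 0 < e -> exists N, forall m n, (N <= m)%N -> (N <= n)%N -> cnorm (u m - u n) < e.
  move=> e0; have /cvgrPdist_lt /(_ (e / 2)) := b0; rewrite divr_gt0 // => /(_ isT)[N _ hN].
  exists N => m n Nm Nn; apply: (le_lt_trans (ub m n)); rewrite (splitr e).
  have {}hN k : (N <= k)%N -> b k < e / 2.
    by move=> Nk; have := hN k Nk; rewrite /= sub0r normrN; apply: le_lt_trans; exact: ler_norm.
  by rewrite ltrD // hN.
have cF : cauchy (u @ \oo).
  move=> E /entourage_cnorm[e e0 h]; have [N hN] := small e e0.
  exists (u @` [set k | (N <= k)%N], u @` [set k | (N <= k)%N]) => /=.
    by split; exists N => // k /= Nk; exists k.
  by move=> [x y] /= [[m Nm <-] [n Nn <-]]; apply/h/hN.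
have [a ua] := @cnorm_complete _ A (u @ \oo) _ cF; exists a; apply/cvgrPdist_lt => e e0.
have : nbhs a [set x | cnorm (a - x) < e] by apply/nbhs_cnormP; exists e.
move/ua => [N _ hN]; exists N => // k Nk; have /= := hN k Nk.
by rewrite sub0r normrN ger0_norm ?cnorm_ge0 // cnormBC.
Qed.
End CstarBasics.

Section ComplexModulus.
Variable R : realType.
Implicit Types z w : R[i].

Definition modc z : R := complex.Re `|z|.

Lemma modcE z : `|z| = (modc z)%:C.
Proof. by rewrite /modc normc_def. Qed.

Lemma modc_ge0 z : 0 <= modc z.
Proof. by rewrite -ler0c -modcE. Qed.

Lemma modc0 : modc 0 = 0.
Proof. by rewrite /modc normr0. Qed.

Lemma modcM z w : modc (z * w) = modc z * modc w.
Proof. by apply: (@complexI R); rewrite rmorphM /= -!modcE normrM. Qed.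

Lemma ler_modcD z w : modc (z + w) <= modc z + modc w.
Proof. by rewrite -lecR rmorphD /= -!modcE ler_normD. Qed.

Lemma modcN z : modc (- z) = modc z.
Proof. by rewrite /modc normrN. Qed.

Lemma modc_eq0 z : modc z = 0 -> z = 0.
Proof. by move=> h; apply/normr0_eq0; rewrite modcE h. Qed.

Lemma modc_real (r : R) : modc r%:C = `|r|.
Proof. by rewrite /modc normc_def /= expr0n /= addr0 sqrtr_sqr. Qed.

Lemma ge0_modcE z : 0 <= z -> z = (modc z)%:C.
Proof. by move=> h; rewrite -modcE ger0_norm. Qed.

End ComplexModulus.

(** * Positive functionals on star-subalgebras *)

Section PositiveFunctionals.
Variables (R : realType) (A : cstarType R).

(** Unlike [sub_cstar] this asks for the unit and not for closedness: it covers the dense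
    subalgebras as well as their closures. *)
Record star_subalgebra (B : set A) : Prop := StarSubalgebra {
  subalg1 : B 1;
  subalgZD : forall (c : R[i]) a b, B a -> B b -> B (c *: a + b);
  subalgM : forall a b, B a -> B b -> B (a * b);
  subalgS : forall a, B a -> B (star a)
}.

Section Subalgebra.
Variables (B : set A) (sB : star_subalgebra B).

Lemma subalg0 : B 0.
Proof. by have := subalgZD sB (-1) (subalg1 sB) (subalg1 sB); rewrite scaleN1r addNr. Qed.

Lemma subalgZ (c : R[i]) a : B a -> B (c *: a).
Proof. by move=> Ba; rewrite -[_ *: _]addr0; apply: (subalgZD sB) => //; exact: subalg0. Qed.

Lemma subalgD a b : B a -> B b -> B (a + b).
Proof. by move=> Ba Bb; rewrite -[a]scale1r; apply: (subalgZD sB). Qed.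

Lemma subalgN a : B a -> B (- a).
Proof. by move=> Ba; rewrite -scaleN1r; apply: subalgZ. Qed.

Lemma subalgB a b : B a -> B b -> B (a - b).
Proof. by move=> Ba Bb; apply: subalgD => //; apply: subalgN. Qed.

Lemma subalg_sum n (F : 'I_n -> A) : (forall i, B (F i)) -> B (\sum_i F i).
Proof. by move=> h; elim/big_rec : _ => [|i x _]; [exact: subalg0|apply: subalgD]. Qed.

Lemma closure_subalgebra : star_subalgebra (closure B).
Proof.
split.
- by apply: subset_closure; apply: subalg1.
- move=> c a b /closure_tendsP[u Bu ua] /closure_tendsP[v Bv vb]; apply/closure_tendsP.
  exists (fun n => c *: u n + v n); first by move=> n; apply: subalgZD.
  by apply: tendsD => //; apply: tendsZ.
- move=> a b /closure_tendsP[u Bu ua] /closure_tendsP[v Bv vb]; apply/closure_tendsP.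
  by exists (fun n => u n * v n); [move=> n; apply: subalgM|apply: tendsM].
- move=> a /closure_tendsP[u Bu ua]; apply/closure_tendsP.
  by exists (fun n => star (u n)); [move=> n; apply: subalgS|apply: tends_star].
Qed.

Lemma closure_commutative : Defs.commutative B -> Defs.commutative (closure B).
Proof.
move=> cB a b /closure_tendsP[u Bu ua] /closure_tendsP[v Bv vb].
apply: (@tends_unique _ _ (fun n => u n * v n)); first exact: tendsM.
rewrite (_ : (fun n => _) = (fun n => v n * u n)); first exact: tendsM.
by apply/funext => n; apply: cB.
Qed.

Variable f : A -> R[i].
Hypothesis f_linear : forall (c : R[i]) a b, B a -> B b -> f (c *: a + b) = c * f a + f b.

Lemma functional0 : f 0 = 0.
Proof.
have B0 := subalg0; have := f_linear 1 B0 B0; rewrite scale1r mul1r addr0.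
by move=> h; apply: (addrI (f 0)); rewrite addr0.
Qed.

Lemma functionalZ c a : B a -> f (c *: a) = c * f a.
Proof. by move=> Ba; rewrite -[X in f X]addr0 f_linear ?functional0 ?addr0 //; exact: subalg0. Qed.

Lemma functionalD a b : B a -> B b -> f (a + b) = f a + f b.
Proof. by move=> Ba Bb; rewrite -[X in f (X + _)]scale1r f_linear ?mul1r. Qed.

Lemma functionalN a : B a -> f (- a) = - f a.
Proof. by move=> Ba; rewrite -scaleN1r functionalZ // mulN1r. Qed.

Lemma functionalB a b : B a -> B b -> f (a - b) = f a - f b.
Proof. by move=> Ba Bb; rewrite functionalD ?functionalN //; exact: subalgN. Qed.

Hypothesis f_pos : forall b, B b -> 0 <= f (star b * b).

(** Positivity at [l *: x + y], expanded. The values 1 and ['i] of [l] give hermitian symmetry, a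
    negative multiple of [f (star x * y)] gives the Cauchy-Schwarz inequality. *)
Lemma positive_functional_quadratic x y (l : R[i]) : B x -> B y ->
  0 <= Num.conj l * l * f (star x * x) + Num.conj l * f (star x * y)
       + l * f (star y * x) + f (star y * y).
Proof.
move=> Bx By; have Blx := subalgZ l Bx.
have -> : Num.conj l * l * f (star x * x) + Num.conj l * f (star x * y)
    + l * f (star y * x) + f (star y * y) = f (star (l *: x + y) * (l *: x + y)).
  have -> : star (l *: x + y) * (l *: x + y) = (Num.conj l * l) *: (star x * x)
      + Num.conj l *: (star x * y) + l *: (star y * x) + star y * y.
    rewrite starD starZ mulrDr !mulrDl -!scalerAl -!scalerAr scalerA !addrA.
    by rewrite (addrAC _ (l *: _)).
  have Bs := subalgS sB; have Bm := subalgM sB.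
  rewrite !functionalD ?functionalZ //; by do ?[apply: subalgZ|apply: subalgD|apply: Bm|apply: Bs].
exact/f_pos/subalgD.
Qed.

(** For [w = f (star x * y)] and [w' = f (star y * x)], reality of the quadratic form at 1 and ['i]
    makes [w + w'] and ['i * (w' - w)] real, which together give the claim. *)
Lemma positive_functional_conj x y : B x -> B y ->
  f (star y * x) = Num.conj (f (star x * y)).
Proof.
move=> Bx By.
have h1 := positive_functional_quadratic 1 Bx By.
have h2 := positive_functional_quadratic 'i Bx By.
have a0 := f_pos Bx; have d0 := f_pos By.
set a := f (star x * x) in a0 h1 h2; set d := f (star y * y) in d0 h1 h2.
set w := f (star x * y) in h1 h2 *; set w' := f (star y * x) in h1 h2 *.
move: h1 h2; rewrite conjC1 conjCi !mul1r mulNr -expr2 sqrCi opprK mul1r mulNr.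
move=> /ger0_real h1 /ger0_real h2.
have r1 : w + w' \is Num.real.
  have -> : w + w' = a + w + w' + d - a - d by ring.
  by rewrite !realB // ger0_real.
have r2 : 'i * (w' - w) \is Num.real.
  have -> : 'i * (w' - w) = a - 'i * w + 'i * w' + d - a - d by ring.
  by rewrite !realB // ger0_real.
move: r1 r2 => /CrealP; rewrite rmorphD /= => r1 /CrealP; rewrite rmorphM rmorphB /= conjCi.
rewrite mulNr -mulrN opprB => /(mulfI (neq0Ci _)) r2.
have : 2%:R * w' = 2%:R * Num.conj w.
  rewrite !mulr_natl !mulr2n; have -> : w' + w' = (w + w') + (w' - w) by ring.
  by rewrite -r1 -r2; ring.
by move/(mulfI _); apply; rewrite pnatr_eq0.
Qed.

(** At [l = - t * w] the form is a real polynomial in [t] of degree at most 2. For [a > 0] its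
    minimum, at [t = a^-1], is nonnegative; for [a = 0] and [c > 0] it would take the value -1 at
    [t = (d + 1) / (2 * c)]. *)
Lemma Cauchy_Schwarz x y : B x -> B y ->
  modc (f (star x * y)) ^+ 2 <= modc (f (star x * x)) * modc (f (star y * y)).
Proof.
move=> Bx By; set w := f (star x * y).
have h (t : R) : 0 <= t ^+ 2 * modc w ^+ 2 * modc (f (star x * x)) - 2 * t * modc w ^+ 2
    + modc (f (star y * y)).
  rewrite -ler0c; have := positive_functional_quadratic (- t%:C * w) Bx By.
  rewrite (positive_functional_conj Bx By) -/w.
  rewrite (ge0_modcE (f_pos Bx)) (ge0_modcE (f_pos By)).
  have e : w * Num.conj w = ((modc w) ^+ 2)%:C by rewrite -normCK modcE rmorphXn.
  have -> : Num.conj (- t%:C * w) = - t%:C * Num.conj w.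
    rewrite (rmorphM Num.conj) (rmorphN Num.conj); congr (- _ * _).
    by apply/CrealP; rewrite complex_real.
  rewrite !modc_real !ger0_norm ?modc_ge0 //.
  congr (0 <= _); rewrite (_ : forall z u : R[i], - t%:C * Num.conj w * (- t%:C * w) * z
      + - t%:C * Num.conj w * w + - t%:C * w * Num.conj w + u
      = t%:C * t%:C * (w * Num.conj w) * z - (1 + 1) * t%:C * (w * Num.conj w) + u).
    by rewrite e -!rmorphM -(rmorph1 (real_complex R)) -!rmorphD -!rmorphM -rmorphB -rmorphD; congr (_%:C); ring.
  by move=> z u; ring.
set a := modc (f (star x * x)) in h *; set d := modc (f (star y * y)) in h *.
have a0 : 0 <= a by exact: modc_ge0.
have d0 : 0 <= d by exact: modc_ge0.
set c := modc w ^+ 2 in h *; have c0 : 0 <= c by exact: sqr_ge0.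
move: a0; rewrite le_eqVlt => /predU1P[a0|a0].
  rewrite -a0 mul0r leNgt; apply/negP => cp.
  have := h ((d + 1) / (2 * c)); rewrite -a0 mulr0 add0r.
  have -> : 2 * ((d + 1) / (2 * c)) * c = d + 1 by field; rewrite gt_eqF.
  lra.
have := h a^-1; rewrite -(ler_pM2l a0) mulr0.
have -> : a * (a^-1 ^+ 2 * c * a - 2 * a^-1 * c + d) = a * d - c by field; rewrite gt_eqF.
by rewrite subr_ge0.
Qed.

End Subalgebra.
End PositiveFunctionals.

(** * States *)

Section States.
Variables (R : realType) (A : cstarType R) (B : set A).
Hypothesis sB : star_subalgebra B.

Section OneState.
Variable f : A -> R[i].
Hypothesis fs : state B f.

Lemma state_linear (c : R[i]) a b : B a -> B b -> f (c *: a + b) = c * f a + f b.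
Proof. by case: fs => h _ _; apply: h. Qed.

Lemma state_pos b : B b -> 0 <= f (star b * b).
Proof. by case: fs => _ h _; apply: h. Qed.

Lemma state_norm b : B b -> modc (f b) <= cnorm b.
Proof.
case: fs => flin _ fsup Bb.
have [b0|b0] := eqVneq (cnorm b) 0.
  by rewrite (cnorm0_eq0 _ b0) (functional0 sB flin) modc0 cnorm_ge0.
have bp : 0 < cnorm b by rewrite lt_def b0 cnorm_ge0.
pose c := (cnorm b)^-1.
have c0 : 0 < c by rewrite invr_gt0.
have h : modc (f (c%:C *: b)) <= 1.
  rewrite -fsup; apply: sup_upper_bound.
    (* Without a supremum, [sup] would have its default value 0 instead of 1. *)
    apply: boolp.contrapT => h; have := sup_out h; rewrite fsup => /eqP; rewrite oner_eq0 //.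
  exists (c%:C *: b) => //; split; first exact: subalgZ.
  by rewrite cnormZr gtr0_norm // mulVf.
by move: h; rewrite (functionalZ sB flin) // modcM modc_real gtr0_norm // mulrC ler_pdivrMr // mul1r.
Qed.

(** Cauchy-Schwarz against 1 bounds [modc (f b) ^+ 2] by [modc (f 1)] on the unit ball, so the
    supremum 1 is at most the square root of [modc (f 1)]. *)
Lemma state1 : f 1 = 1.
Proof.
case: fs => flin fpos fsup; have B1 := subalg1 sB.
have f10 : 0 <= f 1 by rewrite -[1]mulr1 -{1}(star1 A); apply: fpos.
have le1 : modc (f 1) <= 1 by rewrite (le_trans (state_norm B1)) // cnorm1.
suff ge1 : 1 <= modc (f 1).
  by rewrite (ge0_modcE f10); congr (_%:C); apply/eqP; rewrite eq_le le1.
have hs : sup [set modc (f b) | b in [set b | B b /\ cnorm b <= 1]] <= Num.sqrt (modc (f 1)).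
  apply: ge_sup; first by exists (modc (f 1)); exists 1 => //; rewrite /= cnorm1.
  move=> _ [b [Bb b1] <-].
  have := Cauchy_Schwarz sB flin fpos B1 Bb; rewrite star1 !mul1r => cs.
  rewrite -[leLHS]ger0_norm ?modc_ge0 // -sqrtr_sqr ler_wsqrtr // (le_trans cs) //.
  rewrite ler_piMr ?modc_ge0 // (le_trans (state_norm _)) //.
    by apply: (subalgM sB) => //; apply: (subalgS sB).
  by rewrite cnorm_starM expr_le1 ?cnorm_ge0.
rewrite fsup in hs.
rewrite -(ler_pXn2r (isT : (0 < 2)%N)) ?nnegrE ?ler01 ?sqrtr_ge0 // in hs.
by rewrite expr1n sqr_sqrtr ?modc_ge0 in hs.
Qed.
End OneState.

Lemma stateP f : (forall (c : R[i]) a b, B a -> B b -> f (c *: a + b) = c * f a + f b) ->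
  (forall b, B b -> 0 <= f (star b * b)) -> f 1 = 1 ->
  (forall b, B b -> modc (f b) <= cnorm b) -> state B f.
Proof.
move=> flin fpos f1 fn; split=> //.
have h1 : [set modc (f b) | b in [set b | B b /\ cnorm b <= 1]] 1.
  exists 1; first by split; [exact: subalg1|rewrite cnorm1].
  by rewrite f1 /modc normr1.
have ub : ubound [set modc (f b) | b in [set b | B b /\ cnorm b <= 1]] 1.
  by move=> _ [b [Bb b1] <-]; apply: le_trans (fn _ Bb) b1.
apply/eqP; rewrite eq_le; apply/andP; split; first by apply: ge_sup => //; exists 1.
by apply: ub_le_sup => //; exists 1.
Qed.
End States.

Lemma setT_subalgebra (R : realType) (A : cstarType R) : star_subalgebra [set: A].
Proof. by []. Qed.

(** * C*-diagonals from dense data *)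

Section DiagonalSystems.
Variables (R : realType) (A : cstarType R).

(* [N0] consists of normalizers of [D0] and [C0] of its positive elements.  The
   norm estimate [ds_proj_faithful] stands in for faithfulness of [P], which would
   not pass to the completion. *)
Record diagonal_system (A0 D0 N0 C0 : set A) (P : A -> A) : Prop := DiagonalSystem {
  ds_subalg : star_subalgebra A0;
  ds_diag : star_subalgebra D0;
  ds_diag_sub : D0 `<=` A0;
  ds_diag_comm : Defs.commutative D0;
  ds_projZD : forall (c : R[i]) a b, A0 a -> A0 b -> P (c *: a + b) = c *: P a + P b;
  ds_proj_diag : forall a, A0 a -> D0 (P a);
  ds_proj_id : forall d, D0 d -> P d = d;
  ds_proj_norm : forall a, A0 a -> cnorm (P a) <= cnorm a;
  ds_proj_bimod : forall d a e, D0 d -> A0 a -> D0 e -> P (d * a * e) = d * P a * e;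
  ds_proj_pos : forall a, A0 a -> exists c, C0 c /\ P (star a * a) = star c * c;
  ds_pos_diag : C0 `<=` D0;
  ds_pos_dist : forall c c', C0 c -> C0 c' ->
    cnorm (c - c') ^+ 2 <= cnorm (star c * c - star c' * c');
  ds_diag_mono : forall c d, D0 c -> D0 d ->
    cnorm c ^+ 2 <= cnorm (star c * c + star d * d);
  ds_diag_sqrt : forall d, D0 d -> star d = d -> cnorm d <= 1 ->
    exists e, D0 e /\ 1 + d = star e * e;
  ds_norm_sub : N0 `<=` A0;
  ds_norm_diag : forall n d, N0 n -> D0 d -> D0 (n * d * star n) /\ D0 (star n * d * n);
  ds_norm_proj : forall n a, N0 n -> A0 a -> P (star n * a * n) = star n * P a * n;
  ds_span : forall a (e : R), A0 a -> 0 < e -> exists k (t : 'I_k -> A),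
    (forall i, N0 (t i) /\ (D0 (t i) \/ exists p b q,
       [/\ D0 p, A0 b, D0 q, p * q = 0 & t i = p * b * q])) /\
    cnorm (\sum_i t i - a) < e;
  ds_proj_faithful : forall a (c : R), A0 a ->
    (forall v, A0 v -> cnorm v <= 2 -> cnorm (P (star v * (star a * a) * v)) <= c) ->
    cnorm a ^+ 2 <= c
}.

Variables (A0 D0 N0 C0 : set A) (P0 : A -> A).
Hypothesis ds : diagonal_system A0 D0 N0 C0 P0.
Hypothesis A0_dense : closure A0 = setT.

Let sA := ds_subalg ds.
Let sD := ds_diag ds.
Let B := closure D0.
Let sB : star_subalgebra B := closure_subalgebra sD.
Let B_comm : Defs.commutative B := closure_commutative (ds_diag_comm ds).

(** * Extension of the projection to the completion *)

Lemma dense_seq a : exists2 u, (forall n, A0 (u n)) & tends u a.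
Proof. by apply/closure_tendsP; rewrite A0_dense. Qed.

Lemma proj_dist a b : A0 a -> A0 b -> cnorm (P0 a - P0 b) <= cnorm (a - b).
Proof.
move=> Aa Ab; have -> : P0 a - P0 b = P0 (a - b).
  by rewrite addrC -scaleN1r -(ds_projZD ds) // scaleN1r addrC.
exact/(ds_proj_norm ds)/(subalgB sA).
Qed.

Lemma proj_extension : exists P : A -> A,
  forall u a, (forall n, A0 (u n)) -> tends u a -> tends (fun n => P0 (u n)) (P a).
Proof.
have h a : exists b, forall u, (forall n, A0 (u n)) -> tends u a -> tends (fun n => P0 (u n)) b.
  have [u Au ua] := dense_seq a.
  have [|b Pb] := @cnorm_cauchy _ A (fun n => P0 (u n)) (fun n => cnorm (u n - a)) _ ua.
    move=> m n; apply: (le_trans (proj_dist _ _)) => //.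
    by rewrite (cnormBC (u n)) cnorm_triangle.
  exists b => v Av va.
  apply: (@tends_le _ _ _ _ (fun n => cnorm (v n - u n) + cnorm (P0 (u n) - b))).
    move=> n; have -> : P0 (v n) - b = P0 (v n) - P0 (u n) + (P0 (u n) - b) by rewrite addrA subrK.
    by apply: (le_trans (ler_cnormD _ _)); rewrite lerD2r proj_dist.
  rewrite -[X in _ --> X]addr0; apply: cvgD => //.
  have := tends_norm (tendsB va ua); rewrite subrr cnorm0; exact.
by have [P hP] := choice h; exists P => u a; exact: hP.
Qed.

Let P := sval (cid proj_extension).
Let P_lim u a : (forall n, A0 (u n)) -> tends u a -> tends (fun n => P0 (u n)) (P a).
Proof. exact: (svalP (cid proj_extension)). Qed.

Let P_ext a : A0 a -> P a = P0 a.
Proof.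
move=> Aa; apply: (tends_unique (u := fun=> P0 a)); last exact: tends_cst.
by apply: (@P_lim (fun=> a)) => //; apply: tends_cst.
Qed.

Let P_linear : linear P.
Proof.
move=> c a b; have [u Au ua] := dense_seq a; have [v Av vb] := dense_seq b.
apply: (tends_unique (u := fun n => P0 (c *: u n + v n))).
  apply: P_lim; first by move=> n; apply: (subalgZD sA).
  by apply: tendsD => //; apply: tendsZ.
rewrite (_ : (fun n => _) = (fun n => c *: P0 (u n) + P0 (v n))).
  by apply: tendsD; [apply/tendsZ/P_lim|apply: P_lim].
by apply/funext => n; rewrite (ds_projZD ds).
Qed.

Let PD a b : P (a + b) = P a + P b.
Proof. by rewrite -[a in LHS]scale1r P_linear scale1r. Qed.

Let P0E : P 0 = 0.
Proof. by apply: (addrI (P 0)); rewrite -PD !addr0. Qed.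

Let PN a : P (- a) = - P a.
Proof. by apply: (addrI (P a)); rewrite -PD !subrr P0E. Qed.

Let P_diag a : B (P a).
Proof.
have [u Au ua] := dense_seq a; apply/closure_tendsP.
by exists (fun n => P0 (u n)); [move=> n; apply: (ds_proj_diag ds)|apply: P_lim].
Qed.

Let P_id d : B d -> P d = d.
Proof.
move=> /closure_tendsP[u Du ud]; apply: (tends_unique _ ud).
rewrite (_ : u = (fun n => P0 (u n))).
  by apply: P_lim => // n; apply: (ds_diag_sub ds).
by apply/funext => n; rewrite (ds_proj_id ds).
Qed.

Let P_norm a : cnorm (P a) <= cnorm a.
Proof.
have [u Au ua] := dense_seq a.
apply: (ler_cvg_to (tends_norm (P_lim Au ua)) (tends_norm ua)).
by near=> n; apply: (ds_proj_norm ds).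
Unshelve. all: by end_near. Qed.

Let P_bimod d a e : B d -> B e -> P (d * a * e) = d * P a * e.
Proof.
move=> /closure_tendsP[u Du ud] /closure_tendsP[w Dw we].
have [v Av va] := dense_seq a.
have DA := ds_diag_sub ds.
apply: (tends_unique (u := fun n => P0 (u n * v n * w n))).
  apply: P_lim; first by move=> n; do ?apply: (subalgM sA) => //; exact: DA.
  by do ?apply: tendsM.
rewrite (_ : (fun n => _) = (fun n => u n * P0 (v n) * w n)).
  by do ?apply: tendsM => //; apply: P_lim.
by apply/funext => n; rewrite (ds_proj_bimod ds).
Qed.

(** Along a sequence converging to [a] the images are squares of elements of [C0]; by [ds_pos_dist]
    the square roots of the errors control the distances of these roots, so the roots converge
    too. *)
Let P_pos a : exists c, B c /\ P (star a * a) = star c * c.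
Proof.
have [u Au ua] := dense_seq a.
have /choice[c hc] n := ds_proj_pos ds (Au n).
have Auu n : A0 (star (u n) * u n) by apply: (subalgM sA) => //; apply: (subalgS sA).
have uu := tendsM (tends_star ua) ua; have Puu := P_lim Auu uu.
have cd m n : cnorm (c m - c n) <= Num.sqrt (cnorm (P0 (star (u m) * u m) - P (star a * a)))
    + Num.sqrt (cnorm (P0 (star (u n) * u n) - P (star a * a))).
  have [[Cm em] [Cn en]] := (hc m, hc n).
  set x := cnorm (_ - _); set y := cnorm (_ - P _); set z := cnorm (_ - P _).
  have xyz : x ^+ 2 <= y + z.
    apply: (le_trans (ds_pos_dist ds Cm Cn)); rewrite -em -en /z (cnormBC (P0 _) (P _)).
    exact: cnorm_triangle.
  have y0 : 0 <= y by exact: cnorm_ge0.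
  have z0 : 0 <= z by exact: cnorm_ge0.
  rewrite -[leLHS]ger0_norm ?cnorm_ge0 // -sqrtr_sqr.
  have s0 : 0 <= Num.sqrt y + Num.sqrt z by rewrite addr_ge0 ?sqrtr_ge0.
  rewrite -[leRHS]ger0_norm // -sqrtr_sqr ler_wsqrtr // (le_trans xyz) //.
  by rewrite sqrrD !sqr_sqrtr // addrAC lerDl mulrn_wge0 // mulr_ge0 ?sqrtr_ge0.
have [|e ce] := cnorm_cauchy cd.
  rewrite -[X in _ --> X](sqrtr0 R); apply: continuous_cvg => //; exact: sqrt_continuous.
exists e; split; first by apply/closure_tendsP; exists c => // n; apply/(ds_pos_diag ds); case: (hc n).
apply: (tends_unique Puu); rewrite (_ : (fun n => _) = (fun n => star (c n) * c n)).
  by apply: tendsM => //; apply: tends_star.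
by apply/funext => n; case: (hc n).
Qed.

Let B_mono c d : B c -> B d -> cnorm c ^+ 2 <= cnorm (star c * c + star d * d).
Proof.
move=> /closure_tendsP[u Du uc] /closure_tendsP[v Dv vd].
have h := tendsD (tendsM (tends_star uc) uc) (tendsM (tends_star vd) vd).
apply: (ler_cvg_to (cvgM (tends_norm uc) (tends_norm uc)) (tends_norm h)).
by near=> n; rewrite /= -expr2; apply: (ds_diag_mono ds).
Unshelve. all: by end_near. Qed.

Let kernel (x : A) := P (star x * x) = 0.

(* Parallelogram identity: [P (star (x + y) * (x + y))] and the same term for
   [x - y] are squares in [B] with sum 0. *)
Let kernelD x y : kernel x -> kernel y -> kernel (x + y).
Proof.
rewrite /kernel => hx hy.
have [c [Bc ec]] := P_pos (x + y); have [d [Bd ed]] := P_pos (x - y).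
have : star c * c + star d * d = 0.
  have e : star (x + y) * (x + y) + star (x - y) * (x - y)
      = (star x * x + star y * y) + (star x * x + star y * y).
    rewrite starB starD !mulrDl !mulrDr !mulrN !mulNr opprK.
    set a := star x * x; set b := star x * y; set b' := star y * x; set d' := star y * y.
    rewrite addrACA [in X in X + _]addrACA subrr addr0 [in X in _ + X]addrACA subrr add0r.
    by rewrite addrACA.
  by rewrite -ec -ed -PD e !PD hx hy !addr0.
move=> h; have := B_mono Bc Bd; rewrite h cnorm0 => c0.
have /cnorm0_eq0 c00 : cnorm c = 0 by apply/eqP; rewrite -sqrf_eq0 eq_le sqr_ge0 andbT.
by rewrite ec c00 mulr0.
Qed.

Let kernel0 : kernel 0.
Proof. by rewrite /kernel mulr0 P0E. Qed.

Let kernel_lim u x : (forall n, kernel (u n)) -> tends u x -> kernel x.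
Proof.
move=> ku ux; have uu := tendsM (tends_star ux) ux.
have h : tends (fun n => P (star (u n) * u n)) (P (star x * x)).
  apply: (tends_le (b := fun n => cnorm (star (u n) * u n - star x * x))) uu => n.
  by rewrite -PN -PD P_norm.
apply: (tends_unique h); rewrite (_ : (fun n => _) = (fun=> 0)); first exact: tends_cst.
by apply/funext => n; rewrite ku.
Qed.

Let P_cont u x : tends u x -> tends (fun n => P (u n)) (P x).
Proof.
move=> ux; apply: (tends_le (b := fun n => cnorm (u n - x))) ux => n.
by rewrite -PN -PD P_norm.
Qed.

Let span_seq a : exists2 u, tends u a & forall n, exists k (t : 'I_k -> A),
    (forall i, N0 (t i) /\ (D0 (t i) \/ exists p b q,
       [/\ D0 p, A0 b, D0 q, p * q = 0 & t i = p * b * q])) /\ u n = \sum_i t i.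
Proof.
have [v Av va] := dense_seq a.
have /choice[u hu] n : exists w, cnorm (w - v n) < harmonic n /\ exists k (t : 'I_k -> A),
    (forall i, N0 (t i) /\ (D0 (t i) \/ exists p b q,
       [/\ D0 p, A0 b, D0 q, p * q = 0 & t i = p * b * q])) /\ w = \sum_i t i.
  have [k [t [ht hn]]] := ds_span ds (Av n) (harmonic_gt0 n).
  by exists (\sum_i t i); split => //; exists k, t.
exists u; last by move=> n; case: (hu n).
apply: (tends_le (b := fun n => harmonic n + cnorm (v n - a))) => [n|].
  by apply: (le_trans (cnorm_triangle (v n) _ _)); rewrite lerD2r; case: (hu n) => /ltW.
by rewrite -[X in _ --> X]addr0; apply: cvgD => //; exact: cvg_harmonic.
Qed.

(* The right ideal property follows from [P (star t * b * t) = star t * P b * t]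
   for the normalizers [t], which span a dense subspace. *)
Let kernel_ideal x v : kernel x -> kernel (x * v).
Proof.
move=> kx; have [u uv hu] := span_seq v.
apply: (kernel_lim (u := fun n => x * u n)); last by apply: tendsM => //; exact: tends_cst.
move=> n; have [k [t [ht ->]]] := hu n; rewrite mulr_sumr.
elim/big_rec : _ => [|i y _]; [exact: kernel0|apply: kernelD].
have [Nt _] := ht i; rewrite /kernel starM.
have [w Aw wx] := dense_seq (star x * x).
have h := tendsM (tendsM (tends_cst (star (t i))) wx) (tends_cst (t i)).
have At := ds_norm_sub ds Nt; have As := subalgS sA; have Am := subalgM sA.
rewrite mulrA -(mulrA (star (t i))); apply: (tends_unique (P_lim _ h)).
  by move=> m; apply: (Am) => //; apply: (Am) => //; apply: As.
have := tendsM (tendsM (tends_cst (star (t i))) (P_lim Aw wx)) (tends_cst (t i)).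
rewrite kx mulr0 mul0r; congr (tends _ _); apply/funext => m.
by rewrite (ds_norm_proj ds).
Qed.

(** As the kernel is a right ideal, [star x * x] may be subtracted inside
    [P (star v * (star a * a) * v)] for an approximant [a] of [x]. This bounds the term by the
    square of the norm of [v], at most 4, times an error tending to 0, and [ds_proj_faithful] turns
    the bound into one for [a]. *)
Let P_faithful : faithful P.
Proof.
move=> x kx; have [a Aa ax] := dense_seq x.
have aa := tendsM (tends_star ax) ax.
have h n : cnorm (a n) ^+ 2 <= 4 * cnorm (star (a n) * a n - star x * x).
  apply: (ds_proj_faithful ds) => // v Av v2.
  have Ava : A0 (star v * (star (a n) * a n) * v).
    by do ?[apply: (subalgM sA)|apply: (subalgS sA)|exact: Aa|exact: Av].
  rewrite -P_ext //; have <- : P (star v * (star (a n) * a n - star x * x) * v)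
      = P (star v * (star (a n) * a n) * v).
    rewrite mulrBr mulrBl PD PN; have := kernel_ideal v kx; rewrite /kernel starM.
    by rewrite mulrA -[X in P (X * v)]mulrA => ->; rewrite subr0.
  apply: (le_trans (P_norm _)); apply: (le_trans (ler_cnormM _ _)).
  apply: (le_trans (ler_wpM2r (cnorm_ge0 _) (ler_cnormM _ _))); rewrite cnorm_star.
  rewrite mulrAC ler_wpM2r ?cnorm_ge0 // (_ : 4 = 2 * 2); last by rewrite -natrM.
  by rewrite ler_pM ?cnorm_ge0.
have h0 : (fun n => 4 * cnorm (star (a n) * a n - star x * x)) @ \oo --> (0 : R).
  by rewrite -[X in _ --> X](mulr0 (4 : R)); apply: cvgM => //; exact: cvg_cst.
have : cnorm x * cnorm x <= 0.
  apply: (ler_cvg_to (cvgM (tends_norm ax) (tends_norm ax)) h0).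
  by near=> n; rewrite /= -expr2.
rewrite -expr2 => h2; apply/cnorm0_eq0/eqP.
by rewrite -sqrf_eq0 eq_le sqr_ge0 h2.
Unshelve. all: by end_near. Qed.

Let sub_cstar_B : sub_cstar B.
Proof.
split; [exact: subalg0|exact: subalgZD|exact: subalgM|exact: subalgS|exact: closed_closure].
Qed.

(* If [x] commutes with [B] then so does [z := x - P x], hence for [p * q = 0]
   [P (p * b * q * z) = P (p * (b * z) * q) = p * P (b * z) * q = 0]. *)
Let B_masa : maximal_abelian B.
Proof.
split=> // B' sB' cB' BB'; apply/seteqP; split=> // x B'x.
have xB d : B d -> d * x = x * d by move=> Bd; apply: cB' => //; apply: BB'.
pose z := x - P x.
have zB d : B d -> d * z = z * d.
  by move=> Bd; rewrite mulrBr mulrBl xB // (B_comm Bd (@P_diag x)).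
have Pz : P z = 0 by rewrite PD PN (P_id (@P_diag x)) subrr.
suff h a : P (a * z) = 0.
  have /P_faithful/eqP : P (star z * z) = 0 by [].
  by rewrite subr_eq0 => /eqP ->; apply: P_diag.
have [u ua hu] := span_seq a.
have B1 := subalg1 sB.
have DB d : D0 d -> B d by apply: subset_closure.
apply: (tends_unique (u := fun n => P (u n * z))).
  by apply: P_cont; apply: tendsM => //; exact: tends_cst.
rewrite (_ : (fun n => _) = fun=> 0); first exact: tends_cst.
apply/funext => n; have [k [t [ht ->]]] := hu n; rewrite mulr_suml.
elim/big_rec : _ => [//|i y _ hy]; rewrite PD hy addr0.
have [_ [Dt|[p [b [q [Dp Ab Dq pq ->]]]]]] := ht i.
  by rewrite -[_ * z]mulr1 P_bimod ?Pz ?mulr0 ?mul0r //; exact: DB.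
rewrite -mulrA (zB q) ?mulrA; last exact: DB.
rewrite -(mulrA p) P_bimod; [|exact: DB|exact: DB].
rewrite (B_comm (DB _ Dp) (@P_diag _)) -mulrA pq mulr0; exact: erefl.
Qed.

Let B_regular : regular_sub B.
Proof.
apply/seteqP; split=> // x _ C /= [sC NC].
have [C0' CZD CM CS Ccl] := sC.
have [u ux hu] := span_seq x.
apply: ((closedP C).1 Ccl u) ux => n; have [k [t [ht ->]]] := hu n.
elim/big_rec : _ => [//|i y _ Cy]; rewrite -[t i]scale1r; apply: CZD => //; apply: NC.
have [Nt _] := ht i => b /closure_tendsP[d Dd db].
have hd m := ds_norm_diag ds Nt (Dd m).
split; apply/closure_tendsP.
  exists (fun m => t i * d m * star (t i)); first by move=> m; case: (hd m).
  by do ?[apply: tendsM => //|exact: tends_cst].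
exists (fun m => star (t i) * d m * t i); first by move=> m; case: (hd m).
by do ?[apply: tendsM => //|exact: tends_cst].
Qed.

Let P_cond : conditional_expectation B P.
Proof.
split; last by move=> b a b'; apply: P_bimod.
split=> //; move=> a [b ->]; have [c [_ ec]] := P_pos b; by exists c.
Qed.

Lemma diagonal_system_cartan : cartan (closure D0).
Proof.
split; [exact: sub_cstar_B|exact: B_masa|exact: B_regular|exists P; split].
  exact: P_cond.
exact: P_faithful.
Qed.

Let DB d : D0 d -> B d. Proof. by apply: subset_closure. Qed.

(** For [b] in the unit ball of [D0], [1 - star b * b] is a square, so [k (star b * b)] is at most
    [k 1] and Cauchy-Schwarz applies. The crude bound by [K], however large, carries the sharp one
    from [D0] to its closure. *)
Lemma positive_functional_norm k K :
  (forall (c : R[i]) a b, B a -> B b -> k (c *: a + b) = c * k a + k b) ->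
  (forall b, B b -> 0 <= k (star b * b)) ->
  (forall b, B b -> modc (k b) <= K * cnorm b) ->
  forall b, B b -> modc (k b) <= modc (k 1) * cnorm b.
Proof.
move=> klin kpos kK.
have B1 := subalg1 sB.
have k10 : 0 <= k 1 by rewrite -[1]mulr1 -{1}(star1 A); apply: kpos.
have unit b : D0 b -> cnorm b <= 1 -> modc (k b) <= modc (k 1).
  move=> Db b1; have Bb := DB Db.
  have Bbb : B (star b * b) by apply: (subalgM sB) => //; apply: (subalgS sB).
  have [||| e [De he]] := @ds_diag_sqrt _ _ _ _ _ ds (- (star b * b)).
  - by apply: (subalgN sD); apply: (subalgM sD) => //; apply: (subalgS sD).
  - by rewrite starN starM starK.
  - by rewrite cnormN cnorm_starM expr_le1 ?cnorm_ge0.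
  have h : modc (k (star b * b)) <= modc (k 1).
    have : 0 <= k 1 - k (star b * b).
      by rewrite -(functionalB sB klin) // he; apply/kpos/DB.
    by rewrite {1}(ge0_modcE k10) {1}(ge0_modcE (kpos _ Bb)) -rmorphB /= ler0c subr_ge0.
  have := Cauchy_Schwarz sB klin kpos B1 Bb; rewrite star1 !mul1r => cs.
  rewrite -(ler_pXn2r (isT : (0 < 2)%N)) ?nnegrE ?modc_ge0 // (le_trans cs) //.
  by rewrite expr2 ler_wpM2l ?modc_ge0.
have scaled b : D0 b -> modc (k b) <= modc (k 1) * cnorm b.
  move=> Db; have [b0|b0] := eqVneq (cnorm b) 0.
    by rewrite (cnorm0_eq0 _ b0) (functional0 sB klin) modc0 mulr_ge0 ?modc_ge0 ?cnorm_ge0.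
  have bp : 0 < cnorm b by rewrite lt_def b0 cnorm_ge0.
  have := unit ((cnorm b)^-1%:C *: b) (subalgZ sD _ Db).
  rewrite cnormZr (functionalZ sB klin) ?modcM ?modc_real; last exact: DB.
  rewrite gtr0_norm ?invr_gt0 // mulVf // => /(_ (lexx _)).
  by rewrite mulrC ler_pdivrMr.
move=> b Bb; have := Bb => /closure_tendsP[u Du ub].
have h : (fun n => modc (k 1) * cnorm (u n) + K * cnorm (u n - b)) @ \oo --> modc (k 1) * cnorm b.
  rewrite -[X in _ --> X]addr0 -[X in _ --> _ + X](mulr0 K).
  by apply: cvgD; apply: cvgM => //; try exact: cvg_cst; exact: tends_norm.
apply: (ler_cvg_to (cvg_cst (modc (k b))) h); near=> n.
have -> : k b = k (u n) - k (u n - b).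
  by rewrite -(functionalB sB klin) ?opprB ?subrKC //; [exact: DB|apply: (subalgB sB) => //; exact: DB].
apply: (le_trans (ler_modcD _ _)); rewrite modcN lerD ?scaled //.
by apply: kK; apply: (subalgB sB) => //; exact: DB.
Unshelve. all: by end_near. Qed.

(** * Pure states of the diagonal and their extensions *)

Section PureState.
Variable f : A -> R[i].
Hypothesis pf : pure_state B f.
Let fs : state B f := pf.1.
Let flin := state_linear fs.
Let fpos := state_pos fs.
Let f1 := state1 sB fs.

(** Commutativity rewrites [u * (star b * b)] as a square, whence positivity;
    [positive_functional_norm] improves the evident bound to 1. *)
Let split_state u e : D0 u -> D0 e -> u = star e * e -> f u != 0 ->
  state B (fun b => (modc (f u))^-1%:C * f (u * b)).
Proof.
move=> Du De eu fu0; have [Bu Be] := (DB Du, DB De).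
have fup : 0 <= f u by rewrite eu; apply: fpos.
have m0 : modc (f u) != 0 by apply: contra fu0 => /eqP/modc_eq0 ->.
have mp : 0 < modc (f u) by rewrite lt_def m0 modc_ge0.
have klin (c : R[i]) a b : B a -> B b ->
    (modc (f u))^-1%:C * f (u * (c *: a + b)) = c * ((modc (f u))^-1%:C * f (u * a)) + (modc (f u))^-1%:C * f (u * b).
  move=> Ba Bb; rewrite mulrDr -scalerAr flin; try exact: (subalgM sB).
  by rewrite mulrDr mulrCA.
have kpos b : B b -> 0 <= (modc (f u))^-1%:C * f (u * (star b * b)).
  move=> Bb; apply: mulr_ge0; first by rewrite ler0c invr_ge0 modc_ge0.
  have -> : u * (star b * b) = star (e * b) * (e * b).
    by rewrite starM mulrA (B_comm Bu (subalgS sB Bb)) eu !mulrA.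
  by apply: fpos; apply: (subalgM sB).
have k1 : (modc (f u))^-1%:C * f (u * 1) = 1.
  by rewrite mulr1 {2}(ge0_modcE fup) -rmorphM /= mulVf.
apply: (stateP sB) => // b Bb.
have := positive_functional_norm (K := (modc (f u))^-1 * cnorm u) klin kpos; rewrite k1.
rewrite [modc 1]/modc normr1 /= => h; rewrite (le_trans (h _ b Bb)) ?mul1r // => b' Bb'.
rewrite modcM modc_real gtr0_norm ?invr_gt0 // -mulrA ler_wpM2l ?invr_ge0 ?modc_ge0 //.
by rewrite (le_trans (state_norm sB fs _)) ?ler_cnormM //; apply: (subalgM sB).
Qed.

Let null u e b : D0 u -> D0 e -> u = star e * e -> f u = 0 -> B b -> f (u * b) = 0.
Proof.
move=> Du De eu fu0 Bb; have Be := DB De; apply: modc_eq0; apply/eqP.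
have Beb : B (e * b) by apply: (subalgM sB).
have := Cauchy_Schwarz sB flin fpos Be Beb; rewrite -eu fu0 modc0 mul0r mulrA -eu.
by rewrite -sqrf_eq0 eq_le sqr_ge0 andbT.
Qed.

(* [f] is the convex combination of the states [b |-> f (u * b) / f u] and
   [b |-> f (v * b) / f v] with [u := 1 + d] and [v := 1 - d]. *)
Let mult_small d b : D0 d -> star d = d -> cnorm d <= 1 -> B b -> f (d * b) = f d * f b.
Proof.
move=> Dd sd d1 Bb; have D1 := subalg1 sD.
have [e [De eE]] := ds_diag_sqrt ds Dd sd d1.
have [||| g [Dg gE]] := @ds_diag_sqrt _ _ _ _ _ ds (- d).
- exact: (subalgN sD).
- by rewrite starN sd.
- by rewrite cnormN.
set u := 1 + d in eE; set v := 1 - d in gE.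
have Du : D0 u by apply: (subalgD sD).
have Dv : D0 v by apply: (subalgB sD).
suff h : f (u * b) = f u * f b.
  have fd x : B x -> f (d * x) = f (u * x) - f x.
    move=> Bx; rewrite -(functionalB sB flin) //; last by apply: (subalgM sB) => //; exact: DB.
    by rewrite mulrDl mul1r addrAC subrr add0r.
  rewrite fd // -[in RHS](mulr1 d) fd ?mulr1 ?h ?f1 ?mulrBl ?mul1r //; exact: (subalg1 sB).
have Bub : B (u * b) by apply: (subalgM sB) => //; exact: DB.
have Bvb : B (v * b) by apply: (subalgM sB) => //; exact: DB.
have uv x : B x -> f (u * x) + f (v * x) = 2%:R * f x.
  move=> Bx; rewrite -(functionalD flin); try by apply: (subalgM sB) => //; exact: DB.
  rewrite -mulrDl /u /v addrACA subrr addr0 mulrDl mul1r (functionalD flin) //.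
  by rewrite mulr_natl mulr2n.
have [fu0|fu0] := eqVneq (f u) 0; first by rewrite fu0 mul0r (null Du De).
have [fv0|fv0] := eqVneq (f v) 0.
  have := uv b Bb; have := uv 1 (subalg1 sB).
  by rewrite !mulr1 f1 fv0 addr0 (null Dv Dg) // addr0 mulr1 => -> ->.
have fuE : f u = (modc (f u))%:C by apply: ge0_modcE; rewrite eE; apply/fpos/DB.
have fvE : f v = (modc (f v))%:C by apply: ge0_modcE; rewrite gE; apply/fpos/DB.
have s2 : modc (f u) + modc (f v) = 2.
  apply: (@complexI R); rewrite rmorphD /= -fuE -fvE; have := uv 1 (subalg1 sB).
  by rewrite !mulr1 f1 => ->; rewrite mulr1 rmorph_nat.
have up : 0 < modc (f u).
  by rewrite lt_def modc_ge0 andbT; apply: contra fu0 => /eqP/modc_eq0 ->.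
have vp : 0 < modc (f v).
  by rewrite lt_def modc_ge0 andbT; apply: contra fv0 => /eqP/modc_eq0 ->.
have su := split_state Du De eE fu0; have sv := split_state Dv Dg gE fv0.
have t01 : 0 < modc (f u) / 2 < 1 by apply/andP; split; lra.
have [|] := pf.2 _ _ _ su sv t01 _ b Bb.
  move=> x Bx; have := uv x Bx => h.
  rewrite !mulrA -!rmorphM /=.
  have -> : modc (f u) / 2 * (modc (f u))^-1 = 2^-1 by field; rewrite gt_eqF.
  have -> : (1 - modc (f u) / 2) * (modc (f v))^-1 = 2^-1.
    have -> : modc (f u) = 2 - modc (f v) by lra.
    by field; rewrite gt_eqF.
  rewrite -mulrDr h mulrA (_ : (2^-1)%:C * 2%:R = 1) ?mul1r //.
  by rewrite fmorphV rmorph_nat mulVf // pnatr_eq0.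
move=> h _; rewrite -h mulrA {1}fuE -rmorphM /= divff ?mul1r //.
by rewrite gt_eqF.
Qed.

Lemma pure_state_mult a b : B a -> B b -> f (a * b) = f a * f b.
Proof.
move=> Ba Bb.
(* Scaling into the unit ball reduces to [mult_small]; the added 1 keeps the divisor nonzero for
   [d = 0]. *)
have sa d : D0 d -> star d = d -> f (d * b) = f d * f b.
  move=> Dd sd; pose c := (cnorm d + 1)^-1.
  have cp : 0 < c by rewrite invr_gt0 ltr_wpDl ?cnorm_ge0.
  have Bd := DB Dd; have Bdb : B (d * b) by apply: (subalgM sB).
  have := @mult_small (c%:C *: d) b.
  rewrite -scalerAl !(functionalZ sB flin) // -mulrA => h.
  apply: (mulfI (_ : c%:C != 0)); first by rewrite eq_complex /= gt_eqF.
  apply: h => //; first exact: (subalgZ sD).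
    by rewrite starZ sd; congr (_ *: _); apply/CrealP; rewrite complex_real.
  rewrite cnormZr gtr0_norm // mulrC ler_pdivrMr ?mul1r ?lerDl ?ler01 //.
  by rewrite ltr_wpDl ?cnorm_ge0.
have dd d : D0 d -> f (d * b) = f d * f b.
  move=> Dd; have Dsd := subalgS sD Dd.
  pose x := d + star d; pose y := 'i *: (d - star d).
  have Dx : D0 x by apply: (subalgD sD).
  have Dy : D0 y by apply: (subalgZ sD); apply: (subalgB sD).
  have sx : star x = x by rewrite starD starK addrC.
  have sy : star y = y by rewrite starZ conjCi starB starK scaleNr -scalerN opprB.
  have -> : d = 2^-1 *: x + (- 'i / 2) *: y.
    rewrite scalerA mulrAC mulNr -expr2 sqrCi opprK mul1r -scalerDr addrACA subrr addr0.
    by rewrite (_ : d + d = 2%:R *: d) ?scalerA ?mulVf ?scale1r ?pnatr_eq0 // scaler_nat mulr2n.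
  clearbody x y; have Bx := DB Dx; have By := DB Dy.
  have Bxb : B (x * b) by apply: (subalgM sB).
  have Byb : B (y * b) by apply: (subalgM sB).
  rewrite mulrDl -!scalerAl !flin ?(functionalZ sB flin) //; try exact: (subalgZ sB).
  by rewrite !sa // mulrDl !mulrA.
have := Ba => /closure_tendsP[u Du ua].
apply/eqP; rewrite -subr_eq0; apply/eqP/modc_eq0/eqP; rewrite eq_le modc_ge0 andbT.
have h : (fun n => cnorm (u n - a) * cnorm b + cnorm (u n - a) * modc (f b)) @ \oo --> (0 : R).
  rewrite -[X in _ --> X]addr0 -[X in _ --> X + _](mul0r (cnorm b)).
  rewrite -[X in _ --> _ + X](mul0r (modc (f b))).
  by apply: cvgD; apply: cvgM => //; exact: cvg_cst.
apply: (ler_cvg_to (cvg_cst _) h); near=> n.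
have Bu : B (u n) by exact: DB.
have Bua : B (u n - a) by apply: (subalgB sB).
have -> : f (a * b) - f a * f b = - f ((u n - a) * b) + f (u n - a) * f b.
  have Bm := subalgM sB.
  rewrite mulrBl !(functionalB sB flin) ?(dd _ (Du n)) //; try by apply: Bm.
  by ring.
apply: (le_trans (ler_modcD _ _)); rewrite modcN modcM lerD //.
  apply: (le_trans (state_norm sB fs _)); last exact: ler_cnormM.
  exact: (subalgM sB).
by rewrite ler_wpM2r ?modc_ge0 // (state_norm sB fs).
Unshelve. all: by end_near. Qed.

Section Extension.
Variable g : A -> R[i].
Hypothesis gs : state setT g.
Hypothesis gf : forall b, B b -> g b = f b.
Let sT := setT_subalgebra A.
Let glin := state_linear gs.
Let gpos := state_pos gs.

(** [B] lies in the multiplicative domain of [g]: [f] is multiplicative and kills [k], so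
    [g (k * star k) = 0], and Cauchy-Schwarz in [A] gives [g (k * x) = 0]. *)
Lemma extension_mull d x : B d -> g (d * x) = f d * g x.
Proof.
move=> Bd; pose k := d - f d *: 1; have B1 := subalg1 sB.
have Bk : B k by apply: (subalgB sB) => //; apply: (subalgZ sB).
have fk : f k = 0 by rewrite (functionalB sB flin) ?(functionalZ sB flin) ?f1 ?mulr1 ?subrr //; exact: (subalgZ sB).
have gk : g (k * x) = 0.
  apply: modc_eq0; apply/eqP.
  have := Cauchy_Schwarz sT glin gpos (I : setT (star k)) (I : setT x); rewrite starK.
  rewrite (gf (b := k * star k)); last by apply: (subalgM sB) => //; apply: (subalgS sB).
  rewrite (pure_state_mult Bk (subalgS sB Bk)) fk mul0r modc0 mul0r.
  by rewrite -sqrf_eq0 eq_le sqr_ge0 andbT.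
apply/eqP; rewrite -subr_eq0 -gk /k mulrBl (functionalB sT glin) // -scalerAl mul1r.
by rewrite (functionalZ sT glin).
Qed.

Lemma extension_mulr d x : B d -> g (x * d) = g x * f d.
Proof.
move=> Bd; pose k := d - f d *: 1; have B1 := subalg1 sB.
have Bk : B k by apply: (subalgB sB) => //; apply: (subalgZ sB).
have fk : f k = 0 by rewrite (functionalB sB flin) ?(functionalZ sB flin) ?f1 ?mulr1 ?subrr //; exact: (subalgZ sB).
have gk : g (x * k) = 0.
  apply: modc_eq0; apply/eqP.
  have := Cauchy_Schwarz sT glin gpos (I : setT (star x)) (I : setT k); rewrite starK (gf (b := star k * k)).
    rewrite pure_state_mult ?fk ?mulr0 ?modc0 ?mulr0 //; last exact: (subalgS sB).
    by rewrite -sqrf_eq0 eq_le sqr_ge0 andbT.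
  by apply: (subalgM sB) => //; apply: (subalgS sB).
apply/eqP; rewrite -subr_eq0 -gk /k mulrBr (functionalB sT glin) // -scalerAr mulr1.
by rewrite (functionalZ sT glin) // mulrC.
Qed.
End Extension.

(* For [p * q = 0] both extensions vanish at [p * b * q]:
   [g (p * b * q) = f p * g b * f q = f (p * q) * g b]. *)
Lemma extension_unique g g' : state setT g -> (forall b, B b -> g b = f b) ->
  state setT g' -> (forall b, B b -> g' b = f b) -> g = g'.
Proof.
move=> gs gf gs' gf'; apply/funext => x; have [u ux hu] := span_seq x.
have sT := setT_subalgebra A.
have gu n : g (u n) = g' (u n).
  have [k [t [ht ->]]] := hu n.
  elim/big_ind : _ => [|y z hy hz|i _].
  - by rewrite (functional0 sT (state_linear gs)) (functional0 sT (state_linear gs')).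
  - by rewrite (functionalD (state_linear gs)) // (functionalD (state_linear gs')) // hy hz.
  have [_ [/DB Dt|[p [b [q [/DB Bp Ab /DB Bq pq ->]]]]]] := ht i; first by rewrite gf ?gf'.
  have h0 : f p * f q = 0 by rewrite -pure_state_mult // pq (functional0 sB flin).
  rewrite (extension_mulr gs gf) // (extension_mull gs gf) //.
  rewrite (extension_mulr gs' gf') // (extension_mull gs' gf') //.
  by rewrite mulrAC h0 mul0r mulrAC h0 mul0r.
apply/eqP; rewrite -subr_eq0; apply/eqP/modc_eq0/eqP; rewrite eq_le modc_ge0 andbT.
have h : (fun n => cnorm (u n - x) + cnorm (u n - x)) @ \oo --> (0 : R).
  by rewrite -[X in _ --> X]addr0; apply: cvgD.
apply: (ler_cvg_to (cvg_cst _) h); near=> n.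
have -> : g x - g' x = - g (u n - x) + g' (u n - x).
  rewrite (functionalB sT (state_linear gs)) // (functionalB sT (state_linear gs')) // gu; ring.
apply: (le_trans (ler_modcD _ _)); rewrite modcN lerD //.
  exact: (state_norm sT gs).
exact: (state_norm sT gs').
Unshelve. all: by end_near. Qed.

Lemma extension_exists : exists g, state setT g /\ forall b, B b -> g b = f b.
Proof.
exists (fun a => f (P a)); split; last by move=> b Bb; rewrite P_id.
have sT := setT_subalgebra A.
apply: (stateP sT).
- by move=> c a b _ _; rewrite P_linear flin //; exact: P_diag.
- by move=> b _; have [c [Bc ->]] := P_pos b; apply: fpos.
- by rewrite P_id ?f1 //; exact: (subalg1 sB).
- by move=> b _; rewrite (le_trans (state_norm sB fs (@P_diag b))) ?P_norm.
Qed.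
End PureState.

Lemma diagonal_system_diagonal : cstar_diagonal (closure D0).
Proof.
split; first exact: diagonal_system_cartan.
move=> f pf; have [g [gs gf]] := extension_exists pf; exists g; split=> // g' [gs' gf'].
exact: (extension_unique pf).
Qed.
End DiagonalSystems.

(** * The operator norm of matrices *)

Section OperatorNorm.
Variable R : realType.
Notation C := R[i].

Lemma l2norm_ge0 r (v : 'cV[C]_r) : 0 <= l2norm v.
Proof. exact: sqrtr_ge0. Qed.

Lemma l2norm_sqr r (v : 'cV[C]_r) : l2norm v ^+ 2 = \sum_i modc (v i 0) ^+ 2.
Proof. by rewrite sqr_sqrtr // sumr_ge0 // => i _; apply: sqr_ge0. Qed.

Lemma modc_sqr (z : C) : (modc z ^+ 2)%:C = Num.conj z * z.
Proof. by rewrite mulrC -normCK modcE rmorphXn. Qed.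

Lemma l2norm_dot r (v : 'cV[C]_r) : (l2norm v ^+ 2)%:C = (v ^t* *m v) 0 0.
Proof.
rewrite l2norm_sqr rmorph_sum mxE; apply: eq_bigr => i _.
by rewrite /= modc_sqr !mxE.
Qed.

(** Identifies the norm with that of the hermitian form [dotmx] on rows, from which the triangle
    inequality is taken. *)
Lemma l2normE r (v : 'cV[C]_r) : (l2norm v)%:C = sqrtC (dotmx v^T v^T).
Proof.
have -> : dotmx v^T v^T = (l2norm v)%:C ^+ 2.
  rewrite -rmorphXn l2norm_sqr rmorph_sum dotmxE mxE; apply: eq_bigr => i _.
  by rewrite /= modc_sqr mulrC !mxE.
by rewrite sqrCK // ler0c l2norm_ge0.
Qed.

Lemma ler_l2normD r (u v : 'cV[C]_r) : l2norm (u + v) <= l2norm u + l2norm v.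
Proof.
rewrite -lecR rmorphD /= !l2normE linearD /=.
exact: (leif_le (triangle_lerif (dotmx (C := C) (n := r)) _ _)).
Qed.

Lemma l2normZ r (c : C) (v : 'cV[C]_r) : l2norm (c *: v) = modc c * l2norm v.
Proof.
apply/eqP; rewrite -(eqrXn2 (n := 2)) ?mulr_ge0 ?l2norm_ge0 ?modc_ge0 //; apply/eqP.
rewrite exprMn !l2norm_sqr mulr_sumr; apply: eq_bigr => i _.
by rewrite !mxE modcM exprMn.
Qed.

Lemma l2norm0 r : l2norm (0 : 'cV[C]_r) = 0.
Proof. by rewrite -(scale0r 0) l2normZ modc0 mul0r. Qed.

Lemma l2norm_eq0 r (v : 'cV[C]_r) : l2norm v = 0 -> v = 0.
Proof.
move=> h; apply/matrixP => i j; rewrite ord1 mxE; apply/modc_eq0/eqP.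
have : \sum_i modc (v i 0) ^+ 2 == 0 by rewrite -l2norm_sqr h expr0n.
rewrite psumr_eq0 => [/allP /(_ i (mem_index_enum _))|k _]; last exact: sqr_ge0.
by rewrite /= sqrf_eq0.
Qed.

Lemma modc_le_l2norm r (v : 'cV[C]_r) i : modc (v i 0) <= l2norm v.
Proof.
rewrite -(ler_pXn2r (isT : (0 < 2)%N)) ?nnegrE ?modc_ge0 ?l2norm_ge0 //.
rewrite l2norm_sqr (bigD1 i) //= lerDl sumr_ge0 // => k _; exact: sqr_ge0.
Qed.

Lemma l2norm_sum (I : finType) r (F : I -> 'cV[C]_r) :
  l2norm (\sum_i F i) <= \sum_i l2norm (F i).
Proof.
elim/big_rec2 : _ => [|i x y _ h]; first by rewrite l2norm0.
by apply: (le_trans (ler_l2normD _ _)); rewrite lerD2l.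
Qed.

Lemma l2norm_delta r (i : 'I_r) : l2norm (delta_mx i 0 : 'cV[C]_r) = 1.
Proof.
apply/eqP; rewrite -(eqrXn2 (n := 2)) ?l2norm_ge0 // l2norm_sqr (bigD1 i) //=.
rewrite big1 ?addr0 => [|k ki]; rewrite mxE ?eqxx /= ?(negPf ki) ?modc0 ?expr0n //.
by rewrite /modc normr1.
Qed.

(** A crude bound, but it makes the supremum in [opnorm] a genuine one and later yields continuity
    of [opnorm] in the entries. *)
Lemma l2norm_mulmx_sum r (m : 'M[C]_r) (v : 'cV[C]_r) :
  l2norm (m *m v) <= (\sum_i \sum_j modc (m i j)) * l2norm v.
Proof.
have -> : m *m v = \sum_i \sum_j (m i j * v j 0) *: delta_mx i 0.
  apply/matrixP => i j; rewrite ord1 summxE (bigD1 i) //= [X in _ = _ + X]big1 => [|k ki].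
    by rewrite addr0 summxE mxE; apply: eq_bigr => k _; rewrite !mxE !eqxx mulr1.
  by rewrite summxE big1 // => l _; rewrite !mxE eq_sym (negPf ki) mulr0.
apply: (le_trans (l2norm_sum _)); rewrite mulr_suml ler_sum // => i _.
apply: (le_trans (l2norm_sum _)); rewrite mulr_suml ler_sum // => j _.
by rewrite l2normZ l2norm_delta mulr1 modcM ler_wpM2l ?modc_ge0 ?modc_le_l2norm.
Qed.

Lemma opnorm_has_sup r (m : 'M[C]_r) :
  has_sup [set l2norm (m *m v) | v in [set v | l2norm v <= 1]].
Proof.
split; first by exists 0, 0; rewrite ?mulmx0 /= l2norm0.
exists (\sum_i \sum_j modc (m i j)) => _ [v /= v1 <-].
rewrite (le_trans (l2norm_mulmx_sum m v)) // ler_piMr //.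
by apply: sumr_ge0 => i _; apply: sumr_ge0 => j _; apply: modc_ge0.
Qed.

Lemma opnorm_ge0 r (m : 'M[C]_r) : 0 <= opnorm m.
Proof.
apply: (sup_upper_bound (opnorm_has_sup m)).
by exists 0; rewrite ?mulmx0 /= l2norm0.
Qed.

Lemma opnormP r (m : 'M[C]_r) (v : 'cV[C]_r) : l2norm (m *m v) <= opnorm m * l2norm v.
Proof.
have [v0|v0] := eqVneq (l2norm v) 0.
  by rewrite (l2norm_eq0 v0) mulmx0 l2norm0 mulr0.
have vp : 0 < l2norm v by rewrite lt_def v0 l2norm_ge0.
rewrite -ler_pdivrMr // mulrC.
have -> : (l2norm v)^-1 * l2norm (m *m v) = l2norm (m *m ((l2norm v)^-1%:C *: v)).
  by rewrite -scalemxAr l2normZ modc_real gtr0_norm // invr_gt0.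
apply: (sup_upper_bound (opnorm_has_sup m)); eexists; last by [].
by rewrite /= l2normZ modc_real gtr0_norm ?invr_gt0 // mulVf.
Qed.

Lemma opnorm_le r (m : 'M[C]_r) (c : R) : 0 <= c ->
  (forall v, l2norm (m *m v) <= c * l2norm v) -> opnorm m <= c.
Proof.
move=> c0 h; apply: ge_sup; first by case: (opnorm_has_sup m).
move=> _ [v /= v1 <-]; apply: (le_trans (h v)); by rewrite ler_piMr.
Qed.

Lemma opnorm_le_sum r (m : 'M[C]_r) : opnorm m <= \sum_i \sum_j modc (m i j).
Proof.
apply: opnorm_le; last exact: l2norm_mulmx_sum.
by apply: sumr_ge0 => i _; apply: sumr_ge0 => j _; apply: modc_ge0.
Qed.

Lemma ler_opnormD r (m n : 'M[C]_r) : opnorm (m + n) <= opnorm m + opnorm n.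
Proof.
apply: opnorm_le => [|v]; first by rewrite addr_ge0 ?opnorm_ge0.
by rewrite mulmxDl mulrDl (le_trans (ler_l2normD _ _)) // lerD ?opnormP.
Qed.

Lemma opnormZ r (c : C) (m : 'M[C]_r) : opnorm (c *: m) <= modc c * opnorm m.
Proof.
apply: opnorm_le => [|v]; first by rewrite mulr_ge0 ?opnorm_ge0 ?modc_ge0.
by rewrite -scalemxAl l2normZ -mulrA ler_wpM2l ?modc_ge0 ?opnormP.
Qed.

Lemma opnormN r (m : 'M[C]_r) : opnorm (- m) = opnorm m.
Proof.
suff h (n : 'M[C]_r) : opnorm (- n) <= opnorm n.
  by apply/le_anti/andP; split; [exact: h|have := h (- m); rewrite opprK].
by rewrite -scaleN1r (le_trans (opnormZ _ _)) // modcN /modc normr1 mul1r.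
Qed.

Lemma opnorm0 r : opnorm (0 : 'M[C]_r) = 0.
Proof.
apply/eqP; rewrite eq_le opnorm_ge0 andbT (le_trans (opnorm_le_sum _)) //.
by rewrite big1 // => i _; rewrite big1 // => j _; rewrite mxE modc0.
Qed.

Lemma opnormBC r (m n : 'M[C]_r) : opnorm (m - n) = opnorm (n - m).
Proof. by rewrite -opnormN opprB. Qed.

Lemma ler_dist_sym (x y z : R) : x <= z + y -> y <= z + x -> `|x - y| <= z.
Proof. by move=> h1 h2; rewrite ler_norml; apply/andP; split; lra. Qed.

Lemma opnorm_dist r (m n : 'M[C]_r) : `|opnorm m - opnorm n| <= opnorm (m - n).
Proof.
apply: ler_dist_sym; first by apply: (le_trans _ (ler_opnormD _ _)); rewrite subrK.
by rewrite opnormBC; apply: (le_trans _ (ler_opnormD _ _)); rewrite subrK.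
Qed.

Lemma modc_le_opnorm r (m : 'M[C]_r) i j : modc (m i j) <= opnorm m.
Proof.
have -> : m i j = (m *m delta_mx j 0) i (0 : 'I_1) by rewrite -colE mxE.
rewrite (le_trans (modc_le_l2norm _ _)) // (le_trans (opnormP _ _)) //.
by rewrite l2norm_delta mulr1.
Qed.

Lemma opnorm_eq0 r (m : 'M[C]_r) : opnorm m = 0 -> m = 0.
Proof.
move=> h; apply/matrixP => i j; rewrite mxE; apply/modc_eq0/eqP.
by rewrite eq_le modc_ge0 andbT -h modc_le_opnorm.
Qed.

Lemma opnorm_diag r (m : 'M[C]_r) (c : R) : 0 <= c -> is_diag_mx m ->
  (forall i, modc (m i i) <= c) -> opnorm m <= c.
Proof.
move=> c0 /is_diag_mxP md mc; apply: opnorm_le => // v.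
rewrite -(ler_pXn2r (isT : (0 < 2)%N)) ?nnegrE ?mulr_ge0 ?l2norm_ge0 //.
rewrite exprMn !l2norm_sqr mulr_sumr ler_sum // => i _.
rewrite mxE (bigD1 i) //= big1 => [|k ki]; last by rewrite md ?mul0r // eq_sym.
rewrite addr0 modcM exprMn ler_wpM2r ?sqr_ge0 //.
by rewrite ler_pXn2r ?nnegrE ?modc_ge0.
Qed.

Lemma l2norm_isometry m n (V : 'M[C]_(m, n)) (v : 'cV[C]_n) :
  V ^t* *m V = 1%:M -> l2norm (V *m v) = l2norm v.
Proof.
move=> VV; apply/eqP; rewrite -(eqrXn2 (n := 2)) ?l2norm_ge0 //; apply/eqP.
apply: (@complexI R); rewrite !l2norm_dot trmx_mul map_mxM -mulmxA (mulmxA _ V).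
by rewrite VV mul1mx.
Qed.

(** Rectangular [V] is allowed because a fibre rank and the sum of its block sizes are equal only by
    proof. *)
Lemma opnorm_conj m n (V : 'M[C]_(m, n)) (a : 'M[C]_m) :
  V *m V ^t* = 1%:M -> V ^t* *m V = 1%:M -> opnorm (V ^t* *m a *m V) = opnorm a.
Proof.
suff h p q (W : 'M[C]_(p, q)) (b : 'M[C]_p) : W *m W ^t* = 1%:M -> W ^t* *m W = 1%:M ->
    opnorm (W ^t* *m b *m W) <= opnorm b.
  move=> VV' VV; apply/eqP; rewrite eq_le h //=.
  have := h _ _ (V ^t*) (V ^t* *m a *m V); rewrite trmxCK => /(_ VV VV').
  by rewrite !mulmxA VV' mul1mx -mulmxA VV' mulmx1.
move=> WW' WW; apply: opnorm_le => [|v]; first exact: opnorm_ge0.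
rewrite -!mulmxA (l2norm_isometry _ (V := W ^t*)) ?trmxCK //.
by rewrite (le_trans (opnormP _ _)) // (l2norm_isometry _ WW).
Qed.

Lemma addmxE m n (A B : 'M[C]_(m, n)) i j : (A + B) i j = A i j + B i j.
Proof. by rewrite mxE. Qed.

Lemma scalemxE m n (c : C) (A : 'M[C]_(m, n)) i j : (c *: A) i j = c * A i j.
Proof. by rewrite mxE. Qed.

Lemma l2norm_contract r (m b : 'M[C]_r) (c : R) (v : 'cV[C]_r) :
  m ^t* *m m + b ^t* *m b = (c ^+ 2)%:C%:M ->
  l2norm (m *m v) ^+ 2 + l2norm (b *m v) ^+ 2 = c ^+ 2 * l2norm v ^+ 2.
Proof.
move=> h; apply: (@complexI R); rewrite rmorphD [X in _ = X]rmorphM /= !l2norm_dot.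
have := congr1 (fun h => (v ^t* *m h *m v) 0 0) h.
rewrite mul_mx_scalar -scalemxAl mulmxDr mulmxDl addmxE scalemxE => <-.
by rewrite !trmx_mul !map_mxM !mulmxA.
Qed.

Lemma l2norm_defect r (m : 'M[C]_r) (c : R) (v : 'cV[C]_r) :
  (v ^t* *m ((c ^+ 2)%:C%:M - m ^t* *m m) *m v) 0 0
  = (c ^+ 2 * l2norm v ^+ 2 - l2norm (m *m v) ^+ 2)%:C.
Proof.
rewrite mulmxBr mulmxBl mul_mx_scalar -scalemxAl addmxE scalemxE -l2norm_dot.
have -> : v ^t* *m (m ^t* *m m) *m v = (m *m v) ^t* *m (m *m v).
  by rewrite trmx_mul map_mxM !mulmxA.
by rewrite mxE -l2norm_dot [RHS]rmorphB /= [in RHS]rmorphM.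
Qed.

(** Turns a norm bound into a polynomial identity, which unital star-homomorphisms and block sums
    preserve. The witness [b] is a square root of the defect [h], taken in an orthonormal
    eigenbasis. *)
Lemma opnorm_contractP r (m : 'M[C]_r) (c : R) : 0 <= c ->
  opnorm m <= c <-> exists b : 'M[C]_r, m ^t* *m m + b ^t* *m b = (c ^+ 2)%:C%:M.
Proof.
move=> c0; split; last first.
  move=> [b h]; apply: opnorm_le => // v.
  rewrite -(ler_pXn2r (isT : (0 < 2)%N)) ?nnegrE ?mulr_ge0 ?l2norm_ge0 //.
  by rewrite exprMn -(l2norm_contract v h) lerDl sqr_ge0.
move=> mc; pose h := (c ^+ 2)%:C%:M - m ^t* *m m.
have hh : h ^t* = h.
  rewrite linearB /= map_mxB trmx_mul map_mxM trmxCK tr_scalar_mx map_scalar_mx /=.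
  by congr (_%:M - _); apply/CrealP; rewrite complex_real.
have hherm : h \is hermsymmx by apply/is_hermitianmxP; rewrite expr0 scale1r.
pose P := spectralmx h; pose d := spectral_diag h.
have PU : P \is unitarymx := spectral_unitarymx h.
have PP : P *m P ^t* = 1%:M by apply/unitarymxP.
have P'P : P ^t* *m P = 1%:M by rewrite -invmx_unitary // mulVmx // unitarymx_unit.
have hE : h = P ^t* *m diag_mx d *m P.
  by rewrite -invmx_unitary //; apply/orthomx_spectralP/hermitian_normalmx.
have dE : diag_mx d = P *m h *m P ^t*.
  by rewrite hE !mulmxA PP mul1mx -mulmxA PP mulmx1.
(* The eigenvalue is the quadratic form of [h] at the eigenvector [v], nonnegative because [c]
   bounds the norm of [m]. *)
have d0 i : 0 <= d 0 i.
  pose v := P ^t* *m (delta_mx i 0 : 'cV[C]_r).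
  have -> : d 0 i = (v ^t* *m h *m v) 0 0.
    rewrite /v trmx_mul map_mxM trmxCK -!mulmxA !(mulmxA P) -(mulmxA P h) !mulmxA.
    rewrite -(mulmxA _ P) -(mulmxA _ (P *m h)) -dE.
    rewrite -mulmxA mul_diag_mx; rewrite mxE (bigD1 i) //= big1 => [|k ki].
      by rewrite !mxE !eqxx addr0 /= conjC1 mul1r mulr1.
    by rewrite !mxE (negPf ki) /= conjC0 mul0r.
  rewrite l2norm_defect ler0c subr_ge0 -exprMn.
  rewrite ler_pXn2r ?nnegrE ?mulr_ge0 ?l2norm_ge0 //.
  by rewrite (le_trans (opnormP _ _)) // ler_wpM2r ?l2norm_ge0.
exists (diag_mx (map_mx sqrtC d) *m P).
rewrite trmx_mul map_mxM tr_diag_mx map_diag_mx -mulmxA (mulmxA (diag_mx _)).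
have -> : diag_mx (map_mx Num.conj (map_mx sqrtC d)) *m diag_mx (map_mx sqrtC d) = diag_mx d.
  rewrite mulmx_diag; congr diag_mx; apply/rowP => i; rewrite !mxE.
  have /ger0_real/CrealP -> : 0 <= sqrtC (d 0 i) by rewrite sqrtC_ge0.
  by rewrite -expr2 sqrtCK.
by rewrite mulmxA -hE /h addrC subrK.
Qed.

Lemma opnorm_hom r (f : 'M[C]_r -> 'M[C]_r) : linear f -> {morph f : a b / a *m b} ->
  {morph f : a / a ^t*} -> f 1%:M = 1%:M -> forall m, opnorm (f m) <= opnorm m.
Proof.
move=> flin fM fS f1 m; apply/opnorm_contractP; first exact: opnorm_ge0.
have [b hb] := (opnorm_contractP m (opnorm_ge0 m)).1 (lexx _).
exists (f b); rewrite -!fS -!fM -[X in X + _]scale1r -flin scale1r hb.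
have f0 : f 0 = 0 by have := flin (-1) 0 0; rewrite !scaleN1r oppr0 addr0 addNr.
rewrite -[in LHS](mulr1 (_%:C)) -scale_scalar_mx -[in LHS](addr0 (_ *: _)) flin f0 f1 addr0.
by rewrite scale_scalar_mx mulr1.
Qed.

Lemma mx_star_aut1 r (f : 'M[C]_r -> 'M[C]_r) : mx_star_aut f -> f 1%:M = 1%:M.
Proof.
case=> [[g fg gf] _ fM _].
by rewrite -[LHS]mul1mx -{1}(gf 1%:M) -fM mulmx1 gf.
Qed.

Lemma opnorm_aut r (f : 'M[C]_r -> 'M[C]_r) m : mx_star_aut f -> opnorm (f m) = opnorm m.
Proof.
move=> fa; have f1 := mx_star_aut1 fa; have [[g fg gf] flin fM fS] := fa.
have finj : injective f := can_inj fg.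
apply/le_anti/andP; split; first exact: opnorm_hom.
rewrite -{1}(fg m); apply: opnorm_hom.
- by move=> c a b; apply: finj; rewrite flin !gf.
- by move=> a b; apply: finj; rewrite fM !gf.
- by move=> a; apply: finj; rewrite fS !gf.
- by rewrite -f1 fg.
Qed.

Lemma mxdiag_mul p (p_ : 'I_p -> nat) (B B' : forall i, 'M[C]_(p_ i)) :
  \mxdiag_i B i *m \mxdiag_i B' i = \mxdiag_i (B i *m B' i).
Proof.
rewrite [in RHS]/mxdiag [X in _ *m X]/mxdiag mul_mxdiag_mxblock; apply: eq_mxblock => i j.
by case: eqP => [e|_]; [case: _ / e; rewrite !conform_mx_id|rewrite mulmx0].
Qed.
End OperatorNorm.

(** * Fields of matrix algebras *)

(* Only the norms [opnorm (fev x a)] are required to be continuous in [x], so that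
   a frame that varies discontinuously can be absorbed into [fev]. *)
Record matrix_field (R : realType) (A : cstarType R) := MatrixField {
  fbase : topologicalType;
  frank : fbase -> nat;
  fev : forall x, A -> 'M[R[i]]_(frank x);
  fbase_compact : compact [set: fbase];
  fbase_hausdorff : hausdorff_space fbase;
  frank_constant : forall x, \forall y \near x, frank y = frank x;
  fev_hom : forall x, mx_star_hom (fev x);
  fev_norm_le : forall x a, opnorm (fev x a) <= cnorm a;
  fev_norm : forall a (c : R), 0 <= c -> (forall x, opnorm (fev x a) <= c) -> cnorm a <= c;
  fev_continuous : forall a, continuous (fun x => opnorm (fev x a));
  fev_scalar : forall f : fbase -> R, continuous f ->
    exists a, forall x, fev x a = (f x)%:C%:M;
  fev_surj : forall x m, exists a, fev x a = m
}.

Lemma compact_seq_cover (T : topologicalType) (V : T -> set T) :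
  compact [set: T] -> (forall x, nbhs x (V x)) ->
  exists s : seq T, forall y, exists2 x, x \in s & V x y.
Proof.
move=> /compact_near_coveringP cT nV.
(* The filter of properties that hold for all sufficiently large finite subsets of [T]; a
   near-covering statement along it yields a finite subcover. *)
pose F : set_system (seq T) :=
    [set Q : set (seq T) | exists s0 : seq T, forall s : seq T, {subset s0 <= s} -> Q s].
have FF : Filter F.
  split; first by exists [::].
    move=> P Q [s hs] [t ht]; exists (s ++ t) => u su; split.
      by apply: hs => z zs; apply: su; rewrite mem_cat zs.
    by apply: ht => z zt; apply: su; rewrite mem_cat zt orbT.
  by move=> P Q PQ [s hs]; exists s => t st; apply: PQ; apply: hs.
have [|s0 hs] := cT (seq T) F (fun s y => exists2 x, x \in s & V x y) FF.
  move=> x _; exists (V x, [set s : seq T | x \in s]); first split=> //=.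
    by exists [:: x] => s; apply; rewrite mem_head.
  by move=> [y s] /= [Vy xs]; exists x.
by exists s0 => y; apply: hs.
Qed.

Lemma compact_bump (R : realType) (X : topologicalType) :
  compact [set: X] -> hausdorff_space X -> forall x (U : set X), nbhs x U ->
  exists g : X -> R,
  [/\ continuous g, g x = 1, forall y, 0 <= g y <= 1 & forall y, ~ U y -> g y = 0].
Proof.
move=> cX hX x U; rewrite nbhsE => -[V [oV Vx] VU].
have cx : closed [set x] by apply: accessible_closed_set1; apply/hausdorff_accessible.
have d0 : ~` V `&` [set x] = set0.
  by apply/seteqP; split=> // y [/= Vy yx]; apply: Vy; rewrite yx.
have /(uniform_separatorP (R := R))[f [cf f01 fV fx]] :=
  normal_uniform_separator (compact_normal hX cX) (open_closedC oV) cx d0.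
exists f; split=> //.
- by have /= := fx (f x); apply; exists x.
- by move=> y; have := f01 (f y); rewrite /= in_itv /=; apply; exists y.
- by move=> y Uy; have /= := fV (f y); apply; exists y => // /VU.
Qed.

Lemma ex2_def (T : Type) (P Q : T -> Prop) : (exists2 x, P x & Q x) -> exists x, P x /\ Q x.
Proof. by move=> [x Px Qx]; exists x. Qed.

Lemma mulmx_gram (R : realType) n (m w : 'M[R[i]]_n) :
  (m *m w) ^t* *m (m *m w) = w ^t* *m m ^t* *m m *m w.
Proof. by rewrite trmx_mul map_mxM !mulmxA. Qed.

Section MatrixFields.
Variables (R : realType) (A : cstarType R) (F : matrix_field A).
Notation X := (fbase F).
Notation ev := (@fev R A F).

Lemma fevZD x (c : R[i]) a b : ev x (c *: a + b) = c *: ev x a + ev x b.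
Proof. by case: (fev_hom x) => h _ _ _; rewrite h. Qed.

Lemma fevM x a b : ev x (a * b) = ev x a *m ev x b.
Proof. by case: (fev_hom x). Qed.

Lemma fevS x a : ev x (star a) = (ev x a) ^t*.
Proof. by case: (fev_hom x). Qed.

Lemma fev1 x : ev x 1 = 1%:M.
Proof. by case: (fev_hom x). Qed.

Lemma fevD x a b : ev x (a + b) = ev x a + ev x b.
Proof. by rewrite -[a]scale1r fevZD !scale1r. Qed.

Lemma fev0 x : ev x 0 = 0.
Proof. by apply: (addrI (ev x 0)); rewrite -fevD !addr0. Qed.

Lemma fevZ x (c : R[i]) a : ev x (c *: a) = c *: ev x a.
Proof. by rewrite -[_ *: a]addr0 fevZD fev0 addr0. Qed.

Lemma fevN x a : ev x (- a) = - ev x a.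
Proof. by rewrite -scaleN1r fevZ scaleN1r. Qed.

Lemma fevB x a b : ev x (a - b) = ev x a - ev x b.
Proof. by rewrite fevD fevN. Qed.

Lemma fevDE x a b i j : ev x (a + b) i j = ev x a i j + ev x b i j.
Proof. by rewrite fevD mxE. Qed.

Lemma fevBE x a b i j : ev x (a - b) i j = ev x a i j - ev x b i j.
Proof. by rewrite fevB !mxE. Qed.

Lemma fevZE x (c : R[i]) a i j : ev x (c *: a) i j = c * ev x a i j.
Proof. by rewrite fevZ mxE. Qed.

Lemma fev_sum x (I : Type) (s : seq I) (P : pred I) (f : I -> A) :
  ev x (\sum_(i <- s | P i) f i) = \sum_(i <- s | P i) ev x (f i).
Proof. by apply: (big_morph _ (fevD x) (fev0 x)). Qed.

Lemma fev_inj a b : (forall x, ev x a = ev x b) -> a = b.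
Proof.
move=> h; apply/eqP; rewrite -subr_eq0; apply/eqP/cnorm0_eq0/le_anti.
rewrite cnorm_ge0 andbT; apply: (fev_norm (m0 := F)) => // x.
by rewrite fevB h subrr opnorm0.
Qed.

Lemma near_opnorm x a (e : R) : opnorm (ev x a) < e -> \forall y \near x, opnorm (ev y a) < e.
Proof. by move=> h; apply: (cvgr_lt _ (@fev_continuous _ _ F a x)). Qed.

Lemma near_fev0 x a (e : R) : 0 < e -> ev x a = 0 -> \forall y \near x, opnorm (ev y a) <= e.
Proof.
move=> e0 xa; have h : opnorm (ev x a) < e by rewrite xa opnorm0.
by apply: filterS (near_opnorm h) => y /ltW.
Qed.

Lemma scalar_bump x (U : set X) : nbhs x U -> exists g : X -> R,
  [/\ continuous g, g x = 1, forall y, 0 <= g y <= 1 & forall y, ~ U y -> g y = 0].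
Proof. exact: (compact_bump R (@fbase_compact _ _ F) (@fbase_hausdorff _ _ F)). Qed.

Definition scalar_like (u : A) := forall x, exists t : R, ev x u = t%:C%:M.

Lemma scalar_like_central u a : scalar_like u -> u * a = a * u.
Proof.
move=> su; apply: fev_inj => x; have [t ut] := su x.
by rewrite !fevM ut mul_scalar_mx mul_mx_scalar.
Qed.

(** * Gluing local approximations *)

Section Gluing.
Variable S : set A.
Hypothesis S0 : S 0.
Hypothesis SD : forall a b, S a -> S b -> S (a + b).
Hypothesis SM : forall u a, scalar_like u -> S a -> S (u * a).
Variable s : forall x : X, 'M[R[i]]_(frank x).
Hypothesis s_local : forall (x : X) (e : R), 0 < e -> exists2 a, S a &
  \forall y \near x, opnorm (s y - ev y a) <= e.

Lemma opnorm_sum (I : Type) (r : seq I) n (f : I -> 'M[R[i]]_n) :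
  opnorm (\sum_(i <- r) f i) <= \sum_(i <- r) opnorm (f i).
Proof.
elim/big_rec2 : _ => [|i x y _ h]; first by rewrite opnorm0.
by apply: (le_trans (ler_opnormD _ _)); rewrite lerD2l.
Qed.

(** The field [s] is not known to be continuous. With a partition of unity, [s y] is the convex
    combination of copies of itself, and each copy with nonzero weight is within [e] of the local
    approximant of that weight. *)
Lemma glue_approx (e : R) : 0 < e -> exists2 a, S a & forall y, opnorm (s y - ev y a) <= e.
Proof.
move=> e0.
have h x : exists ag : A * (X -> R), [/\ S ag.1, continuous ag.2, ag.2 x = 1,
    forall y, 0 <= ag.2 y <= 1 & forall y, ag.2 y != 0 -> opnorm (s y - ev y ag.1) <= e].
  have [a Sa na] := s_local x e0; have [g [cg gx g01 gU]] := scalar_bump na.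
  exists (a, g); split=> // y /= gy; apply: boolp.contrapT => hy.
  by move: gy; rewrite gU ?eqxx.
have [ag hag] := choice h.
(* Finitely many of these sets cover, so the total weight [w] is positive everywhere and can be
   divided by. *)
pose V x := [set y | 2^-1 < (ag x).2 y].
have oV x : open (V x).
  have [_ cg _ _ _] := hag x.
  by apply: (@open_comp _ _ (ag x).2 [set t | 2^-1 < t]) => [y _|]; [exact: cg|exact: open_gt].
have [x|D cD] := compact_seq_cover (V := V) (@fbase_compact _ _ F).
  by apply: open_nbhs_nbhs; split=> //; rewrite /V /=; have [_ _ -> _ _] := hag x; rewrite invf_lt1 ?ltr1n.
pose w y := \sum_(x <- D) (ag x).2 y.
have wp y : 0 < w y.
  have [x xD Vx] := cD y.
  rewrite /w (big_rem x xD) /= ltr_pwDl //.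
    by apply: lt_trans Vx; rewrite invr_gt0.
  by apply: sumr_ge0 => z _; have [_ _ _ /(_ y) /andP[]] := hag z.
have cw : continuous w.
  move=> y; apply: (cvg_big add_continuous) => x _; have [_ cg _ _ _] := hag x; exact: cg.
have hc x : exists u, forall y, ev y u = ((ag x).2 y / w y)%:C%:M.
  apply: fev_scalar => y; apply: cvgM; first by have [_ cg _ _ _] := hag x; exact: cg.
  by apply: cvgV; [rewrite gt_eqF|exact: cw].
have [u hu] := choice hc.
exists (\sum_(x <- D) u x * (ag x).1).
  elim/big_rec : _ => [//|x y _ Sy]; apply: SD => //; apply: SM; last by have [] := hag x.
  by move=> z; exists ((ag x).2 z / w z).
move=> y.
have sE : s y = \sum_(x <- D) ((ag x).2 y / w y)%:C *: s y.
  rewrite -scaler_suml -rmorph_sum /= -mulr_suml -/(w y) divff ?gt_eqF // scale1r //.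
rewrite {1}sE fev_sum -sumrB (le_trans (opnorm_sum _ _)) //.
have -> : e = \sum_(x <- D) (ag x).2 y / w y * e.
  by rewrite -!mulr_suml -/(w y) divff ?gt_eqF // mul1r.
apply: ler_sum => x _; rewrite fevM hu mul_scalar_mx -scalerBr.
have [_ _ _ /(_ y)/andP[g0 _] hg] := hag x.
have c0 : 0 <= (ag x).2 y / w y by rewrite divr_ge0 // ltW.
rewrite (le_trans (opnormZ _ _)) // modc_real ger0_norm //.
have [->|gy] := eqVneq ((ag x).2 y) 0; first by rewrite !mul0r.
by rewrite ler_wpM2l // hg.
Qed.

(** Membership in [closure S] is kept for [thin_span], where it is the whole point; for diagonal
    elements the existence of [a] suffices, as diagonality can be read off [s]. *)
Lemma glue : exists2 a, closure S a & forall x, ev x a = s x.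
Proof.
have /choice[u hu] n : exists a, S a /\ forall y, opnorm (s y - ev y a) <= harmonic n.
  by have [a Sa ha] := glue_approx (harmonic_gt0 n); exists a.
have [|a ua] := @cnorm_cauchy _ A u harmonic _ cvg_harmonic.
  move=> m n; apply: (fev_norm (m0 := F)); first by rewrite addr_ge0 ?harmonic_ge0.
  move=> x; rewrite fevB; have [[_ hm] [_ hn]] := (hu m, hu n).
  rewrite -(subrK (s x) (ev x (u m))) -addrA (le_trans (ler_opnormD _ _)) //.
  by rewrite lerD // opnormBC.
exists a; first by apply/closure_tendsP; exists u => // n; case: (hu n).
move=> x; apply/esym/eqP; rewrite -subr_eq0; apply/eqP/opnorm_eq0/le_anti.
rewrite opnorm_ge0 andbT.
have h : (fun n => harmonic n + cnorm (u n - a)) @ \oo --> (0 : R).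
  by rewrite -[X in _ --> X]addr0; apply: cvgD => //; exact: cvg_harmonic.
apply: (ler_cvg_to (cvg_cst _) h); near=> n.
rewrite -(subrK (ev x (u n)) (s x)) -addrA (le_trans (ler_opnormD _ _)) //.
have [_ hn] := hu n; rewrite lerD // -fevB; exact: fev_norm_le.
Unshelve. all: by end_near. Qed.
End Gluing.

Definition diagonals : set A := [set a | forall x, is_diag_mx (ev x a)].

Lemma diagonalsP a : diagonals a -> forall x i j, i != j -> ev x a i j = 0.
Proof. by move=> Da x i j ij; have /is_diag_mxP := Da x; apply. Qed.

Lemma diagonals_subalgebra : star_subalgebra diagonals.
Proof.
split=> [x|c a b Da Db x|a b Da Db x|a Da x]; apply/is_diag_mxP => i j ij.
- by rewrite fev1 mxE -val_eqE (negPf ij).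
- by rewrite fevZD !mxE !diagonalsP // mulr0 addr0.
- rewrite fevM mxE big1 // => k _; have [ik|ik] := eqVneq i k; last by rewrite diagonalsP ?mul0r.
  by rewrite -ik mulrC diagonalsP ?mul0r.
- by rewrite fevS !mxE diagonalsP ?conjC0 // eq_sym.
Qed.

Lemma diagonals_mul a b x i : diagonals a -> ev x (a * b) i i = ev x a i i * ev x b i i.
Proof.
move=> Da; rewrite fevM mxE (bigD1 i) //= big1 ?addr0 // => k ki.
by rewrite diagonalsP ?mul0r // eq_sym.
Qed.

Lemma diagonals_inj a b : diagonals a -> diagonals b ->
  (forall x i, ev x a i i = ev x b i i) -> a = b.
Proof.
move=> Da Db h; apply: fev_inj => x; apply/matrixP => i j.
by have [<-|ij] := eqVneq i j; rewrite ?h // !diagonalsP.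
Qed.

Lemma diagonals_comm : Defs.commutative diagonals.
Proof.
move=> a b Da Db; have sD := diagonals_subalgebra.
apply: diagonals_inj; [exact: (subalgM sD)|exact: (subalgM sD)|move=> x i].
by rewrite !diagonals_mul // mulrC.
Qed.

Lemma diagonals_scalar u a : scalar_like u -> diagonals a -> diagonals (u * a).
Proof.
move=> su Da x; apply/is_diag_mxP => i j ij; have [t ut] := su x.
by rewrite fevM ut mul_scalar_mx mxE diagonalsP ?mulr0.
Qed.

Lemma glue_diagonals (s : forall x : X, 'M[R[i]]_(frank x)) :
  (forall x, is_diag_mx (s x)) ->
  (forall (x : X) (e : R), 0 < e -> exists2 a, diagonals a &
    \forall y \near x, opnorm (s y - ev y a) <= e) ->
  exists2 a, diagonals a & forall x, ev x a = s x.
Proof.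
move=> sdiag hs; have sD := diagonals_subalgebra.
have [||| a _ ha] := glue _ _ _ hs.
- exact: subalg0.
- exact: subalgD.
- exact: diagonals_scalar.
by exists a => // x; rewrite ha.
Qed.

Definition positives : set A :=
  [set a | diagonals a /\ forall x i, 0 <= ev x a i i].

Lemma positives_star c : positives c -> star c = c.
Proof.
move=> [Dc c0]; apply: diagonals_inj => // [|x i]; first exact: (subalgS diagonals_subalgebra).
by rewrite fevS !mxE; apply/CrealP/ger0_real.
Qed.

Lemma diagonals_star_mul d x i : diagonals d -> ev x (star d * d) i i = (modc (ev x d i i) ^+ 2)%:C.
Proof.
move=> Dd; rewrite diagonals_mul; last exact: (subalgS diagonals_subalgebra).
by rewrite fevS !mxE modc_sqr.
Qed.

Lemma star_mul_positive d : diagonals d -> positives (star d * d).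
Proof.
move=> Dd; have sD := diagonals_subalgebra.
split; first by apply: (subalgM sD) => //; apply: (subalgS sD).
by move=> x i; rewrite diagonals_star_mul // ler0c sqr_ge0.
Qed.

(** Hoelder continuity of the square root, on scalars: for nonnegative p and q, |p - q| is at most p
    + q. *)
Lemma modc_sqr_dist (p q : R[i]) : 0 <= p -> 0 <= q ->
  modc (p - q) ^+ 2 <= modc (p ^+ 2 - q ^+ 2).
Proof.
move=> /ge0_modcE -> /ge0_modcE ->.
have p0 := modc_ge0 p; have q0 := modc_ge0 q.
rewrite -!rmorphXn -!rmorphB !modc_real /= subr_sqr normrM expr2.
rewrite ler_wpM2l // [leRHS]ger0_norm ?addr_ge0 // ler_norml; apply/andP; split; lra.
Qed.

Definition full := forall (x : X) (d : 'rV_(frank x)),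
  exists2 a, diagonals a & ev x a = diag_mx d.

Hypothesis F_full : full.

(** Near [x] the approximant is [star b * b], where [b] has fourth roots as entries at [x]: thus it
    is positive everywhere and the exact root at [x]. Its square is within [e ^+ 2] of [d] nearby,
    so [modc_sqr_dist] puts it within [e] of the root. *)
Lemma positives_sqrt d : positives d -> exists2 c, positives c & c * c = d.
Proof.
move=> [Dd d0]; have sD := diagonals_subalgebra.
pose s x := diag_mx (\row_i sqrtC (ev x d i i)).
have [|x e e0|c Dc cE] := @glue_diagonals s.
- by move=> x; apply: diag_mx_is_diag.
- have [b Db bE] := F_full (\row_i sqrtC (sqrtC (ev x d i i))).
  have [Da a0] := star_mul_positive Db; set a := star b * b in Da a0.
  exists a => //.
  have aE i : ev x a i i = sqrtC (ev x d i i).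
    rewrite diagonals_star_mul // bE !mxE eqxx mulr1n modc_sqr.
    rewrite (CrealP _) ?ger0_real ?sqrtC_ge0 ?d0 // -expr2 sqrtCK //.
  have xz : ev x (a * a - d) = 0.
    apply/matrixP => i j; rewrite [RHS]mxE; have [<-|ij] := eqVneq i j.
      by rewrite fevBE diagonals_mul // aE -expr2 sqrtCK subrr.
    by apply: diagonalsP => //; apply: (subalgB sD) => //; apply: (subalgM sD).
  have e2 : 0 < e ^+ 2 by rewrite exprn_gt0.
  apply: filterS (near_fev0 e2 xz) => y hy; apply: opnorm_diag; first exact: ltW.
    by apply/is_diag_mxP => i j ij; rewrite !mxE -val_eqE (negPf ij) mulr0n sub0r (diagonalsP Da) ?oppr0 // -val_eqE.
  move=> i; rewrite -(ler_pXn2r (isT : (0 < 2)%N)) ?nnegrE ?modc_ge0 ?(ltW e0) //.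
  rewrite !mxE eqxx mulr1n -modcN opprB (le_trans (modc_sqr_dist _ _)) ?sqrtC_ge0 ?a0 ?d0 //.
  rewrite sqrtCK (le_trans _ hy) //.
  by have := modc_le_opnorm (ev y (a * a - d)) i i; rewrite fevBE diagonals_mul.
exists c.
  by split=> // x i; rewrite cE !mxE eqxx mulr1n sqrtC_ge0 d0.
apply: diagonals_inj => //; first exact: (subalgM sD).
by move=> x i; rewrite diagonals_mul // cE !mxE eqxx mulr1n -expr2 sqrtCK.
Qed.

Lemma positive_part t : diagonals t -> star t = t -> exists2 p, positives p &
  forall x i, ev x p i i = if 0 <= ev x t i i then ev x t i i else 0.
Proof.
move=> Dt st; have sD := diagonals_subalgebra.
have tr x i : ev x t i i \is Num.real.
  by apply/CrealP; rewrite -{2}st fevS !mxE.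
have [c [Dc c0] cc] : exists2 c, positives c & c * c = star t * t.
  by apply/positives_sqrt/star_mul_positive.
have cE x i : ev x c i i = `|ev x t i i|.
  apply/eqP; rewrite -(eqrXn2 (n := 2)) // ?normr_ge0 // expr2 -diagonals_mul // cc.
  by rewrite diagonals_star_mul // modcE rmorphXn.
have pE x i : ev x (2^-1 *: (t + c)) i i = if 0 <= ev x t i i then ev x t i i else 0.
  rewrite fevZ fevD !mxE cE; case: ifP => [t0|/negbT].
    by rewrite ger0_norm //; field.
  by rewrite -real_ltNge ?real0 // => t0; rewrite ltr0_norm // subrr mulr0.
exists (2^-1 *: (t + c)) => //; split; first by apply: (subalgZ sD); apply: (subalgD sD).
by move=> x i; rewrite pE; case: ifP.
Qed.

(* With [h i] positive and [ev x (h i) = delta_mx i i], take for [p i] the positive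
   part of [t i := h i - \sum_(l != i) h l]; these are orthogonal as
   [t i + t j <= 0]. *)
Lemma orthogonal_family x : exists p : 'I_(frank x) -> A,
  [/\ forall i, positives (p i), forall i j, i != j -> p i * p j = 0
    & forall i, ev x (p i) = delta_mx i i].
Proof.
have sD := diagonals_subalgebra.
have hh i : exists h, positives h /\ ev x h = delta_mx i i.
  have [b Db bE] := F_full (delta_mx 0 i : 'rV_(frank x)).
  exists (star b * b); split; first exact: star_mul_positive.
  apply/matrixP => k l; rewrite [RHS]mxE; have [<-|kl] := eqVneq k l.
    rewrite diagonals_star_mul // bE !mxE !eqxx mulr1n andbb /=.
    by case: (k == i); rewrite /= ?modc0 /modc ?normr1 ?expr1n ?expr0n.
  have /diagonalsP-> // := (star_mul_positive Db).1.
  by case: (eqVneq k i) kl => [->|_ _] //=; rewrite eq_sym => /negPf ->.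
have [h hP] := choice hh.
have Dh i : diagonals (h i) by have [[]] := hP i.
have h0 i y k : 0 <= ev y (h i) k k by have [[_ hp] _] := hP i.
pose t i := 2%:R *: h i - \sum_l h l.
have Ds : diagonals (\sum_l h l) by apply: (subalg_sum sD).
have Dt i : diagonals (t i) by apply: (subalgB sD) => //; apply: (subalgZ sD).
have sh i : star (h i) = h i by apply: positives_star; case: (hP i).
have st i : star (t i) = t i.
  rewrite /t starB starZ sh star_sum; congr (_ - _); last by apply: eq_bigr => l _; exact: sh.
  by rewrite conjC_nat.
have tE i y k : ev y (t i) k k = 2%:R * ev y (h i) k k - \sum_l ev y (h l) k k.
  by rewrite fevBE fevZE fev_sum summxE.
have [p hp] := choice (fun i => ex2_def (positive_part (Dt i) (st i))).
exists p; split=> [i|i j ij|i]; first by case: (hp i).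
- have [[[Dpi _] pi] [[Dpj _] pj]] := (hp i, hp j).
  apply: diagonals_inj; [exact: (subalgM sD)|exact: (subalg0 sD)|move=> y k].
  rewrite diagonals_mul // pi pj fev0 mxE.
  case: ifP => ti; last by rewrite mul0r.
  case: ifP => tj; last by rewrite mulr0.
  have tij : ev y (t i) k k + ev y (t j) k k <= 0.
    rewrite !tE (bigD1 i) //= (bigD1 j) //=; last by rewrite eq_sym.
    set a := ev y (h i) k k; set b := ev y (h j) k k.
    have : 0 <= \sum_(l < frank x | (l != i) && (l != j)) ev y (h l) k k by apply: sumr_ge0.
    set c := \sum_(l < _ | _) _ => c0.
    have -> : 2%:R * a - (a + (b + c)) + (2%:R * b - (a + (b + c))) = - (2%:R * c) by ring.
    by rewrite oppr_le0 mulr_ge0.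
  have /le_anti -> : ev y (t i) k k <= 0 <= ev y (t i) k k; last by rewrite mul0r.
  by rewrite ti andbT (le_trans _ tij) // lerDl.
have [[Dp _] pE] := hp i; apply/matrixP => k l; have [<-|kl] := eqVneq k l; last first.
  rewrite diagonalsP // mxE; case: eqP => //= ki; case: eqP => // li.
  by rewrite ki li eqxx in kl.
rewrite pE tE [RHS]mxE andbb.
have hE l' : ev x (h l') k k = (k == l')%:R by have [_ ->] := hP l'; rewrite mxE andbb.
rewrite hE (bigD1 k) //= big1 => [|l' /negPf lk]; last by rewrite hE eq_sym lk.
rewrite hE eqxx addr0; case: (k == i).
  by rewrite mulr1 -[X in _ - X]mulr1n -natrB //= ler01.
by rewrite mulr0 sub0r oppr_ge0 ler10.
Qed.

Definition thin (p : A) := diagonals p /\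
  forall y k l, ev y p k k != 0 -> ev y p l l != 0 -> k = l.

Lemma diagonals_sandwich p a q y k l : diagonals p -> diagonals q ->
  ev y (p * a * q) k l = ev y p k k * ev y a k l * ev y q l l.
Proof.
move=> Dp Dq; rewrite fevM mxE (bigD1 l) //= big1 => [|j jl].
  rewrite addr0; congr (_ * _); rewrite fevM mxE (bigD1 k) //= big1 ?addr0 // => j jk.
  by rewrite (diagonalsP Dp) ?mul0r // eq_sym.
by rewrite (diagonalsP Dq) ?mulr0.
Qed.

(* Near [x] the [frank x] elements of an orthogonal family are nonzero, which
   leaves each of them exactly one nonzero entry. *)
Lemma thin_family (x : X) : exists p : 'I_(frank x) -> A,
  [/\ forall i, thin (p i), forall i j, i != j -> p i * p j = 0
    & forall i, ev x (p i) = delta_mx i i].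
Proof.
have sD := diagonals_subalgebra.
have [p [pp po px]] := orthogonal_family x.
have Dp i : diagonals (p i) by case: (pp i).
pose W := [set y : X | frank y = frank x /\ forall i, ev y (p i) <> 0].
have nW : nbhs x W.
  apply: filterI; first exact: frank_constant.
  apply: filter_forall => i.
  have h : 0 < opnorm (ev x (p i)).
    rewrite lt_def opnorm_ge0 andbT; apply/eqP => /opnorm_eq0 /matrixP /(_ i i) /eqP.
    by rewrite px !mxE !eqxx oner_eq0.
  apply: filterS (cvgr_gt _ (@fev_continuous _ _ F (p i) x) _ h) => y hy py.
  by rewrite py opnorm0 ltxx in hy.
have thinW y i k l : W y -> ev y (p i) k k != 0 -> ev y (p i) l l != 0 -> k = l.
  move=> [ry pne] kk ll.
  have hk j : exists k, ev y (p j) k k != 0.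
    apply: boolp.contrapT => hn; apply: (pne j); apply/matrixP => a b; rewrite mxE.
    have [<-|ab] := eqVneq a b; last by rewrite diagonalsP.
    by apply/eqP; apply: boolp.contrapT => /negP ha; apply: hn; exists a.
  have [f hf] := choice hk.
  have po' j j' c : ev y (p j) c c != 0 -> ev y (p j') c c != 0 -> j = j'.
    move=> h1 h2; apply/eqP; apply: boolp.contrapT => /negP jj.
    have := congr1 (fun z => ev y z c c) (po _ _ jj); rewrite diagonals_mul // fev0 mxE.
    by move/eqP; rewrite mulf_eq0 (negPf h1) (negPf h2).
  have finj : injective f by move=> j j' e; apply: (po' _ _ (f j)) => //; rewrite e.
  have fsurj c : exists j, f j = c.
    have /codomP[j ->] : c \in codom f by apply: inj_card_onto => //; rewrite !card_ord ry.
    by exists j.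
  have [j jk] := fsurj k; have [j' jl] := fsurj l.
  have e1 : j = i by apply: (po' _ _ k) => //; rewrite -jk.
  have e2 : j' = i by apply: (po' _ _ l) => //; rewrite -jl.
  by rewrite -jk -jl e1 e2.
(* Thinness is known on [W]; the cut-off makes the elements vanish elsewhere and keeps their values
   at [x]. *)
have [g [cg gx g01 gW]] := scalar_bump nW.
have [u ug] := fev_scalar cg.
have su : scalar_like u by move=> y; exists (g y).
have upE y i k l : ev y (u * p i) k l = (g y)%:C * ev y (p i) k l.
  by rewrite fevM ug mul_scalar_mx mxE.
exists (fun i => u * p i); split=> [i|i j ij|i].
- split; first exact: diagonals_scalar.
  move=> y k l; rewrite !upE; have [/thinW h|/gW ->] := boolp.pselect (W y); last by rewrite mul0r eqxx.
  by rewrite !mulf_eq0 !negb_or => /andP[_ kk] /andP[_ ll]; apply: h kk ll.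
- by rewrite (scalar_like_central (p j) su) mulrA -(mulrA u) po // mulr0 mul0r.
- by apply/matrixP => k l; rewrite upE gx mul1r px.
Qed.

(** At [x] the terms [p i * a * p j] are the single matrix entries of [a], so the error vanishes
    there; by continuity of its norm it is small nearby, as [glue] requires. *)
Lemma thin_decomposition (x : X) a : exists p : 'I_(frank x) -> A,
  [/\ forall i, thin (p i), forall i j, i != j -> p i * p j = 0
    & ev x (a - \sum_i \sum_j p i * a * p j) = 0].
Proof.
have [p [pt po px]] := thin_family x; exists p; split=> //.
have Dp i : diagonals (p i) by case: (pt i).
apply/matrixP => k l; rewrite fevBE fev_sum summxE (bigD1 k) //= [X in _ - (_ + X)]big1 => [|i /negPf ik].
  rewrite addr0 fev_sum summxE (bigD1 l) //= [X in _ - (_ + X)]big1 => [|j /negPf jl].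
    by rewrite (diagonals_sandwich _ _ _ (Dp _) (Dp _)) ?px !mxE !eqxx mul1r mulr1 addr0 subrr.
  by rewrite (diagonals_sandwich _ _ _ (Dp _) (Dp _)) ?px !mxE eq_sym jl mulr0.
rewrite fev_sum summxE big1 // => j _.
by rewrite (diagonals_sandwich _ _ _ (Dp _) (Dp _)) ?px !mxE eq_sym ik !mul0r.
Qed.

(** * Diagonal parts, monomial elements and the dense span *)

Definition dpart n (m : 'M[R[i]]_n) : 'M[R[i]]_n := diag_mx (\row_i m i i).

Lemma dpartE n (m : 'M[R[i]]_n) i j : dpart m i j = if i == j then m i i else 0.
Proof. by rewrite !mxE mulrb. Qed.

Lemma dpart_linear n (c : R[i]) (m m' : 'M[R[i]]_n) :
  dpart (c *: m + m') = c *: dpart m + dpart m'.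
Proof.
apply/matrixP => i j; rewrite dpartE !(addmxE, scalemxE) !dpartE.
by case: ifP => _; rewrite ?mulr0 ?addr0.
Qed.

Lemma opnorm_dpart n (m : 'M[R[i]]_n) : opnorm (dpart m) <= opnorm m.
Proof.
apply: opnorm_diag; [exact: opnorm_ge0|exact: diag_mx_is_diag|move=> i].
by rewrite dpartE eqxx modc_le_opnorm.
Qed.

Lemma thin_sandwich p a : thin p -> diagonals (p * a * p).
Proof.
move=> [Dp tp] y; apply/is_diag_mxP => i j ij; rewrite diagonals_sandwich //.
have [->|pi] := eqVneq (ev y p i i) 0; first by rewrite !mul0r.
have [->|pj] := eqVneq (ev y p j j) 0; first by rewrite mulr0.
by rewrite (tp _ _ _ pi pj) eqxx in ij.
Qed.

(** The local approximant is the sum of the [p i * a * p i]. The terms with two different indices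
    have zero diagonal, so its error is the diagonal part of the error in [thin_decomposition], and
    [dpart] is contractive. *)
Lemma diagonal_projection a : exists2 d, diagonals d & forall x, ev x d = dpart (ev x a).
Proof.
have sD := diagonals_subalgebra.
apply: glue_diagonals => [x|x e e0]; first exact: diag_mx_is_diag.
have [p [pt po px]] := thin_decomposition x a.
have Dd : diagonals (\sum_i p i * a * p i).
  by apply: (subalg_sum sD) => i; apply: thin_sandwich.
exists (\sum_i p i * a * p i) => //.
apply: filterS (near_fev0 e0 px) => y; apply: le_trans.
apply: (le_trans _ (opnorm_dpart _)); rewrite le_eqVlt; apply/orP; left; apply/eqP; congr opnorm.
apply/matrixP => k l; rewrite [LHS]mxE [X in _ + X]mxE !dpartE.
have [<-|kl] := eqVneq k l; last by rewrite diagonalsP ?subr0.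
rewrite fevBE; congr (_ - _); rewrite !fev_sum !summxE; apply: eq_bigr => i _.
rewrite fev_sum summxE (bigD1 i) //= big1 ?addr0 // => j ji.
have Dp i' : diagonals (p i') by case: (pt i').
rewrite (diagonals_sandwich _ _ _ (Dp _) (Dp _)) mulrAC -(diagonals_mul _ _ (Dp _)).
by rewrite po ?fev0 ?mxE ?mul0r // eq_sym.
Qed.

Definition diag_proj a := sval (cid2 (diagonal_projection a)).

Lemma diag_proj_diag a : diagonals (diag_proj a).
Proof. by rewrite /diag_proj; case: cid2. Qed.

Lemma fev_diag_proj x a : ev x (diag_proj a) = dpart (ev x a).
Proof. by rewrite /diag_proj; case: cid2. Qed.

Definition monomial_mx n (m : 'M[R[i]]_n) :=
  (forall i j k, m i j != 0 -> m i k != 0 -> j = k) /\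
  (forall i j k, m j i != 0 -> m k i != 0 -> j = k).

Lemma monomial_mx_star n (m : 'M[R[i]]_n) : monomial_mx m -> monomial_mx (m ^t*).
Proof. by move=> [h1 h2]; split=> i j k; rewrite !mxE !conjC_eq0; [apply: h2|apply: h1]. Qed.

(** The column condition removes the off-diagonal entries of [a] from the diagonal of the product;
    the row condition makes the right-hand side diagonal. *)
Lemma monomial_dpart n (m a : 'M[R[i]]_n) : monomial_mx m ->
  dpart (m ^t* *m a *m m) = m ^t* *m dpart a *m m.
Proof.
move=> [h1 h2]; apply/matrixP => k l; rewrite dpartE.
have hz i j : i != j -> Num.conj (m i k) * m j k = 0.
  move=> ij; have [->|mi] := eqVneq (m i k) 0; first by rewrite conjC0 mul0r.
  have [->|mj] := eqVneq (m j k) 0; first by rewrite mulr0.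
  by rewrite (h2 _ _ _ mi mj) eqxx in ij.
have -> : (m ^t* *m dpart a *m m) k l = \sum_i Num.conj (m i k) * a i i * m i l.
  rewrite mul_mx_diag mxE; apply: eq_bigr => i _; by rewrite !mxE.
have [<-|kl] := eqVneq k l.
  rewrite mxE; apply: eq_bigr => j _; rewrite mxE mulr_suml (bigD1 j) //= big1 => [|i ij].
    by rewrite addr0 !mxE.
  by rewrite !mxE mulrAC hz ?mul0r.
rewrite big1 // => i _.
have [->|mi] := eqVneq (m i k) 0; first by rewrite conjC0 !mul0r.
have [->|mj] := eqVneq (m i l) 0; first by rewrite mulr0.
by rewrite (h1 _ _ _ mi mj) eqxx in kl.
Qed.

Definition monomials : set A := [set n | forall x, monomial_mx (ev x n)].

Lemma dpart_id n (m : 'M[R[i]]_n) : is_diag_mx m -> dpart m = m.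
Proof.
move=> /is_diag_mxP h; apply/matrixP => i j; rewrite dpartE.
by have [<-|ij] := eqVneq i j; rewrite // h.
Qed.

Lemma monomials_diag n d : monomials n -> diagonals d ->
  diagonals (n * d * star n) /\ diagonals (star n * d * n).
Proof.
have h m b : monomials m -> diagonals b -> diagonals (star m * b * m).
  move=> Mm Db x; rewrite !fevM fevS -(dpart_id (Db x)) -monomial_dpart //.
  exact: diag_mx_is_diag.
move=> Mn Dd; split; last exact: h.
rewrite -{1}(starK n); apply: h => // x; rewrite fevS; exact: monomial_mx_star.
Qed.

Lemma thin_monomial p q a : thin p -> thin q -> monomials (p * a * q).
Proof.
move=> [Dp tp] [Dq tq] x; split=> i j k; rewrite !diagonals_sandwich // !mulf_eq0 !negb_or.
  by move=> /andP[_ qj] /andP[_ qk]; apply: tq qj qk.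
by move=> /andP[/andP[pj _] _] /andP[/andP[pk _] _]; apply: tp pj pk.
Qed.

Definition thin_term t := exists p a q,
  [/\ thin p, thin q, p = q \/ p * q = 0 & t = p * a * q].

(** Gluing is applied to the field of values of [a] itself: the glued element lies in the closure of
    the span and must be [a]. *)
Lemma thin_span a (e : R) : 0 < e -> exists k (t : 'I_k -> A),
  (forall i, thin_term (t i)) /\ cnorm (\sum_i t i - a) < e.
Proof.
move=> e0.
pose S := [set b | exists2 s : seq A, (forall t, t \in s -> thin_term t) & b = \sum_(t <- s) t].
have S0 : S 0 by exists [::]; rewrite ?big_nil.
have SD b c : S b -> S c -> S (b + c).
  move=> [s hs ->] [r hr ->]; exists (s ++ r); last by rewrite big_cat.
  by move=> t; rewrite mem_cat => /orP[/hs|/hr].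
(* A central factor moves past [p] into the middle, which keeps the outer factors [p], [q] and their
   relation. *)
have SM u b : scalar_like u -> S b -> S (u * b).
  move=> su [s hs ->]; exists [seq u * t | t <- s]; last by rewrite big_map mulr_sumr.
  move=> _ /mapP[t /hs[p [c [q [tp tq pq ->]]]] ->]; exists p, (u * c), q; split=> //.
  by rewrite !mulrA (scalar_like_central _ su).
have Sl (x : X) (d : R) : 0 < d -> exists2 b, S b & \forall y \near x, opnorm (ev y a - ev y b) <= d.
  move=> d0; have [p [pt po px]] := thin_decomposition x a.
  exists (\sum_i \sum_j p i * a * p j); last first.
    by apply: filterS (near_fev0 d0 px) => y; rewrite fevB.
  elim/big_rec : _ => [//|i b _ Sb]; apply: (SD) => //.
  elim/big_rec : _ => [//|j b' _ Sb']; apply: (SD) => //.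
  exists [:: p i * a * p j]; last by rewrite big_seq1.
  move=> t; rewrite inE => /eqP ->; exists (p i), a, (p j); split=> //.
  by have [->|/po] := eqVneq i j; [left|right].
have [b /closure_tendsP[v Sv vb] ba] := glue S0 SD SM Sl.
have {}ba : b = a by exact: fev_inj.
have /cvgrPdist_lt /(_ e e0) [N _ /(_ N (leqnn N))] := vb.
rewrite /= sub0r normrN ger0_norm ?cnorm_ge0 // ba => vN.
have [s hs vE] := Sv N; exists (size s), (fun i => nth 0 s i); split.
  by move=> i; apply/hs/mem_nth.
by rewrite -(big_mkord xpredT (nth 0 s)) -(big_nth 0 xpredT id) -vE.
Qed.

(** Given [x] and a unit vector [z], choose [v] whose value at [x] has [z] as one column and 0
    elsewhere: a diagonal entry of [star v * (star a * a) * v] is then the squared length of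
    [ev x a *m z]. That value of [v] has norm at most 1; the bound 2 leaves room for growth on a
    neighbourhood, outside of which [v] is cut off. *)
Lemma diag_proj_faithful a (c : R) :
  (forall v, cnorm v <= 2 -> cnorm (diag_proj (star v * (star a * a) * v)) <= c) ->
  cnorm a ^+ 2 <= c.
Proof.
move=> h.
have c0 : 0 <= c by apply: le_trans (h 0 _); rewrite ?cnorm_ge0 // cnorm0.
rewrite -[leRHS](sqr_sqrtr c0) ler_pXn2r ?nnegrE ?cnorm_ge0 ?sqrtr_ge0 //.
apply: (fev_norm (m0 := F)); first exact: sqrtr_ge0.
move=> x; apply: opnorm_le; first exact: sqrtr_ge0.
move=> xi; have [xi0|xi0] := eqVneq (l2norm xi) 0.
  by rewrite (l2norm_eq0 xi0) mulmx0 l2norm0 mulr0.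
have xp : 0 < l2norm xi by rewrite lt_def xi0 l2norm_ge0.
pose z := (l2norm xi)^-1%:C *: xi.
have z1 : l2norm z = 1 by rewrite l2normZ modc_real gtr0_norm ?invr_gt0 // mulVf.
suff hz : l2norm (ev x a *m z) <= Num.sqrt c.
  move: hz; rewrite -scalemxAr l2normZ modc_real gtr0_norm ?invr_gt0 // mulrC.
  by rewrite ler_pdivrMr.
(* The nonzero vector supplies a column index: a [matrix_field] may have fibres of rank 0. *)
have [i0 _] : exists i, xi i 0 != 0.
  apply: boolp.contrapT => hn; move: xi0; suff -> : xi = 0 by rewrite l2norm0 eqxx.
  apply/matrixP => i j; rewrite ord1 mxE; apply/eqP; apply: boolp.contrapT => /negP hi.
  by apply: hn; exists i.
pose w0 := z *m (delta_mx 0 i0 : 'rV_(frank x)).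
have w1 : opnorm w0 < 2.
  apply: (@le_lt_trans _ _ 1); last by rewrite ltr1n.
  apply: opnorm_le => // v.
  have -> : w0 *m v = v i0 0 *: z.
    rewrite /w0 -mulmxA -rowE; apply/matrixP => i j; rewrite ord1 mxE big_ord1 !mxE mulrC; congr (_ * _).
  by rewrite l2normZ z1 mulr1 mul1r modc_le_l2norm.
have [w wE] := fev_surj w0.
have nw : \forall y \near x, opnorm (ev y w) < 2 by apply: near_opnorm; rewrite wE.
have [g [cg gx g01 gW]] := scalar_bump nw.
have [u ug] := fev_scalar cg.
have uw : cnorm (u * w) <= 2.
  apply: (fev_norm (m0 := F)) => // y; rewrite fevM ug mul_scalar_mx.
  have [g0 g1] := andP (g01 y).
  rewrite (le_trans (opnormZ _ _)) // modc_real ger0_norm //.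
  have [h2|/gW ->] := boolp.pselect (opnorm (ev y w) < 2); last by rewrite mul0r.
  by rewrite -[leRHS]mul1r ler_pM ?opnorm_ge0 // ltW.
rewrite -(ler_pXn2r (isT : (0 < 2)%N)) ?nnegrE ?l2norm_ge0 ?sqrtr_ge0 // (sqr_sqrtr c0).
apply: le_trans (h _ uw); apply: le_trans (fev_norm_le x _).
apply: le_trans (modc_le_opnorm _ i0 i0); rewrite fev_diag_proj dpartE eqxx.
have -> : ev x (star (u * w) * (star a * a) * (u * w)) = w0 ^t* *m (ev x a) ^t* *m ev x a *m w0.
  by rewrite !fevM fevS fevM ug gx wE mul_scalar_mx scale1r fevS !mulmxA.
rewrite -mulmx_gram.
have -> : ((ev x a *m w0) ^t* *m (ev x a *m w0)) i0 i0 = ((l2norm (ev x a *m z)) ^+ 2)%:C.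
  rewrite l2norm_dot !mxE; apply: eq_bigr => k _; rewrite !mxE.
  have e : \sum_j ev x a k j * w0 j i0 = \sum_j ev x a k j * z j 0.
    by apply: eq_bigr => j _; rewrite mxE big_ord1 !mxE !eqxx mulr1.
  by rewrite e.
by rewrite modc_real ger0_norm ?sqr_ge0.
Qed.

Lemma matrix_field_system :
  diagonal_system setT diagonals monomials positives diag_proj.
Proof.
have sD := diagonals_subalgebra.
split=> //.
- exact: diagonals_comm.
- move=> c a b _ _; apply: fev_inj => x; rewrite fev_diag_proj !fevZD !fev_diag_proj.
  exact: dpart_linear.
- by move=> a _; apply: diag_proj_diag.
- by move=> d Dd; apply: fev_inj => x; rewrite fev_diag_proj dpart_id.
- move=> a _; apply: (fev_norm (m0 := F)); first exact: cnorm_ge0.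
  by move=> x; rewrite fev_diag_proj (le_trans (opnorm_dpart _)) ?fev_norm_le.
- move=> d a e Dd _ De; apply: diagonals_inj; first exact: diag_proj_diag.
    by do 2![apply: (subalgM sD) => //]; exact: diag_proj_diag.
  move=> x i; rewrite fev_diag_proj dpartE eqxx !diagonals_sandwich //.
  by rewrite fev_diag_proj dpartE eqxx.
- move=> a _.
  have pa : positives (diag_proj (star a * a)).
    split; first exact: diag_proj_diag.
    move=> x i; rewrite fev_diag_proj dpartE eqxx fevM fevS mxE sumr_ge0 // => k _.
    by rewrite !mxE mulrC -normCK exprn_ge0.
  have [c pc cc] := positives_sqrt pa; exists c; split=> //.
  by rewrite (positives_star pc) cc.
- by move=> c [].
- move=> c c' pc pc'; rewrite !positives_star //.
  have [[Dc c0] [Dc' c0']] := (pc, pc').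
  rewrite -[leRHS](sqr_sqrtr (cnorm_ge0 _)) ler_pXn2r ?nnegrE ?cnorm_ge0 ?sqrtr_ge0 //.
  apply: (fev_norm (m0 := F)); first exact: sqrtr_ge0.
  move=> x; apply: opnorm_diag; [exact: sqrtr_ge0|exact: (subalgB sD)|move=> i].
  rewrite -[leLHS]ger0_norm ?modc_ge0 // -sqrtr_sqr ler_wsqrtr // fevBE.
  apply: (le_trans (modc_sqr_dist (c0 x i) (c0' x i))); apply: le_trans (fev_norm_le x _).
  by apply: le_trans (modc_le_opnorm _ i i); rewrite fevBE !diagonals_mul.
- move=> c d Dc Dd.
  rewrite -[leRHS](sqr_sqrtr (cnorm_ge0 _)) ler_pXn2r ?nnegrE ?cnorm_ge0 ?sqrtr_ge0 //.
  apply: (fev_norm (m0 := F)); first exact: sqrtr_ge0.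
  move=> x; apply: opnorm_diag; [exact: sqrtr_ge0|exact: Dc|move=> i].
  rewrite -[leLHS]ger0_norm ?modc_ge0 // -sqrtr_sqr ler_wsqrtr //.
  apply: le_trans (fev_norm_le x _); apply: le_trans (modc_le_opnorm _ i i).
  rewrite fevDE !diagonals_star_mul // -rmorphD modc_real ger0_norm ?addr_ge0 ?sqr_ge0 //.
  by rewrite lerDl sqr_ge0.
- move=> d Dd sd d1.
  have pd : positives (1 + d).
    split; first by apply: (subalgD sD) => //; exact: (subalg1 sD).
    move=> x i; rewrite fevDE fev1 mxE eqxx mulr1n.
    have dr : ev x d i i \is Num.real by apply/CrealP; rewrite -{2}sd fevS !mxE.
    have : modc (ev x d i i) <= 1 by rewrite (le_trans (modc_le_opnorm _ i i)) // (le_trans (fev_norm_le _ _)).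
    rewrite -lecR -modcE rmorph1 real_ler_norml // => /andP[h _].
    by rewrite addrC -lerBlDr sub0r.
  have [c pc cc] := positives_sqrt pd; exists c; split; first by case: pc.
  by rewrite (positives_star pc) cc.
- by move=> n d Mn Dd; apply: monomials_diag.
- move=> n a Mn _; apply: fev_inj => x.
  by rewrite fev_diag_proj !fevM fevS fev_diag_proj monomial_dpart.
- move=> a e _ e0; have [k [t [ht tn]]] := thin_span a e0; exists k, t; split=> // i.
  have [p [b [q [tp tq pq ->]]]] := ht i; split; first exact: thin_monomial.
  case: pq => [<-|pq]; [left; exact: thin_sandwich|right; exists p, b, q].
  by split=> //; [case: tp|case: tq].
- by move=> a c _ h; apply: diag_proj_faithful => v v2; apply: h.
Qed.
End MatrixFields.

(** * Bundles and the spectrum *)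

Lemma sum_sum_const (R : realType) n (d : R) :
  \sum_(i < n) \sum_(j < n) d = n%:R * n%:R * d.
Proof. by rewrite sumr_const card_ord sumr_const card_ord -mulrnA -natrM mulr_natl. Qed.

Section MatrixContinuity.
Variables (R : realType) (T : topologicalType).

Lemma real_complex_cvg (F : set_system T) (FF : Filter F) (f : T -> R) (l : R) :
  f @ F --> l -> (fun x => (f x)%:C : R[i]) @ F --> (l%:C : R[i]).
Proof.
move=> /cvgrPdist_lt fl; apply/cvgrPdist_lt => e e0.
have e0' : 0 < modc e.
  by rewrite lt_def modc_ge0 andbT; apply: contraTneq e0 => /modc_eq0 ->; rewrite ltxx.
apply: filterS (fl _ e0') => x h.
by rewrite -rmorphB /= modcE modc_real (ge0_modcE (ltW e0)) ltcR.
Qed.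

Lemma opnorm_cvg (F : set_system T) (FF : Filter F) r (f : T -> 'M[R[i]]_r) (m : 'M[R[i]]_r) :
  f @ F --> m -> (fun x => opnorm (f x)) @ F --> opnorm m.
Proof.
move=> fm; apply/cvgrPdist_lt => e e0.
(* There are [r * r] entries, each to be within [d]; the added 1 makes the total strictly less than
   [e] and covers [r = 0]. *)
pose d := e / (r%:R * r%:R + 1).
have d0 : 0 < d by rewrite divr_gt0 // ltr_wpDl // mulr_ge0.
have hij i j : \forall x \near F, modc (m i j - f x i j) < d.
  have : (fun x => f x i j) @ F --> m i j
    by apply: (@cvg_comp _ _ _ f (fun M : 'M[R[i]]_r => M i j) _ _ _ fm); exact: coord_continuous.
  move=> /cvgrPdist_lt /(_ d%:C); rewrite (ltcR 0 d) => /(_ d0).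
  by apply: filterS => x; rewrite modcE ltcR.
have : \forall x \near F, forall i j, modc (m i j - f x i j) < d.
  by apply: filter_forall => i; apply: filter_forall => j; exact: hij.
apply: filterS => x hx; apply: (le_lt_trans (opnorm_dist _ _)).
apply: (le_lt_trans (opnorm_le_sum _)).
apply: (@le_lt_trans _ _ (r%:R * r%:R * d)).
  apply: (@le_trans _ _ (\sum_(i < r) \sum_(j < r) d)).
    by apply: ler_sum => i _; apply: ler_sum => j _; rewrite !mxE ltW.
  by rewrite sum_sum_const.
rewrite /d mulrA ltr_pdivrMr ?ltr_wpDl ?mulr_ge0 // mulrC ltr_pM2l //.
by rewrite ltrDl.
Qed.

Lemma scale_mx_cvg (F : set_system T) (FF : Filter F) r (f : T -> R) (l : R) (m : 'M[R[i]]_r) :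
  f @ F --> l -> (fun x => (f x)%:C *: m) @ F --> l%:C *: m.
Proof. by move=> fl; apply: cvgZr_tmp; exact: real_complex_cvg. Qed.
End MatrixContinuity.

Section Bundle.
Variables (R : realType) (Z : topologicalType) (r : nat) (E : matrix_bundle R Z r).

Definition trivialization (U : set Z) (h : Z -> 'M[R[i]]_r -> 'M[R[i]]_r) :=
  [/\ open U, forall z, U z -> mx_star_aut (h z)
    & homeomorphism_on (U `*` setT) (@Defs.proj _ _ _ E @^-1` U)
        (fun zm : Z * 'M[R[i]]_r => Defs.point E zm.1 (h zm.1 zm.2))].

Lemma section_coordinates U h s : trivialization U h -> continuous_section E s ->
  exists m : Z -> 'M[R[i]]_r, forall z, U z -> {for z, continuous m} /\ s z = h z (m z).
Proof.
move=> [oU hU [g [fc gc fg gf]]] cs.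
exists (fun z => (g (Defs.point E z (s z))).2) => z Uz.
have pU : (@Defs.proj _ _ _ E @^-1` U) (Defs.point E z (s z)) by rewrite /= Defs.proj_point.
have oV : open (@Defs.proj _ _ _ E @^-1` U) by apply: open_comp => // y _; exact: Defs.proj_continuous.
split.
  have cg : {for Defs.point E z (s z), continuous g}.
    by move: gc; rewrite continuous_open_subspace // => /(_ (Defs.point E z (s z))); apply; rewrite inE.
  have c1 : {for z, continuous (g \o (fun z => Defs.point E z (s z)))}.
    by apply: continuous_comp => //; exact: cs.
  exact: (cvg_comp _ _ c1 cvg_snd).
have [[Ug _] gE] := gf _ pU.
have zE : (g (Defs.point E z (s z))).1 = z.
  by have := congr1 (@Defs.proj _ _ _ E) gE; rewrite !Defs.proj_point.
by rewrite zE in gE; have /Defs.point_inj := gE.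
Qed.

(** The identifications [point z] differ from a local trivialization by automorphisms of the matrix
    algebra, which are isometric, so their discontinuity does not affect norms. *)
Lemma section_norm_continuous s : continuous_section E s -> continuous (fun z => opnorm (s z)).
Proof.
move=> cs z; have [U [h [oU Uz hU hom]]] := Defs.locally_trivial E z.
have [m hm] := section_coordinates (And3 oU hU hom) cs.
have [cm _] := hm z Uz.
rewrite /continuous_at; have -> : opnorm (s z) = opnorm (m z) by rewrite (hm z Uz).2 opnorm_aut //; exact: hU.
apply: (cvg_trans _ (opnorm_cvg _ cm)); apply: near_eq_cvg.
have nU : nbhs z U by apply: open_nbhs_nbhs.
by apply: filterS nU => y Uy; rewrite (hm y Uy).2 opnorm_aut //; exact: hU.
Qed.

Lemma continuous_section_at s z U h (m : Z -> 'M[R[i]]_r) : trivialization U h -> U z ->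
  {for z, continuous m} -> (\forall y \near z, s y = h y (m y)) ->
  {for z, continuous (fun y => Defs.point E y (s y))}.
Proof.
move=> [oU hU [g [fc _ _ _]]] Uz cm hs.
have oUT : open (U `*` [set: 'M[R[i]]_r]).
  rewrite openE => -[y n] [/= Uy _]; exists (U, setT) => //=.
  by split; [exact: open_nbhs_nbhs|exact: filterT].
have cf : {for (z, m z), continuous (fun zm : Z * 'M[R[i]]_r => Defs.point E zm.1 (h zm.1 zm.2))}.
  by move: fc; rewrite continuous_open_subspace // => /(_ (z, m z)); apply; rewrite inE.
rewrite /prop_for /continuous_at; have -> : s z = h z (m z) by exact: nbhs_singleton hs.
have c1 : {for z, continuous (fun y => (y, m y))} by apply: (cvg_pair (f := id) _ cm); exact: cvg_id.
have := continuous_comp c1 cf; apply: cvg_trans; apply: near_eq_cvg.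
by apply: filterS hs => y -> .
Qed.

Lemma mx_star_autZ (h : 'M[R[i]]_r -> 'M[R[i]]_r) (c : R[i]) m : mx_star_aut h ->
  h (c *: m) = c *: h m.
Proof.
case=> [_ hl _ _]; have h0 : h 0 = 0.
  by have := hl (-1) 0 0; rewrite !scaleN1r oppr0 addr0 addNr.
by rewrite -[in LHS](addr0 (_ *: _)) hl h0 addr0.
Qed.

Lemma scalar_section (f : Z -> R) : continuous f ->
  continuous_section E (fun z => (f z)%:C%:M).
Proof.
move=> cf z; have [U [h [oU Uz hU hom]]] := Defs.locally_trivial E z.
apply: (continuous_section_at (And3 oU hU hom) Uz (m := fun z => (f z)%:C *: 1%:M)).
  by apply: scale_mx_cvg; exact: cf.
have nU : nbhs z U by apply: open_nbhs_nbhs.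
apply: filterS nU => y Uy.
by rewrite (mx_star_autZ _ _ (hU y Uy)) (mx_star_aut1 (hU y Uy)) scale_scalar_mx mulr1.
Qed.

Lemma section_through : compact [set: Z] -> hausdorff_space Z -> forall z m,
  exists2 s, continuous_section E s & s z = m.
Proof.
move=> cZ hZ z m; have [U [h [oU Uz hU hom]]] := Defs.locally_trivial E z.
have tr := And3 oU hU hom.
have nU : nbhs z U by apply: open_nbhs_nbhs.
have [g [cg gz g01 gU]] := compact_bump R cZ hZ nU.
have [[k hk kh] _ _ _] := hU z Uz.
have nV : nbhs z [set y | 2^-1 < g y].
  by apply: (cvgr_gt _ (cg z)); rewrite gz invf_lt1 ?ltr1n.
(* [t] vanishes wherever [g] is at most 1/2, hence on a neighbourhood of every point outside [U];
   there the extension by 0 is locally zero. *)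
have [t [ct tz _ tV]] := compact_bump R cZ hZ nV.
pose s y := if `[< U y >] then h y ((t y)%:C *: k m) else 0.
exists s; last first.
  by rewrite /s (asboolT Uz) tz scale1r kh.
move=> y; have [Uy|Uy] := boolp.pselect (U y).
  apply: (continuous_section_at tr Uy (m := fun y => (t y)%:C *: k m)).
    by apply: scale_mx_cvg; exact: ct.
  have : nbhs y U by apply: open_nbhs_nbhs.
  by apply: filterS => x Ux; rewrite /s asboolT.
have [V [h' [oV Vy hV hom']]] := Defs.locally_trivial E y.
apply: (continuous_section_at (And3 oV hV hom') Vy (m := fun=> 0)); first exact: cvg_cst.
have nVy : nbhs y V by apply: open_nbhs_nbhs.
have gy : \forall x \near y, g x < 2^-1 by apply: (cvgr_lt _ (cg y)); rewrite gU ?invr_gt0.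
apply: filterS2 gy nVy => x gx Vx.
have h0 (k' : 'M[R[i]]_r -> 'M[R[i]]_r) : mx_star_aut k' -> k' 0 = 0.
  by move=> hk'; rewrite -(scale0r 0) mx_star_autZ // !scale0r.
rewrite h0; last exact: hV.
rewrite /s; case: asboolP => // Ux.
have -> : t x = 0 by apply: tV; rewrite /= ltNge ltW.
by rewrite scale0r h0 //; exact: hU.
Qed.
End Bundle.

Section SpectrumField.
Variables (R : realType) (A : cstarType R) (H : homogeneous_sum A).

Definition spectrum_space : topologicalType :=
  {i : 'I_(nsummands H) & hbase (summand_homogeneous i)}.

Lemma near_existT i (z : hbase (summand_homogeneous i)) (P : spectrum_space -> Prop) :
  (\forall y \near z, P (existT _ i y)) -> \forall x \near (existT _ i z : spectrum_space), P x.
Proof. by []. Qed.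

Lemma spectrum_rank_constant (x : spectrum_space) :
  \forall y \near x, fibre_rank (H := H) y = fibre_rank (H := H) x.
Proof. by case: x => i z; apply: near_existT; apply: filterE. Qed.

Lemma spectrum_compact : compact [set: spectrum_space].
Proof. by apply: sigT_compact => [|i]; [exact: finite_finset|exact: hbase_compact]. Qed.

Lemma spectrum_hausdorff : hausdorff_space spectrum_space.
Proof.
move=> [i x] [j y] xy.
have ij : i = j.
  apply: boolp.contrapT => ij.
  have hj (k : 'I_(nsummands H)) (z : hbase (summand_homogeneous k)) :
      nbhs (existT _ k z : spectrum_space) [set w | projT1 w = k].
    by apply: near_existT; apply: filterE.
  have [w [/= wi wj]] := xy _ _ (hj i x) (hj j y).
  by apply: ij; rewrite -wi.
case: _ / ij in y xy *.
congr existT; apply: (hbase_hausdorff (h := summand_homogeneous i)) => U V Ux Vy.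
have [w [[a Ua aw] [b Vb bw]]] := xy _ _ (@existT_nbhs _ _ _ _ _ Ux) (@existT_nbhs _ _ _ _ _ Vy).
exists a; split=> //; suff <- : b = a by [].
exact: (existT_inj2 (etrans bw (esym aw))).
Qed.

Lemma ev_hom (x : spectrum_space) : mx_star_hom (ev (H := H) x).
Proof.
have [[cl cM cS] c1] := coordinate_hom (projT1 x); have [hl hM hS h1] := hev_hom (projT2 x).
split=> [c a b|a b|a|]; rewrite /ev.
- by rewrite cl hl.
- by rewrite cM hM.
- by rewrite cS hS.
- by rewrite c1 h1.
Qed.

Lemma hev_norm_continuous (A' : cstarType R) (K : homogeneous A') a :
  continuous (fun z : hbase K => opnorm (hev z a)).
Proof. by apply: section_norm_continuous; exact: hev_section. Qed.

Lemma hev_norm_le (A' : cstarType R) (K : homogeneous A') (z : hbase K) a :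
  opnorm (hev z a) <= cnorm a.
Proof.
rewrite (hev_norm K); apply: sup_upper_bound; last by exists z.
split; first by exists (opnorm (hev z a)), z.
have [|||y _ hy] := @compact_EVT_max (hbase K) R (fun z => opnorm (hev z a)) setT.
- by exists z.
- exact: hbase_compact.
- by apply: continuous_subspaceT; exact: hev_norm_continuous.
by exists (opnorm (hev y a)) => _ [w _ <-]; apply: hy; rewrite inE.
Qed.

Lemma ev_norm_le (x : spectrum_space) a : opnorm (ev (H := H) x a) <= cnorm a.
Proof.
rewrite (coordinate_norm H) (le_trans (hev_norm_le _ _)) //.
exact: (le_bigmax_cond _ (fun i => cnorm (coordinate i a))).
Qed.

Lemma ev_norm a (c : R) : 0 <= c ->
  (forall x : spectrum_space, opnorm (ev (H := H) x a) <= c) -> cnorm a <= c.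
Proof.
move=> c0 hc; rewrite (coordinate_norm H); apply: bigmax_le => // i _.
rewrite (hev_norm (summand_homogeneous i)).
have [[z _]|he] := boolp.pselect ([set: hbase (summand_homogeneous i)] !=set0).
  apply: ge_sup; first by exists (opnorm (hev z (coordinate i a))), z.
  by move=> _ [w _ <-]; exact: (hc (existT _ i w)).
(* Over an empty base the supremum is that of the empty set, which is 0 by convention. *)
have -> : [set: hbase (summand_homogeneous i)] = set0.
  by apply/seteqP; split=> // w _; apply: he; exists w.
by rewrite image_set0 sup0.
Qed.

Lemma ev_norm_continuous a : continuous (fun x : spectrum_space => opnorm (ev (H := H) x a)).
Proof.
move=> [i z] V hV; apply: near_existT.
exact: (@hev_norm_continuous _ (summand_homogeneous i) (coordinate i a) z V hV).
Qed.

Lemma ev_scalar (f : spectrum_space -> R) : continuous f ->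
  exists a, forall x : spectrum_space, ev (H := H) x a = (f x)%:C%:M.
Proof.
move=> cf.
have h i : exists b : summand i, forall z, hev (h := summand_homogeneous i) z b = (f (existT _ i z))%:C%:M.
  apply: hev_surj; apply: scalar_section => z.
  apply: continuous_comp; [exact: existT_continuous|exact: cf].
have [a [ha _]] := coordinate_bij (fun i => projT1 (cid (h i))).
exists a => -[i z]; rewrite /ev /= ha; exact: (projT2 (cid (h i))).
Qed.

Lemma ev_surj (x : spectrum_space) m : exists a, ev (H := H) x a = m.
Proof.
case: x m => i z m.
have [s cs sz] := section_through (hbundle (summand_homogeneous i))
  (@hbase_compact _ _ (summand_homogeneous i)) (@hbase_hausdorff _ _ (summand_homogeneous i)) z m.
have [b bE] := hev_surj cs.
have [a [ha _]] := coordinate_bij (fun j => if boolp.pselect (i = j) is left e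
  then eq_rect i (fun j => summand j : Type) b j e else 0).
exists a; rewrite /ev /= ha; case: boolp.pselect => // e.
by rewrite (Prop_irrelevance e erefl) /= bE.
Qed.

Definition spectrum_field : matrix_field A :=
  @MatrixField R A spectrum_space (fun x => fibre_rank (H := H) x) (fun x => ev (H := H) x)
    spectrum_compact spectrum_hausdorff
    spectrum_rank_constant
    ev_hom ev_norm_le ev_norm ev_norm_continuous ev_scalar ev_surj.
End SpectrumField.

Lemma unitary_dim (R : realType) m n (U : 'M[R[i]]_(m, n)) :
  U *m U ^t* = 1%:M -> U ^t* *m U = 1%:M -> n = m.
Proof.
move=> UU' U'U; apply/eqP; rewrite eqn_leq; apply/andP; split.
  by rewrite -(mxrank1 R[i] n) -U'U (leq_trans (mxrankM_maxr _ _)) // rank_leq_row.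
by rewrite -(mxrank1 R[i] m) -UU' (leq_trans (mxrankM_maxl _ _)) // rank_leq_col.
Qed.

Section ConjugateField.
Variables (R : realType) (A : cstarType R) (F : matrix_field A).
Variables (n : fbase F -> nat) (V : forall x, 'M[R[i]]_(frank x, n x)).
Hypothesis VV' : forall x, V x *m (V x) ^t* = 1%:M.
Hypothesis V'V : forall x, (V x) ^t* *m V x = 1%:M.

Definition conj_ev x a := (V x) ^t* *m fev x a *m V x.

Lemma conj_ev_hom x : mx_star_hom (conj_ev x).
Proof.
split=> [c a b|a b|a|]; rewrite /conj_ev.
- by rewrite fevZD mulmxDr mulmxDl -scalemxAr -scalemxAl.
- by rewrite fevM !mulmxA -(mulmxA _ (V x) _) VV' mulmx1.
- by rewrite fevS !trmx_mul !map_mxM trmxCK mulmxA.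
- by rewrite fev1 mulmx1 V'V.
Qed.

Lemma opnorm_conj_ev x a : opnorm (conj_ev x a) = opnorm (fev x a).
Proof. exact: opnorm_conj. Qed.

Program Definition conj_field : matrix_field A :=
  @MatrixField R A (fbase F) n conj_ev (@fbase_compact _ _ F) (@fbase_hausdorff _ _ F)
    _ conj_ev_hom _ _ _ _ _.
Next Obligation.
by move=> x; apply: filterS (frank_constant x) => y; rewrite !(unitary_dim (VV' _) (V'V _)).
Qed.
Next Obligation. by move=> x a; rewrite opnorm_conj_ev fev_norm_le. Qed.
Next Obligation.
move=> a c c0 h; apply: (fev_norm (m0 := F)) => // x; rewrite -opnorm_conj_ev; exact: h.
Qed.
Next Obligation.
move=> a; rewrite (_ : (fun x => _) = (fun x => opnorm (fev x a))); first exact: fev_continuous.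
by apply/funext => x; rewrite opnorm_conj_ev.
Qed.
Next Obligation.
move=> f cf; have [a ha] := fev_scalar cf; exists a => x.
by rewrite /conj_ev ha mul_mx_scalar -scalemxAl V'V scale_scalar_mx mulr1.
Qed.
Next Obligation.
move=> x m; have [a ha] := fev_surj (V x *m m *m (V x) ^t*); exists a.
by rewrite /conj_ev ha !mulmxA V'V mul1mx -mulmxA V'V mulmx1.
Qed.
End ConjugateField.

(** * Frames *)

Section Unitization.
Variables (R : realType) (A : cstarType R) (B : set A).

(** Scalars plus [B] commute, so their closure is an abelian sub-C*-algebra containing [B], and
    maximality identifies the two. *)
Lemma maximal_abelian1 : sub_cstar B -> maximal_abelian B -> B 1.
Proof.
move=> [B0 BZD BM BS Bcl] [cB maxB].
pose B1 := [set a : A | exists (c : R[i]) b, B b /\ a = c *: 1 + b].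
have BZ c b : B b -> B (c *: b) by move=> Bb; rewrite -[_ *: _]addr0; apply: BZD.
have BD a b : B a -> B b -> B (a + b) by move=> Ba Bb; rewrite -[a]scale1r; apply: BZD.
have s1 : star_subalgebra B1.
  split=> [|k _ _ [c [b [Bb ->]]] [c' [b' [Bb' ->]]]|_ _ [c [b [Bb ->]]] [c' [b' [Bb' ->]]]|_ [c [b [Bb ->]]]].
  - by exists 1, 0; rewrite scale1r addr0.
  - exists (k * c + c'), (k *: b + b'); split; first exact: BZD.
    by rewrite scalerDr scalerA scalerDl addrACA.
  - exists (c * c'), (c *: b' + (c' *: b + b * b')); split.
      by apply: (BD); [exact: BZ|apply: BD; [exact: BZ|exact: BM]].
    rewrite mulrDr !mulrDl -!scalerAl -!scalerAr !mul1r mulr1 scalerA -!addrA; congr (_ + _).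
    by rewrite addrCA.
  - exists (Num.conj c), (star b); split; first exact: BS.
    by rewrite starD starZ star1.
have c1 : Defs.commutative B1.
  move=> _ _ [c [b [Bb ->]]] [c' [b' [Bb' ->]]].
  rewrite !mulrDr !mulrDl -!scalerAl -!scalerAr !mul1r !mulr1 (cB b' b) // !scalerA (mulrC c').
  by rewrite -!addrA; congr (_ + _); rewrite addrCA.
have sB1 : sub_cstar (closure B1).
  have s2 := closure_subalgebra s1.
  split; [exact: subalg0|exact: subalgZD|exact: subalgM|exact: subalgS|exact: closed_closure].
rewrite -(maxB _ sB1 (closure_commutative c1)); first exact: (subalg1 (closure_subalgebra s1)).
by move=> b Bb; apply: subset_closure; exists 0, b; rewrite scale0r add0r.
Qed.
End Unitization.

Section Characters.
Variables (R : realType) (A : cstarType R) (B : set A).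
Hypothesis sB : star_subalgebra B.

Lemma state_null (g : A -> R[i]) k : state B g -> B k -> g (star k * k) = 0 -> g k = 0.
Proof.
move=> gs Bk gk; apply: modc_eq0; apply/eqP.
have := Cauchy_Schwarz sB (state_linear gs) (state_pos gs) (subalg1 sB) Bk.
by rewrite star1 !mul1r gk modc0 mulr0 -sqrf_eq0 => h; rewrite eq_le h sqr_ge0.
Qed.

(** With [k = b - f b *: 1] the character vanishes at [star k * k]; by positivity so do both states
    of a convex decomposition, hence by Cauchy-Schwarz they vanish at [k]. *)
Lemma character_pure f : state B f -> (forall a b, B a -> B b -> f (a * b) = f a * f b) ->
  pure_state B f.
Proof.
move=> fs fM; split=> // g h t gs hs /andP[t0 t1] fE b Bb.
have f1 := state1 sB fs; have B1 := subalg1 sB.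
pose k := b - f b *: 1.
have Bk : B k by apply: (subalgB sB) => //; apply: (subalgZ sB).
have fk : f k = 0.
  rewrite (functionalB sB (state_linear fs)) ?(functionalZ sB (state_linear fs)) ?f1 ?mulr1 ?subrr //.
  exact: (subalgZ sB).
have Bkk : B (star k * k) by apply: (subalgM sB) => //; apply: (subalgS sB).
have g0 := state_pos gs Bk; have h0 := state_pos hs Bk.
have e : t%:C * g (star k * k) + (1 - t)%:C * h (star k * k) = 0.
  by rewrite -fE // fM ?fk ?mulr0 //; apply: (subalgS sB).
have tp : 0 < t%:C :> R[i] by rewrite ltcR.
have tp' : 0 < (1 - t)%:C :> R[i] by rewrite ltcR subr_gt0.
have [gk hk] : g (star k * k) = 0 /\ h (star k * k) = 0.
  have g1 := mulr_ge0 (ltW tp) g0; have h1 := mulr_ge0 (ltW tp') h0.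
  move/eqP: e; rewrite paddr_eq0 // !mulf_eq0 !(gt_eqF tp) !(gt_eqF tp') /=.
  by move=> /andP[/eqP -> /eqP ->].
have eqf g' : state B g' -> g' (star k * k) = 0 -> g' b = f b.
  move=> gs' gk'; have := state_null gs' Bk gk'.
  rewrite (functionalB sB (state_linear gs')) ?(functionalZ sB (state_linear gs')) //; last exact: (subalgZ sB).
  by rewrite (state1 sB gs') mulr1 => /eqP; rewrite subr_eq0 => /eqP.
by split; apply: eqf.
Qed.
End Characters.

(** Reduces an infinite commuting family of matrices to a finite sequence, namely one whose span has
    maximal dimension. *)
Lemma span_subseq (K : fieldType) (vT : vectType K) (S : set vT) :
  exists s : seq vT, (forall v, v \in s -> S v) /\ forall v, S v -> v \in span s.
Proof.
pose Q k := `[< exists2 s : seq vT, (forall v, v \in s -> S v) & \dim (span s) = k >].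
have Q0 : exists k, Q k by exists 0%N; apply/asboolP; exists [::]; rewrite // span_nil dimv0.
have Qub k : Q k -> (k <= \dim {:vT})%N by move=> /asboolP[s _ <-]; apply/dimvS/subvf.
case: (ex_maxnP Q0 Qub) => k /asboolP[s hs sk] kmax; exists s; split=> // v Sv.
have : (\dim (span (v :: s)) <= k)%N.
  apply: kmax; apply/asboolP; exists (v :: s) => // w; rewrite inE => /predU1P[->|/hs] //.
have sub : (span s <= span (v :: s))%VS by rewrite span_cons addvSr.
rewrite -sk => h; have /eqP -> : span s == span (v :: s) by rewrite eqEdim sub.
by rewrite memv_span // mem_head.
Qed.

(** * Simultaneous unitary diagonalization *)

Section SimultaneousDiagonalization.
Variables (C : numClosedFieldType) (n : nat).

(** A common unitary triangularization of a spanning sequence serves all of [S]. As [S] contains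
    adjoints, each matrix and its adjoint become triangular on the same side, hence diagonal. *)
Lemma commuting_unitary_diag (S : set 'M[C]_n) :
  (forall a b, S a -> S b -> a *m b = b *m a) -> (forall a, S a -> S (a ^t*)) ->
  exists P : 'M[C]_n, [/\ P *m P ^t* = 1%:M, P ^t* *m P = 1%:M &
    forall a, S a -> is_diag_mx (P *m a *m P ^t*)].
Proof.
move=> Scomm Sstar; have [s [sS spanS]] := span_subseq S.
have [P Pu /allP /= hP] : cotrigonalizable_in (@unitarymx C n n) s.
  by apply: cotrigonalization => a b sa sb; apply: Scomm; exact: sS.
have PP : P *m P ^t* = 1%:M by apply/unitarymxP.
have P'P : P ^t* *m P = 1%:M by rewrite -invmx_unitary // mulVmx // unitarymx_unit.
have trig a : S a -> is_trig_mx (P *m a *m P ^t*).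
  move=> Sa; have := spanS a Sa; move/(@coord_span _ _ _ (in_tuple s)) => ->.
  rewrite mulmx_sumr mulmx_suml; apply/is_trig_mxP => i j ij.
  rewrite summxE big1 // => k _; rewrite -scalemxAr -scalemxAl mxE.
  have : is_trig_mx (conjmx P (in_tuple s)`_k) by apply: hP; apply: mem_nth.
  by rewrite conjumx ?unitarymx_unit // invmx_unitary // => /is_trig_mxP -> //; rewrite mulr0.
exists P; split=> // a Sa; apply/is_diag_mxP => i j; rewrite neq_ltn => /orP[ij|ij].
  by have /is_trig_mxP -> := trig a Sa.
have /is_trig_mxP /(_ j i ij) := trig _ (Sstar a Sa).
have -> : P *m a ^t* *m P ^t* = (P *m a *m P ^t*) ^t* by rewrite !trmx_mul !map_mxM trmxCK mulmxA.
by rewrite !mxE => /eqP; rewrite conjC_eq0 => /eqP.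
Qed.
End SimultaneousDiagonalization.

Definition unitary_frame (R : realType) (A : cstarType R) (F : matrix_field A)
    (V : forall x : fbase F, 'M[R[i]]_(frank x)) :=
  (forall x, V x *m (V x) ^t* = 1%:M) /\ (forall x, (V x) ^t* *m V x = 1%:M).

Definition frame_field (R : realType) (A : cstarType R) (F : matrix_field A) V
    (hV : unitary_frame V) : matrix_field A :=
  @conj_field R A F (@frank _ _ F) V hV.1 hV.2.

Section VectorStates.
Variables (R : realType) (A : cstarType R) (F : matrix_field A).

Lemma vector_state (x : fbase F) i : state setT (fun a => fev x a i i).
Proof.
apply: (stateP (setT_subalgebra A)).
- by move=> c a b _ _; rewrite fevZD !mxE.
- move=> b _; rewrite fevM fevS mxE sumr_ge0 // => k _.
  by rewrite !mxE mulrC -normCK exprn_ge0.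
- by rewrite fev1 mxE eqxx.
- by move=> b _; rewrite (le_trans (modc_le_opnorm _ _ _)) ?fev_norm_le.
Qed.

(* If two diagonal entries of [B] at [x] coincided, they would be a pure state of
   [B] with two distinct extensions, the corresponding vector states of [A]. *)
Lemma diagonal_full (B : set A) : sub_cstar B -> maximal_abelian B -> unique_extension B ->
  B `<=` diagonals F -> full F.
Proof.
move=> sB mB uB BD; have B1 := maximal_abelian1 sB mB.
have [B0 BZD BM BS _] := sB.
have {}sB : star_subalgebra B by split.
have chi_state (x : fbase F) i : state B (fun a => fev x a i i).
  have vs := vector_state i; have sT := setT_subalgebra A.
  apply: (stateP sB).
  - by move=> c a b _ _; rewrite (state_linear vs).
  - by move=> b _; rewrite (state_pos vs).
  - exact: (state1 sT vs).
  - by move=> b _; rewrite (state_norm sT vs).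
have chi_distinct (x : fbase F) i j : i != j -> exists2 b, B b & fev x b i i != fev x b j j.
  move=> ij; apply: boolp.contrapT => hn.
  have e b : B b -> fev x b j j = fev x b i i.
    by move=> Bb; apply/eqP; rewrite eq_sym; apply: boolp.contrapT => /negP hb; apply: hn; exists b.
  have pf : pure_state B (fun a => fev x a i i).
    apply: (character_pure sB) => // a b Ba Bb; rewrite diagonals_mul //; exact: BD.
  have [g [_ gu]] := uB _ pf.
  have gi := gu _ (conj (vector_state i) (fun b _ => erefl)).
  have gj := gu _ (conj (vector_state j) e).
  have [a ha] := fev_surj (delta_mx i i : 'M[R[i]]_(frank x)).
  have : fev x a i i = fev x a j j by have := congr1 (fun k => k a) (etrans (esym gi) gj).
  by rewrite ha !mxE eqxx eq_sym (negPf ij) /= => /eqP; rewrite oner_eq0.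
(* Lagrange interpolation at the distinct diagonal characters: each [j] contributes a factor that is
   1 at [i] and 0 at [j]. *)
have sep (x : fbase F) i (s : seq 'I_(frank x)) : i \notin s ->
    exists b, [/\ B b, fev x b i i = 1 & forall j, j \in s -> fev x b j j = 0].
  elim: s => [|j s IH]; first by exists 1; split=> //; rewrite fev1 mxE eqxx.
  rewrite inE negb_or => /andP[ij /IH[b [Bb bi bs]]].
  have [c Bc cij] := chi_distinct x i j ij.
  pose t := fev x c i i - fev x c j j.
  have t0 : t != 0 by rewrite subr_eq0.
  have Bd : B (t^-1 *: (c - fev x c j j *: 1)).
    by apply: (subalgZ sB); apply: (subalgB sB) => //; apply: (subalgZ sB).
  have dE k : fev x (t^-1 *: (c - fev x c j j *: 1)) k k = t^-1 * (fev x c k k - fev x c j j).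
    by rewrite fevZE fevBE fevZE fev1 mxE eqxx mulr1.
  exists (t^-1 *: (c - fev x c j j *: 1) * b); split; first exact: BM.
    by rewrite diagonals_mul ?dE ?mulVf ?mul1r //; exact: BD.
  move=> k; rewrite inE diagonals_mul ?dE; last exact: BD.
  by case/predU1P=> [->|/bs ->]; rewrite ?subrr ?mulr0 ?mul0r.
move=> x d.
have hb i : exists b, B b /\ forall j, fev x b j j = (i == j)%:R.
  have [|b [Bb bi bs]] := sep x i [seq j <- enum 'I_(frank x) | j != i].
    by rewrite mem_filter eqxx.
  exists b; split=> // j; have [<-//|ij] := eqVneq i j.
  by rewrite bs // mem_filter eq_sym ij mem_enum.
have [b bP] := choice hb.
exists (\sum_i d 0 i *: b i).
  by apply: BD; apply: (subalg_sum sB) => i; apply: (subalgZ sB); case: (bP i).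
apply/matrixP => k l; rewrite fev_sum summxE.
have [<-|kl] := eqVneq k l; last first.
  rewrite big1 => [|i _]; first by rewrite !mxE (negPf kl).
  by rewrite fevZE diagonalsP ?mulr0 //; apply: BD; case: (bP i).
rewrite (bigD1 k) //= big1 => [|i ik].
  by rewrite fevZE; have [_ ->] := bP k; rewrite !mxE eqxx mulr1 addr0.
by rewrite fevZE; have [_ ->] := bP i; rewrite (negPf ik) mulr0.
Qed.

Lemma cstar_diagonal_frame (B : set A) : cstar_diagonal B ->
  exists V : (forall x : fbase F, 'M[R[i]]_(frank x)), exists hV : unitary_frame V,
    B `<=` diagonals (frame_field hV).
Proof.
move=> [[[B0 BZD BM BS Bcl] [cB _] _ _] _].
have h (x : fbase F) : exists P : 'M[R[i]]_(frank x), [/\ P *m P ^t* = 1%:M, P ^t* *m P = 1%:M &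
    forall b, B b -> is_diag_mx (P *m fev x b *m P ^t*)].
  have [||P [PP P'P hP]] := @commuting_unitary_diag R[i] (frank x) (fev x @` B).
  - by move=> _ _ [a Ba <-] [b Bb <-]; rewrite -!fevM cB.
  - by move=> _ [a Ba <-]; exists (star a); [exact: BS|rewrite fevS].
  by exists P; split=> // b Bb; apply: hP; exists b.
pose V x := (sval (cid (h x))) ^t*.
have hV : unitary_frame V.
  by split=> x; rewrite /V trmxCK; case: (svalP (cid (h x))).
exists V, hV => b Bb x; rewrite /= /conj_ev /V trmxCK.
by case: (svalP (cid (h x))) => _ _; apply.
Qed.
End VectorStates.

Section BlockDiagonal.
Variables (R : realType) (p : nat) (p_ : 'I_p -> nat).
Notation C := R[i].
Implicit Types B : forall i, 'M[C]_(p_ i).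

Lemma mxdiag_star B : (\mxdiag_i B i) ^t* = \mxdiag_i (B i) ^t*.
Proof.
rewrite tr_mxdiag; apply/matrixP => s t; rewrite !mxE.
case: eqP => [e|_]; last by rewrite !mxE conjC0.
move: (tagnat.sig2 s) (tagnat.sig2 t); case: _ / e => u v.
by rewrite !conform_mx_id !mxE.
Qed.

(** The witnesses of [opnorm_contractP] for the blocks assemble into one for the sum. *)
Lemma opnorm_mxdiag_le B (c : R) : 0 <= c -> (forall i, opnorm (B i) <= c) ->
  opnorm (\mxdiag_i B i) <= c.
Proof.
move=> c0 h.
have /all_sig[b hb] i : {b : 'M[C]_(p_ i) | (B i) ^t* *m B i + b ^t* *m b = (c ^+ 2)%:C%:M}.
  by apply/cid/opnorm_contractP.
apply/opnorm_contractP => //; exists (\mxdiag_i b i).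
rewrite !mxdiag_star !mxdiag_mul -mxdiagD -mxdiagZ.
by apply: eq_mxdiag => i; rewrite hb.
Qed.

(** [J] is the isometric inclusion of the block [i], which intertwines the block with the sum. *)
Lemma opnorm_mxdiag_ge B i : opnorm (B i) <= opnorm (\mxdiag_i B i).
Proof.
pose D j : 'M[C]_(p_ j, p_ i) := if i == j then conform_mx 0 (1%:M : 'M[C]_(p_ i)) else 0.
pose J := \mxcol_j D j.
have JJ : J ^t* *m J = 1%:M.
  have -> : J ^t* = \mxrow_j (D j) ^t*.
    by rewrite /J tr_mxcol; apply/matrixP => s t; rewrite !mxE.
  rewrite mul_mxrow_mxcol (bigD1 i) //= big1 => [|j /negPf ji].
    by rewrite /D eqxx conform_mx_id trmx1 map_mx1 mulmx1 addr0.
  by rewrite /D eq_sym ji mulmx0.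
have MJ : \mxdiag_i B i *m J = J *m B i.
  rewrite mul_mxdiag_mxcol mxcol_mul; apply: eq_mxcol => j; rewrite /D.
  case: eqP => [e|_]; last by rewrite mulmx0 mul0mx.
  by case: _ / e; rewrite conform_mx_id mulmx1 mul1mx.
apply: opnorm_le => [|v]; first exact: opnorm_ge0.
rewrite -(l2norm_isometry _ JJ) mulmxA -MJ -mulmxA (le_trans (opnormP _ _)) //.
by rewrite (l2norm_isometry _ JJ).
Qed.
End BlockDiagonal.

(** * Connecting maps in terms of matrix entries *)

Section Coefficients.
Variables (R : realType) (A : cstarType R) (F : matrix_field A).
Notation P := {x : fbase F & 'I_(frank x)}.

(* The matrix entries of [a] in the direct sum of all fibres, indexed by the basis
   vectors [(x, i)]. *)
Definition coef (a : A) (p q : P) : R[i] :=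
  if tag p == tag q then fev (tag p) a (tagged p) (tagged_as p q) else 0.

Lemma coefE a x (i j : 'I_(frank x)) : coef a (Tagged _ i) (Tagged _ j) = fev x a i j.
Proof. by rewrite /coef /= eqxx tagged_asE. Qed.

Lemma coef_tagged a p : coef a p p = fev (tag p) a (tagged p) (tagged p).
Proof. by case: p => x i; rewrite (coefE a i i). Qed.

Lemma point_mass (p q : P) a (g : fbase F -> R) :
  fev (tag p) a = diag_mx (delta_mx 0 (tagged p)) -> g (tag p) = 1 ->
  (tag q != tag p -> g (tag q) = 0) ->
  (g (tag q))%:C * fev (tag q) a (tagged q) (tagged q) = (q == p)%:R.
Proof.
case: p q => [x l] [y k] /= aE gx gq; have [e|ne] := eqVneq x y; last first.
  rewrite gq; last by rewrite eq_sym.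
  by rewrite mul0r; case: eqP => // e; have /= yx := congr1 tag e; rewrite yx eqxx in ne.
case: _ / e k gq => k _; rewrite gx mul1r aE !mxE !eqxx mulr1n.
by rewrite -tag_eqE /tag_eq /= eqxx tagged_asE.
Qed.

Lemma coef_diag a p q : diagonals F a -> p != q -> coef a p q = 0.
Proof.
move=> Da; case: p q => [x i] [y j]; have [e|xy] := eqVneq x y; last by rewrite /coef /= (negPf xy).
case: _ / e j => j pq; rewrite (coefE a i j) diagonalsP //.
by apply: contra pq => /eqP ->.
Qed.

Lemma coef_monomial_row a p q q' : monomials F a -> coef a p q != 0 -> coef a p q' != 0 -> q = q'.
Proof.
case: p q q' => [x i] [y j] [z k] Ma.
have [e|xy] := eqVneq x y; last by rewrite /coef /= (negPf xy) eqxx.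
have [e'|xz] := eqVneq x z; last by rewrite {2}/coef /= (negPf xz) eqxx.
case: _ / e j => j; case: _ / e' k => k.
by rewrite (coefE a i j) (coefE a i k) => h1 h2; congr existT; apply: (Ma x).1 h1 h2.
Qed.

Lemma coef_monomial_col a p q q' : monomials F a -> coef a q p != 0 -> coef a q' p != 0 -> q = q'.
Proof.
case: p q q' => [x i] [y j] [z k] Ma.
have [e|xy] := eqVneq x y; last by rewrite /coef /= [y == x]eq_sym (negPf xy) eqxx.
have [e'|xz] := eqVneq x z; last by rewrite {2}/coef /= [z == x]eq_sym (negPf xz) eqxx.
case: _ / e j => j; case: _ / e' k => k.
by rewrite (coefE a j i) (coefE a k i) => h1 h2; congr existT; apply: (Ma x).2 h1 h2.
Qed.

(** Basis vectors in one fibre are separated by fullness, those in different fibres by bump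
    functions on the Hausdorff base. *)
Lemma interpolation : full F -> forall n (p : 'I_n -> P) (d : 'I_n -> R[i]), injective p ->
  exists2 a, diagonals F a & forall i, coef a (p i) (p i) = d i.
Proof.
move=> fF n p d pinj; have sD := diagonals_subalgebra F.
have h i : exists a, diagonals F a /\ forall j, coef a (p j) (p j) = (j == i)%:R.
  have [a Da aE] := fF (tag (p i)) (delta_mx 0 (tagged (p i))).
  pose U := [set x : fbase F | forall j, tag (p j) != tag (p i) -> x != tag (p j)].
  have nU : nbhs (tag (p i)) U.
    apply: filter_forall => j; have [e|ne] := eqVneq (tag (p j)) (tag (p i)); first exact: filterE.
    have cl : closed [set tag (p j)].
      exact/accessible_closed_set1/hausdorff_accessible/fbase_hausdorff.
    have : nbhs (tag (p i)) (~` [set tag (p j)]).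
      by apply: open_nbhs_nbhs; split; [exact: closed_openC|apply/eqP; rewrite eq_sym].
    by apply: filterS => x /= /eqP.
  have [g [cg gx g01 gU]] := scalar_bump nU.
  have [u ug] := fev_scalar cg.
  exists (u * a); split; first by apply: diagonals_scalar => // x; exists (g x).
  move=> j; rewrite coef_tagged fevM ug mul_scalar_mx mxE -(inj_eq pinj).
  apply: point_mass aE gx _ => ne; apply: gU => /(_ j ne) /eqP; exact.
have [a ha] := choice h.
exists (\sum_i d i *: a i).
  by apply: (subalg_sum sD) => i; apply: (subalgZ sD); case: (ha i).
move=> i; rewrite coef_tagged fev_sum summxE (bigD1 i) //= big1 => [|j ji].
  by rewrite fevZE -coef_tagged; have [_ ->] := ha i; rewrite eqxx mulr1 addr0.
by rewrite fevZE -coef_tagged; have [_ ->] := ha j; rewrite eq_sym (negPf ji) mulr0.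
Qed.
End Coefficients.

(** In adapted bases [phi] only copies matrix entries: [t] names the source basis vector behind each
    basis vector at [y]. By injectivity, off-diagonal positions copy off-diagonal entries. *)
Definition field_morphism (R : realType) (A A' : cstarType R)
    (F : matrix_field A) (F' : matrix_field A') (phi : A -> A') :=
  forall y : fbase F', exists t : 'I_(frank y) -> {x : fbase F & 'I_(frank x)},
    injective t /\ forall a i j, fev y (phi a) i j = coef a (t i) (t j).

Section Morphisms.
Variables (R : realType) (A A' : cstarType R).
Variables (F : matrix_field A) (F' : matrix_field A') (phi : A -> A').
Hypothesis fphi : field_morphism F F' phi.

Lemma morphism_diagonals a : diagonals F a -> diagonals F' (phi a).
Proof.
move=> Da y; apply/is_diag_mxP => i j ij; have [t [tinj ->]] := fphi y.
by rewrite coef_diag // (inj_eq tinj).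
Qed.

Lemma morphism_positives a : positives F a -> positives F' (phi a).
Proof.
move=> [Da a0]; split; first exact: morphism_diagonals.
by move=> y i; have [t [_ ->]] := fphi y; rewrite coef_tagged a0.
Qed.

Lemma morphism_monomials a : monomials F a -> monomials F' (phi a).
Proof.
move=> Ma y; have [t [tinj tE]] := fphi y; split=> i j k; rewrite !tE => h1 h2; apply: tinj.
  exact: coef_monomial_row Ma h1 h2.
exact: coef_monomial_col Ma h1 h2.
Qed.

Lemma morphism_proj (fF : full F) (fF' : full F') a :
  phi (diag_proj fF a) = diag_proj fF' (phi a).
Proof.
apply: (fev_inj (F := F')) => y; rewrite fev_diag_proj; have [t [tinj tE]] := fphi y.
apply/matrixP => i j; rewrite dpartE !tE; have [<-|ij] := eqVneq i j.
  by rewrite !coef_tagged fev_diag_proj dpartE eqxx.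
by rewrite coef_diag ?(inj_eq tinj) //; exact: diag_proj_diag.
Qed.
End Morphisms.

Definition decomposes (R : realType) (A A' : cstarType R)
    (F : matrix_field A) (F' : matrix_field A') (phi : A -> A') :=
  forall y : fbase F', exists (k : nat) (x : 'I_k -> fbase F),
    injective x /\
    unitarily_equivalent (fun a => fev y (phi a)) (fun a => \mxdiag_(mu < k) fev (x mu) a).

Section Step.
Variables (R : realType) (A A' : cstarType R).
Variables (F : matrix_field A) (F' : matrix_field A') (phi : A -> A').
Hypothesis dphi : decomposes F F' phi.

Section Isometry.
Hypothesis phi_hom : star_hom phi.
Hypothesis phi_inj : injective phi.

(* If [cnorm (phi a) < opnorm (fev x0 a)], a bump function supported where this
   inequality holds vanishes at all the points occurring in [phi], contradicting
   injectivity. *)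
Lemma decomposition_isometry a : cnorm (phi a) = cnorm a.
Proof.
have phi0 : phi 0 = 0.
  have [hl _ _] := phi_hom; have := hl (-1) 0 0.
  by rewrite !scaleN1r oppr0 addr0 addNr.
apply/le_anti/andP; split.
  apply: (fev_norm (m0 := F')) => [|y]; first exact: cnorm_ge0.
  have [k [x [_ [U [UU' U'U ->]]]]] := dphi y.
  rewrite -{1}(trmxCK U) opnorm_conj ?trmxCK //.
  by apply: opnorm_mxdiag_le => [|mu]; [exact: cnorm_ge0|exact: fev_norm_le].
apply: (fev_norm (m0 := F)) => [|x0]; first exact: cnorm_ge0.
rewrite leNgt; apply/negP => hx.
have nU : \forall x \near x0, cnorm (phi a) < opnorm (fev x a).
  by apply: (cvgr_gt _ (@fev_continuous _ _ F a x0)).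
have [g [cg gx g01 gU]] := scalar_bump nU.
have [u ug] := fev_scalar cg.
have u0 : phi u <> 0.
  rewrite -phi0 => /phi_inj u0; have := ug x0; rewrite u0 fev0 gx => h.
  (* Equality of 1 and 0 would make the fibre at [x0] trivial, but [hx] gives it an element of
     positive norm. *)
  have h' : (1%:M : 'M[R[i]]_(frank x0)) = 0 := esym h.
  by move: hx; rewrite -[fev x0 a]mul1mx h' mul0mx opnorm0 ltNge cnorm_ge0.
apply: u0; apply: (fev_inj (F := F')) => y; rewrite fev0.
have [k [x [_ [U [UU' U'U UE]]]]] := dphi y.
have gx0 mu : g (x mu) = 0.
  apply: gU => /=; apply/negP; rewrite -leNgt.
  apply: (le_trans (opnorm_mxdiag_ge (fun mu => fev (x mu) a) mu)).
  have -> : \mxdiag_mu fev (x mu) a = U ^t* *m fev y (phi a) *m U.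
    by rewrite UE !mulmxA U'U mul1mx -mulmxA U'U mulmx1.
  by rewrite opnorm_conj // fev_norm_le.
rewrite UE; have -> : \mxdiag_mu fev (x mu) u = \mxdiag_mu (0%:M : 'M[R[i]]_(frank (x mu))).
  by apply: eq_mxdiag => mu; rewrite ug gx0.
by rewrite mxdiagZ -scalemx1 scale0r mulmx0 mul0mx.
Qed.
End Isometry.

Variables (V : forall x : fbase F, 'M[R[i]]_(frank x)) (hV : unitary_frame V).

(** The new frame is [U *m G], with [G] the block sum of the old frames. A repeated point would give
    two indices the same basis vector, so injectivity of [x] is what makes [t] injective. *)
Lemma block_frame m k (x : 'I_k -> fbase F) (f : A -> 'M[R[i]]_m)
    (U : 'M[R[i]]_(m, \sum_mu frank (x mu))) : injective x ->
  U *m U ^t* = 1%:M -> U ^t* *m U = 1%:M ->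
  (forall a, f a = U *m (\mxdiag_mu fev (x mu) a) *m U ^t*) ->
  exists W : 'M[R[i]]_m, [/\ W *m W ^t* = 1%:M, W ^t* *m W = 1%:M &
    exists t : 'I_m -> {x : fbase (frame_field hV) & 'I_(frank x)}, injective t /\
      forall a i j, (W ^t* *m f a *m W) i j = coef a (t i) (t j)].
Proof.
move=> xinj UU' U'U; have e := unitary_dim UU' U'U.
case: _ / e f U UU' U'U => f U UU' U'U fE.
pose G := \mxdiag_mu V (x mu).
have GG' : G *m G ^t* = 1%:M.
  by rewrite mxdiag_star mxdiag_mul -mxdiagZ; apply: eq_mxdiag => mu; rewrite hV.1.
have G'G : G ^t* *m G = 1%:M.
  by rewrite mxdiag_star mxdiag_mul -mxdiagZ; apply: eq_mxdiag => mu; rewrite hV.2.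
exists (U *m G); split.
- by rewrite trmx_mul map_mxM mulmxA -(mulmxA U) GG' mulmx1.
- by rewrite trmx_mul map_mxM mulmxA -(mulmxA _ _ U) U'U mulmx1.
exists (fun s => Tagged (fun x : fbase (frame_field hV) => 'I_(frank x)) (tagnat.sig2 s : 'I_(frank (x (tagnat.sig1 s))))).
split.
  move=> s s' e; rewrite -(tagnat.sigK s) -(tagnat.sigK s'); congr tagnat.rank.
  move: e; rewrite /tagnat.sig1 /tagnat.sig2.
  case: (tagnat.sig s) (tagnat.sig s') => [al u] [be v] /= e.
  have := congr1 tag e => /= /xinj ab; case: _ / ab v e => v e.
  by congr existT; exact: (existT_inj2 e).
move=> a s t'.
have -> : (U *m G) ^t* *m f a *m (U *m G) = \mxdiag_mu conj_ev V (x mu) a.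
  rewrite fE trmx_mul map_mxM !mulmxA -(mulmxA _ (U ^t*) U) U'U mulmx1.
  rewrite -(mulmxA _ (U ^t*) U) U'U mulmx1.
  by rewrite mxdiag_star !mxdiag_mul.
rewrite mxE; move: (tagnat.sig2 s) (tagnat.sig2 t').
move: (tagnat.sig1 s) (tagnat.sig1 t') => al be u v.
have [e|ne] := eqVneq al be.
  by case: _ / e v => v; rewrite conform_mx_id coefE.
by rewrite mxE /coef /= (inj_eq xinj) (negPf ne).
Qed.

(** A diagonal prescribed at [y] is already attained on the image of [phi]: its entries are
    interpolated at the basis vectors [t i] and the result is pushed forward. *)
Lemma frame_step : full (frame_field hV) ->
  exists V' : (forall y : fbase F', 'M[R[i]]_(frank y)), exists hV' : unitary_frame V',
    full (frame_field hV') /\ field_morphism (frame_field hV) (frame_field hV') phi.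
Proof.
move=> fF.
have h (y : fbase F') : exists W : 'M[R[i]]_(frank y), [/\ W *m W ^t* = 1%:M, W ^t* *m W = 1%:M &
    exists t : 'I_(frank y) -> {x : fbase (frame_field hV) & 'I_(frank x)}, injective t /\
      forall a i j, (W ^t* *m fev y (phi a) *m W) i j = coef a (t i) (t j)].
  by have [k [x [xinj [U [UU' U'U UE]]]]] := dphi y; exact: block_frame xinj UU' U'U UE.
pose V' y := sval (cid (h y)).
have hV' : unitary_frame V' by split=> y; rewrite /V'; case: (svalP (cid (h y))).
have mor : field_morphism (frame_field hV) (frame_field hV') phi.
  by move=> y; rewrite /= /conj_ev /V'; case: (svalP (cid (h y))).
exists V', hV'; split=> // y d; have [t [tinj tE]] := mor y.
have [a Da aE] := interpolation fF (d 0) tinj.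
exists (phi a); first exact: morphism_diagonals mor _ Da.
apply/matrixP => i j; rewrite tE !mxE; have [<-|ij] := eqVneq i j; first by rewrite aE.
by rewrite coef_diag // (inj_eq tinj).
Qed.
End Step.

(** * The inductive limit *)

Section Union.
Variables (R : realType) (A : nat -> cstarType R) (phi : forall n, A n -> A n.+1).
Variables (L : cstarType R) (psi : forall n, A n -> L).
Variables (D N C : forall n, set (A n)) (P : forall n, A n -> A n).
Hypothesis system : forall n, diagonal_system setT (@D n) (@N n) (@C n) (@P n).
Hypothesis phi_diag : forall n a, D a -> D (phi (n := n) a).
Hypothesis phi_norm : forall n a, N a -> N (phi (n := n) a).
Hypothesis phi_pos : forall n a, C a -> C (phi (n := n) a).
Hypothesis phi_proj : forall n a, phi (P a) = P (phi (n := n) a).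
Hypothesis phi1 : forall n, phi (1 : A n) = 1.
Hypothesis psi_hom : forall n, star_hom (@psi n).
Hypothesis psi_phi : forall n a, psi (phi (n := n) a) = psi a.
Hypothesis psi_iso : forall n a, cnorm (@psi n a) = cnorm a.
Hypothesis psi_dense : closure (\bigcup_n range (@psi n)) = setT.

Let psiZD n (c : R[i]) a b : psi (c *: a + b) = c *: psi a + @psi n b.
Proof. by have [h _ _] := psi_hom n; rewrite h. Qed.

Let psiM n a b : psi (a * b) = psi a * @psi n b.
Proof. by have [_ h _] := psi_hom n. Qed.

Let psiS n a : psi (star a) = star (@psi n a).
Proof. by have [_ _ h] := psi_hom n. Qed.

Let psiD n a b : psi (a + b) = psi a + @psi n b.
Proof. by rewrite -[a]scale1r psiZD !scale1r. Qed.

Let psi0 n : @psi n 0 = 0.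
Proof. by apply: (addrI (@psi n 0)); rewrite -psiD !addr0. Qed.

Let psiB n a b : psi (a - b) = psi a - @psi n b.
Proof. by rewrite addrC -scaleN1r psiZD scaleN1r addrC. Qed.

Let psi_inj n : injective (@psi n).
Proof.
move=> a b e; apply/eqP; rewrite -subr_eq0; apply/eqP/cnorm0_eq0.
by rewrite -psi_iso psiB e subrr cnorm0.
Qed.

Definition increasing (S : forall n, set (A n)) := forall n a, S n a -> S n.+1 (phi a).

Definition union_of (S : forall n, set (A n)) : set L := \bigcup_n (@psi n) @` S n.

Lemma union_lift (S : forall n, set (A n)) x : increasing S -> union_of S x ->
  exists n0, forall n, (n0 <= n)%N -> exists2 a : A n, S n a & psi a = x.
Proof.
move=> hS [m _ [a Sa <-]]; exists m => n /subnK <-.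
elim: (n - m)%N => [|k [b Sb <-]]; first by exists a.
by exists (phi b); [exact: hS|exact: psi_phi].
Qed.

Lemma union_lift2 (S T : forall n, set (A n)) x y : increasing S -> increasing T ->
  union_of S x -> union_of T y ->
  exists n (a b : A n), [/\ S n a, T n b, psi a = x & psi b = y].
Proof.
move=> hS hT /(union_lift hS)[m hm] /(union_lift hT)[k hk].
have [a Sa xa] := hm (maxn m k) (leq_maxl _ _); have [b Tb yb] := hk (maxn m k) (leq_maxr _ _).
by exists (maxn m k), a, b.
Qed.

Lemma union_lift3 (S T V : forall n, set (A n)) x y z :
  increasing S -> increasing T -> increasing V ->
  union_of S x -> union_of T y -> union_of V z ->
  exists n (a b c : A n), [/\ S n a, T n b, V n c & [/\ psi a = x, psi b = y & psi c = z]].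
Proof.
move=> hS hT hV /(union_lift hS)[m hm] /(union_lift hT)[k hk] /(union_lift hV)[l hl].
pose M := maxn (maxn m k) l.
have mM : (m <= M)%N by apply: leq_trans (leq_maxl m k) (leq_maxl _ l).
have kM : (k <= M)%N by apply: leq_trans (leq_maxr m k) (leq_maxl _ l).
have [a Sa xa] := hm M mM; have [b Tb yb] := hk M kM; have [c Vc zc] := hl M (leq_maxr _ _).
by exists M, a, b, c.
Qed.

Lemma unionW (S : forall n, set (A n)) n a : S n a -> union_of S (psi a).
Proof. by move=> Sa; exists n => //; exists a. Qed.

Let T n : set (A n) := setT.
Let U := union_of T.

Let incT : increasing T. Proof. by []. Qed.

Let UW n (a : A n) : U (psi a). Proof. exact: (unionW (S := T)). Qed.

(** The implication sits inside the existential so that choice gives a total map, with junk values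
    outside the union. *)
Let P_exists x : exists y, U x -> exists n (a : A n), x = psi a /\ y = psi (P a).
Proof.
have [[n _ [a _ <-]]|h] := boolp.pselect (U x); last by exists 0.
by exists (psi (P a)) => _; exists n, a.
Qed.

Let PU x := sval (cid (P_exists x)).

(** Independence of the representative: two representatives are compared at the later of their
    stages, where [psi] is injective, and [phi] commutes with the projections. *)
Let PUE n (a : A n) : PU (psi a) = psi (P a).
Proof.
rewrite /PU; case: cid => y /= /(_ (UW a))[m [b [ab ->]]].
have grow k j (c : A k) : exists c' : A (j + k), psi c = psi c' /\ psi (P c) = psi (P c').
  elim: j => [|j [c' [e1 e2]]]; first by exists c.
  by exists (phi c'); rewrite psi_phi -phi_proj psi_phi.
have key k j (c : A k) (d : A j) : (k <= j)%N -> psi c = psi d -> psi (P c) = psi (P d).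
  move=> /subnK kj; have [c' [-> ->]] := grow k (j - k)%N c.
  move: (j - k)%N kj c' => l kj; by case: j / kj d => d c' e; rewrite (psi_inj e).
have [mn|/ltnW nm] := leqP m n; first by apply: key.
by apply/esym/key.
Qed.

(** [psi] is not assumed unital, but the image of 1 is a left unit on the dense union. *)
Let psi1 n : @psi n 1 = 1.
Proof.
suff h x : @psi n 1 * x = x by rewrite -[LHS]mulr1 h.
have : closure U x.
  by rewrite /U /union_of /T psi_dense.
have inc1 : increasing (fun n => [set 1 : A n]) by move=> m a /= ->.
move=> /closure_tendsP[u Uu ux].
apply: (tends_unique (u := fun k => psi 1 * u k)) => //.
  exact: (tendsM (tends_cst (@psi n 1)) ux).
rewrite (_ : (fun k => _) = u) //; apply/funext => k.
have U1 : union_of (fun n => [set 1 : A n]) (@psi n 1) by exists n => //; exists 1.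
have [m [a [b [a1 _ <- <-]]]] := union_lift2 inc1 incT U1 (Uu k).
by rewrite -psiM a1 mul1r.
Qed.

Lemma union_subalgebra (S : forall n, set (A n)) : increasing S ->
  (forall n, star_subalgebra (@S n)) -> star_subalgebra (union_of S).
Proof.
move=> hS sS; split.
- by rewrite -(psi1 0); apply: unionW; exact: subalg1.
- move=> c x y Ux Uy; have [n [a [b [Sa Sb <- <-]]]] := union_lift2 hS hS Ux Uy.
  by rewrite -psiZD; apply: unionW; apply: (subalgZD (sS n)).
- move=> x y Ux Uy; have [n [a [b [Sa Sb <- <-]]]] := union_lift2 hS hS Ux Uy.
  by rewrite -psiM; apply: unionW; apply: (subalgM (sS n)).
- move=> _ [n _ [a Sa <-]].
  by rewrite -psiS; apply: unionW; apply: (subalgS (sS n)).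
Qed.

(** The elements in each condition lie in a common stage, where it holds, and [psi] is isometric. In
    the faithfulness estimate it is enough to test with [v] from the stage of [a]. *)
Lemma union_system : diagonal_system U (union_of D) (union_of N) (union_of C) PU.
Proof.
split.
- by apply: union_subalgebra => // n; exact: setT_subalgebra.
- by apply: union_subalgebra => // n; exact: (ds_diag (system n)).
- by move=> _ [n _ [a _ <-]].
- move=> x y Ux Uy; have [n [a [b [Da Db <- <-]]]] := union_lift2 phi_diag phi_diag Ux Uy.
  by rewrite -!psiM (ds_diag_comm (system n) Da Db).
- move=> c x y Ux Uy; have [n [a [b [_ _ <- <-]]]] := union_lift2 incT incT Ux Uy.
  by rewrite -psiZD !PUE (ds_projZD (system n)) // psiZD.
- by move=> _ [n _ [a _ <-]]; rewrite PUE; apply/unionW/(ds_proj_diag (system n)).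
- by move=> _ [n _ [a Da <-]]; rewrite PUE (ds_proj_id (system n)).
- by move=> _ [n _ [a _ <-]]; rewrite PUE !psi_iso (ds_proj_norm (system n)).
- move=> x y z Ux Uy Uz.
  have [n [d [a [e [Dd _ De [<- <- <-]]]]]] := union_lift3 phi_diag incT phi_diag Ux Uy Uz.
  by rewrite -!psiM !PUE (ds_proj_bimod (system n)) // !psiM.
- move=> _ [n _ [a _ <-]]; have [c [Cc ec]] := ds_proj_pos (system n) (I : setT a).
  by exists (psi c); split; [exact: unionW|rewrite -!psiS -!psiM PUE ec].
- by move=> _ [n _ [a Ca <-]]; apply/unionW/(ds_pos_diag (system n)).
- move=> x y Ux Uy; have [n [a [b [Ca Cb <- <-]]]] := union_lift2 phi_pos phi_pos Ux Uy.
  by rewrite -!psiS -!psiM -!psiB !psi_iso (ds_pos_dist (system n)).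
- move=> x y Ux Uy; have [n [a [b [Da Db <- <-]]]] := union_lift2 phi_diag phi_diag Ux Uy.
  by rewrite -!psiS -!psiM -psiD !psi_iso (ds_diag_mono (system n)).
- move=> _ [n _ [a Da <-]]; rewrite -psiS psi_iso => /psi_inj sa a1.
  have [e [De eE]] := ds_diag_sqrt (system n) Da sa a1.
  by exists (psi e); split; [exact: unionW|rewrite -psiS -psiM -eE psiD psi1].
- by move=> _ [n _ [a _ <-]].
- move=> x y Ux Uy; have [n [a [b [Na Db <- <-]]]] := union_lift2 phi_norm phi_diag Ux Uy.
  have [h1 h2] := ds_norm_diag (system n) Na Db.
  by rewrite -!psiS -!psiM; split; exact: unionW.
- move=> x y Ux Uy; have [n [a [b [Na _ <- <-]]]] := union_lift2 phi_norm incT Ux Uy.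
  by rewrite -!psiS -!psiM !PUE (ds_norm_proj (system n)) // !psiM.
- move=> _ e [n _ [a _ <-]] e0.
  have [k [t [ht tn]]] := ds_span (system n) (I : setT a) e0.
  exists k, (fun i => psi (t i)); split=> [i|]; last first.
    by rewrite -(big_morph (@psi n) (@psiD n) (@psi0 n)) -psiB psi_iso.
  have [Nt h] := ht i; split; first exact: unionW.
  case: h => [Dt|[p [b [q [Dp _ Dq pq ->]]]]]; [left; exact: unionW|right].
  exists (psi p), (psi b), (psi q); split; try exact: unionW.
  + by rewrite -psiM pq psi0.
  + by rewrite !psiM.
- move=> _ c [n _ [a _ <-]] h; rewrite psi_iso; apply: (ds_proj_faithful (system n)) => // v _ v2.
  by have := h (psi v) (UW v); rewrite psi_iso -!psiS -!psiM PUE psi_iso; apply.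
Qed.

Lemma union_diagonal : exists B : set L, cstar_diagonal B.
Proof. by exists (closure (union_of D)); apply: (diagonal_system_diagonal union_system). Qed.
End Union.

Theorem theorem1 (R : realType) (A : nat -> cstarType R)
    (H : forall n, homogeneous_sum (A n))
    (phi : forall n, A n -> A n.+1)
    (L : cstarType R) (psi : forall n, A n -> L) :
  (forall n, unital_star_hom (phi n)) ->
  (forall n, injective (phi n)) ->
  (forall n, maximally_homogeneous (H n) (H n.+1) (phi n)) ->
  inductive_limit phi psi ->
  (exists B : set (A 0), cstar_diagonal B) ->
  exists B : set L, cstar_diagonal B.
Proof.
move=> phi_hom phi_inj phi_max [psi_hom psi_phi psi_lim psi_dense] [B hB].
pose F n := spectrum_field (H n).
have dec n : decomposes (F n) (F n.+1) (phi n) by exact: phi_max.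
pose frame n := {V : forall x : fbase (F n), 'M[R[i]]_(frank x) |
  exists hV : unitary_frame V, full (frame_field hV)}.
have base : frame 0.
  apply: cid; have [V [hV BV]] := cstar_diagonal_frame (F 0) hB; exists V, hV.
  by have [[sB mB _ _] uB] := hB; apply: (diagonal_full sB mB uB).
(* A [frame] hides its proof of unitarity, so the morphism property is stated for every such
   proof. *)
have step n (V : frame n) : {V' : frame n.+1 |
    forall (hV : unitary_frame (sval V)) (hV' : unitary_frame (sval V')),
    field_morphism (frame_field hV) (frame_field hV') (phi n)}.
  apply: cid; case: V => V [hV fV].
  have [V' [hV' [fV' m]]] := frame_step (dec n) fV.
  exists (exist _ V' (ex_intro _ hV' fV')) => /= hV1 hV1'.
  exact: m.
pose V := fix V n : frame n := if n is m.+1 then sval (step m (V m)) else base.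
have hV n : unitary_frame (sval (V n)) by case: (svalP (V n)).
pose G n := frame_field (hV n).
have fG n : full (G n).
  by case: (svalP (V n)) => h; rewrite (Prop_irrelevance h (hV n)).
have mor n : field_morphism (G n) (G n.+1) (phi n) := svalP (step n (V n)) (hV n) (hV n.+1).
have iso n a : cnorm (phi n a) = cnorm a.
  by apply: (decomposition_isometry (dec n)); [case: (phi_hom n)|exact: phi_inj].
have conn n m (a : A n) : cnorm (connecting phi m a) = cnorm a.
  by elim: m => [//|m IH] /=; rewrite iso.
have psi_iso n (a : A n) : cnorm (psi n a) = cnorm a.
  (* The connecting maps are isometric, so the sequence defining the limit seminorm is constant. *)
  have := psi_lim n a; rewrite (_ : (fun m => _) = fun=> cnorm a).
    by move=> h; rewrite -(cvg_lim _ h) // lim_cst.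
  by apply/funext => m; rewrite conn.
apply: (union_diagonal (fun n => matrix_field_system (fG n)) _ _ _ _ _ psi_hom psi_phi psi_iso psi_dense).
- by move=> n a; apply: morphism_diagonals (mor n) a.
- by move=> n a; apply: morphism_monomials (mor n) a.
- by move=> n a; apply: morphism_positives (mor n) a.
- by move=> n a; apply: morphism_proj.
- by move=> n; case: (phi_hom n).
Qed.
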